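(* Let $\theta\in[\frac{\pi}{3},\frac{2\pi}{3}]$ and let $$u_1=\frac{\sin(\frac{5\pi}{4})\sin(\frac{5\pi}{8}+\frac{3\theta}{8})}{\sin(\frac{5\pi}{4}+\frac{3\theta}{8})\sin(\frac{5\pi}{8}-\frac{3\theta}{8})},\qquad u_2=\frac{\sin(\frac{5\pi}{4})\sin(\frac{3\theta}{8})}{\sin(\frac{5\pi}{4}+\frac{3\theta}{8})\sin(\frac{5\pi}{8}-\frac{3\theta}{8})},$$ $$v=\frac{\sin(\frac{5\pi}{8}+\frac{3\theta}{8})\sin(-\frac{3\theta}{8})}{\sin(\frac{5\pi}{4}+\frac{3\theta}{8})\sin(\frac{5\pi}{8}-\frac{3\theta}{8})},$$ $$w_1=\frac{\sin(\frac{5\pi}{8}+\frac{3\theta}{8})\sin(\frac{5\pi}{4}-\frac{3\theta}{8})}{\sin(\frac{5\pi}{4}+\frac{3\theta}{8})\sin(\frac{5\pi}{8}-\frac{3\theta}{8})},\qquad w_2=\frac{\sin(\frac{15\pi}{8}+\frac{3\theta}{8})\sin(-\frac{3\theta}{8})}{\sin(\frac{5\pi}{4}+\frac{3\theta}{8})\sin(\frac{5\pi}{8}-\frac{3\theta}{8})}.$$ Let $k,m$ be any positive integers (possibly different from each other), and define the length $|\gamma|$ of a self-avoiding walk $\gamma$ on $\Lambda$ as the sum of the lengths of its pieces, where each arc of angle $\theta$ has length $1$, each arc of angle $\pi-\theta$ has length $k$, and each straight segment has length $m$. Let $\tilde c_n=\frac{1}{u_1^n}\sum_{|\gamma|=n}\omega(\gamma)$,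 the sum being over self-avoiding walks $\gamma$ on $\Lambda$ starting at $0$ with $|\gamma|=n$. Then $\lim_{n\to\infty}\sqrt[n]{\tilde c_n}$ exists and is equal to $\frac{1}{u_1}$.
   Context: For $\theta\in[\frac{\pi}{3},\frac{2\pi}{3}]$, $\Lambda$ is the skewed $\mathbb{Z}^2$ lattice in the plane: all edges have length $1$ and every face (plaquet) is a rhombus with angles $\theta$ and $\pi-\theta$ (all rhombi are translates of one another). A self-avoiding walk on $\Lambda$ is a (directed) non-self-intersecting curve starting and ending at midpoints of edges, crossing edges only at their midpoints and at right angles, visiting each edge midpoint at most once, and whose intersection with each rhombus is one of the following: nothing; one straight line connecting the midpoints of two opposite sides; one arc connecting the midpoints of two adjacent sides (i.e. surrounding their common vertex); or two disjoint arcs surrounding two opposite vertices. In particular a walk may visit the same rhombus twice. An arc surrounding a vertex at which the rhombus has angle $\theta$ (resp. $\pi-\theta$) is called an arc of angle $\theta$ (resp. $\pi-\theta$). The empty walk (a single midpoint) is allowed. Given numbers $u_1,u_2,v,w_1,w_2$, the weight $\omega(r)$ of a rhombus $r$ is: $1$ if it is empty; $u_1$ if it contains exactly one arc, of angle $\theta$; $u_2$ if it contains exactly one arc, of angle $\pi-\theta$; $v$ if it contains a straight line; $w_1$ if it contains two arcs of angle $\theta$; $w_2$ if it contains two arcs of angle $\pi-\theta$. The weight of a walk is $\omega(\gamma)=\prod_{r}\omega(r)$, the product over all rhombi $r$ of $\Lambda$. One edge midpoint of $\Lambda$ is fixed and denoted $0$. *)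

(* Defs.v *)
From mathcomp Require Import all_boot all_order all_algebra.
From mathcomp Require Import all_classical all_reals all_analysis.

Set Implicit Arguments.
Unset Strict Implicit.
Unset Printing Implicit Defensive.

Import Order.TTheory GRing.Theory Num.Theory.

Local Open Scope classical_set_scope.
Local Open Scope ring_scope.

(* The vertex (i, j) of the lattice is the point i + j exp(I theta) of the
   plane.  The rhombus (i, j) has vertices (i, j), (i+1, j), (i+1, j+1) and
   (i, j+1), called SW, SE, NE, NW; its angle is theta at SW and NE and
   pi - theta at SE and NW. *)
Definition rhombus : Type := (int * int)%type.

(* An edge stands for its midpoint.  [hedge i j] joins (i, j) to (i+1, j) and
   [vedge i j] joins (i, j) to (i, j+1). *)
Definition edge : Type := (bool * (int * int))%type.

Definition hedge (i j : int) : edge := (false, (i, j)).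
Definition vedge (i j : int) : edge := (true, (i, j)).

Definition south (r : rhombus) : edge := hedge r.1 r.2.
Definition north (r : rhombus) : edge := hedge r.1 (r.2 + 1).
Definition west (r : rhombus) : edge := vedge r.1 r.2.
Definition east (r : rhombus) : edge := vedge (r.1 + 1) r.2.

(* The six ways of joining two sides of a rhombus: an arc is named after the
   vertex it surrounds, a straight line after the sides it joins. *)
Inductive piece := ArcSW | ArcNE | ArcSE | ArcNW | LineSN | LineWE.

Definition ends (r : rhombus) (p : piece) : edge * edge :=
  match p with
  | ArcSW => (south r, west r)
  | ArcNE => (north r, east r)
  | ArcSE => (south r, east r)
  | ArcNW => (north r, west r)
  | LineSN => (south r, north r)
  | LineWE => (west r, east r)
  end.

(* A walk is encoded by the nonempty sequence of the midpoints it visits, in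
   order; two distinct midpoints are sides of at most one common rhombus, so
   this sequence determines the pieces. *)
Definition steps (g : seq edge) : seq (edge * edge) := zip g (behead g).

Definition joined (g : seq edge) (ab : edge * edge) : bool :=
  ((ab.1, ab.2) \in steps g) || ((ab.2, ab.1) \in steps g).

(* The intersection of the walk with a rhombus; the order of the list is the
   fixed one below, whatever the order and direction in which the pieces are
   travelled. *)
Definition trace (g : seq edge) (r : rhombus) : seq piece :=
  [seq p <- [:: ArcSW; ArcNE; ArcSE; ArcNW; LineSN; LineWE]
     | joined g (ends r p)].

Definition admissible (t : seq piece) : bool :=
  match t with
  | [::] | [:: _] | [:: ArcSW; ArcNE] | [:: ArcSE; ArcNW] => true
  | _ => false
  end.

(* That the walk crosses each inner edge (rather than turning back into the
   rhombus it comes from) follows from admissibility: two pieces sharing a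
   midpoint never lie in the same rhombus. *)
Definition is_saw (g : seq edge) : Prop :=
  [/\ g != [::],
      uniq g,
      forall a b, (a, b) \in steps g ->
        exists r p, ends r p = (a, b) \/ ends r p = (b, a)
    & forall r, admissible (trace g r)].

Definition piece_length (k m : nat) (p : piece) : nat :=
  match p with
  | ArcSW | ArcNE => 1
  | ArcSE | ArcNW => k
  | LineSN | LineWE => m
  end.

Definition walk_length (k m : nat) (g : seq edge) : nat :=
  \big[addn/0%N]_(r \in [set: rhombus])
    (\sum_(p <- trace g r) piece_length k m p)%N.

(* The last case, irrelevant for self-avoiding walks, is the non-admissible
   one. *)
Definition rhombus_weight (R : realType) (u1 u2 v w1 w2 : R) (t : seq piece)
    : R :=
  match t with
  | [::] => 1
  | [:: ArcSW] | [:: ArcNE] => u1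
  | [:: ArcSE] | [:: ArcNW] => u2
  | [:: LineSN] | [:: LineWE] => v
  | [:: ArcSW; ArcNE] => w1
  | [:: ArcSE; ArcNW] => w2
  | _ => 0
  end.

Definition walk_weight (R : realType) (u1 u2 v w1 w2 : R) (g : seq edge) : R :=
  \big[*%R/1]_(r \in [set: rhombus])
    rhombus_weight u1 u2 v w1 w2 (trace g r).

Definition saws_from (k m : nat) (o : edge) (n : nat) : set (seq edge) :=
  [set g | [/\ is_saw g, ohead g = Some o & walk_length k m g = n]].

Definition c_tilde (R : realType) (u1 u2 v w1 w2 : R) (k m : nat) (o : edge)
    (n : nat) : R :=
  (u1 ^+ n)^-1 *
  \sum_(g \in saws_from k m o n) walk_weight u1 u2 v w1 w2 g.

Section Weights.
Variables (R : realType) (theta : R).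

Definition weight_denom : R :=
  sin (5 * pi / 4 + 3 * theta / 8) * sin (5 * pi / 8 - 3 * theta / 8).

Definition weight_u1 : R :=
  sin (5 * pi / 4) * sin (5 * pi / 8 + 3 * theta / 8) / weight_denom.

Definition weight_u2 : R :=
  sin (5 * pi / 4) * sin (3 * theta / 8) / weight_denom.

Definition weight_v : R :=
  sin (5 * pi / 8 + 3 * theta / 8) * sin (- (3 * theta / 8)) / weight_denom.

Definition weight_w1 : R :=
  sin (5 * pi / 8 + 3 * theta / 8) * sin (5 * pi / 4 - 3 * theta / 8)
  / weight_denom.

Definition weight_w2 : R :=
  sin (15 * pi / 8 + 3 * theta / 8) * sin (- (3 * theta / 8)) / weight_denom.

End Weights.

(* Main.v *)
(* With these weights the observable that gives a walk ending on a horizontal or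
   vertical edge the phase exp(- 5i W / 8), where W is its total turning, sums to
   zero around every rhombus: walks entering the rhombus cancel against their
   continuations, and walks making a loop cancel against the walk that runs
   through the loop backwards. Summing over a box and letting it widen gives
   c A_T + B_T = 1 for the total weights A_T of the arcs and B_T of the bridges of
   a strip of height T, provided that the walks are summable. Cutting arcs at
   their last visit to the top row gives A_(T+1) - A_T <= C B_T B_(T+1), so that
   1 / B_T grows at most linearly and the sum of the B_T diverges, a
   contradiction: at the critical weights the walks are not summable.

   Conversely B_T <= 1. Multiplying the weight by x^length with x < 1 makes
   the bridges of height T weigh at most x^T, and the decomposition of walks into
   bridges, which needs w1 <= u1^2 and w2 <= u2^2, shows that the walks become
   summable. Hence the total weight of the walks of length n is at most
   C x^(- n). If the bridges of length 2n weighed less than y^n for all n, with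
   y < 1, the same decomposition would make the walks summable at the critical
   weights; so some bridges are heavy, and concatenating them bounds the total
   weight of the walks of length n from below. *)

(* The obstacle is topological: cancelling a loop against its reverse needs the exact turning of the
   loop, and the boundary terms need that of a walk ending on a wall. In place of the Jordan curve
   theorem, a discrete form of Hopf's theorem on tangents is used: the turning is read off the
   rotation of secants, and secants can be slid along any piece that the walk does not meet.
   Rotations count eighths of a turn between integer vectors, so that each elementary move is a
   finite check. Turning counts signed quarter turns, arcs of both angles alike; [theta] is left to
   the phase and the weights, and its range is the one where [w1] and [w2] are nonnegative.
   Weighting by x^length merely rescales the five weights and preserves w1 <= u1^2 and w2 <= u2^2,
   so that k and m enter only through the bound of the height of a bridge by its length. The lower
   bound uses bridges of even length because there may be no others (k odd, m even); one arc of
   angle theta, of length 1 for all k and m, supplies the odd lengths. *)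
From HB Require Import structures.
Require Import Defs.
From mathcomp Require Import all_boot all_order all_algebra.
From mathcomp Require Import all_classical all_reals all_analysis.
From mathcomp Require Import zify ring lra.

Set Implicit Arguments.
Unset Strict Implicit.
Unset Printing Implicit Defensive.

Import Order.TTheory GRing.Theory Num.Theory.
Import numFieldNormedType.Exports.

Local Open Scope classical_set_scope.
Local Open Scope ring_scope.

(** * Rotations between integer vectors *)

(* Directions in eighths of a turn: the half-axes get the even values and the
   open quadrants the odd ones. *)
Definition sector (x y : int) : int :=
  if y == 0 then (if 0 < x then 0 else 4)
  else if 0 < y then (if 0 < x then 1 else if x == 0 then 2 else 3)
  else (if x < 0 then 5 else if x == 0 then 6 else 7).

(** The difference of sectors is brought back to the closed range from -4 to 4. Keeping both
    half-turns 4 and -4 as they come makes it antisymmetric. *)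
Definition rotation (x y x' y' : int) : int :=
  let t := sector x' y' - sector x y in
  if 4 < t then t - 8 else if t < -4 then t + 8 else t.

(* Adding at most 4 to [x] and to [clamp x] gives the same signs, and [clamp]
   preserves parity: this reduces [cell] to finitely many cases. *)
Definition clamp (x : int) : int :=
  if 6 < x then (if (x %% 2)%Z == 0 then 6 else 5)
  else if x < -6 then (if (x %% 2)%Z == 0 then -6 else -5) else x.

Lemma sector_clamp (x y a b : int) : `|a| <= 4 -> `|b| <= 4 ->
  sector (x + a) (y + b) = sector (clamp x + a) (clamp y + b).
Proof.
move=> ha hb.
have key u c : `|c| <= 4 -> [/\ (u + c == 0) = (clamp u + c == 0),
   (0 < u + c) = (0 < clamp u + c) & (u + c < 0) = (clamp u + c < 0)].
  move=> hc; rewrite /clamp; case: ifP => h1; first by case: ifP => _; split; lia.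
  by case: ifP => h2; [case: ifP => _|]; split; lia.
have [h1 h2 h3] := key x a ha; have [k1 k2 k3] := key y b hb.
by rewrite /sector h1 h2 h3 k1 k2.
Qed.

(** In doubled coordinates, the displacements between two sides of a rhombus: diagonal vectors for
    arcs, axis vectors for straight lines. *)
Definition step_vectors : seq (int * int) :=
  [:: (1, 1); (1, -1); (-1, 1); (-1, -1); (2, 0); (-2, 0); (0, 2); (0, -2)].

(* When its ends make the steps [e] and [f], the secant (x, y) rotates by the
   same amount whichever end moves first, unless it vanishes on the way or the
   two steps have the same midpoint. *)
Definition cell_ok (x y : int) (e f : int * int) : bool :=
  [&& ((x + y) %% 2)%Z == 0, (x != 0) || (y != 0),
      (x + f.1 != 0) || (y + f.2 != 0),
      (x + - e.1 != 0) || (y + - e.2 != 0),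
      (x + (f.1 - e.1) != 0) || (y + (f.2 - e.2) != 0) &
      (x + x != e.1 - f.1) || (y + y != e.2 - f.2)] ==>
  (rotation x y (x + f.1) (y + f.2)
   + rotation (x + f.1) (y + f.2) (x + (f.1 - e.1)) (y + (f.2 - e.2))
   == rotation x y (x + - e.1) (y + - e.2)
   + rotation (x + - e.1) (y + - e.2) (x + (f.1 - e.1)) (y + (f.2 - e.2))).

Definition small : seq int := [seq n%:Z - 6 | n <- iota 0 13].

Lemma cell_small : all (fun x => all (fun y => all (fun e => all (fun f =>
  cell_ok x y e f) step_vectors) step_vectors) small) small.
Proof. by vm_compute. Qed.

Lemma clamp_small x : clamp x \in small.
Proof.
have h : -6 <= clamp x <= 6.
  by rewrite /clamp; case: ifP => h1; [case: ifP|case: ifP => h2; [case: ifP|lia]].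
apply/mapP; exists (absz (clamp x + 6)); last by lia.
by rewrite mem_iota; lia.
Qed.

Lemma clamp_parity x : (clamp x %% 2)%Z = (x %% 2)%Z.
Proof.
rewrite /clamp; case: ifP => h1; first by case: ifP => /eqP h2; lia.
by case: ifP => h2; [case: ifP => /eqP|]; lia.
Qed.

Lemma clampD_eq0 x a : `|a| <= 4 -> (clamp x + a == 0) = (x + a == 0).
Proof.
move=> ha; rewrite /clamp; case: ifP => h1; first by case: ifP => _; lia.
by case: ifP => h2; [case: ifP => _|]; lia.
Qed.

Lemma clamp2_eq x a : `|a| <= 4 -> (clamp x + clamp x == a) = (x + x == a).
Proof.
move=> ha; rewrite /clamp; case: ifP => h1; first by case: ifP => _; lia.
by case: ifP => h2; [case: ifP => _|]; lia.
Qed.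

Lemma step_vectors_le e : e \in step_vectors -> `|e.1| <= 2 /\ `|e.2| <= 2.
Proof. by rewrite !inE => h; repeat case/orP: h => [/eqP->//|h]; move/eqP: h => ->. Qed.

Lemma cell (x y : int) (e f : int * int) :
  e \in step_vectors -> f \in step_vectors -> cell_ok x y e f.
Proof.
case: e f => [a b] [c d] he hf.
have [/= e1 e2] := step_vectors_le he; have [/= f1 f2] := step_vectors_le hf.
have l0 : `|0 : int| <= 4 by [].
have le1 : `|- a| <= 4 by lia.
have le2 : `|- b| <= 4 by lia.
have lf1 : `|c| <= 4 by lia.
have lf2 : `|d| <= 4 by lia.
have ld1 : `|c - a| <= 4 by lia.
have ld2 : `|d - b| <= 4 by lia.
have lg1 : `|a - c| <= 4 by lia.
have lg2 : `|b - d| <= 4 by lia.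
have par : ((clamp x + clamp y) %% 2)%Z = ((x + y) %% 2)%Z.
  by have := clamp_parity x; have := clamp_parity y; lia.
have /allP/(_ _ (clamp_small x))/allP/(_ _ (clamp_small y))/allP/(_ _ he)/allP/(_ _ hf) :=
  cell_small.
rewrite /cell_ok /rotation /= -!sector_clamp // !clampD_eq0 // !clamp2_eq // par.
rewrite -[in sector (clamp x) _](addr0 (clamp x)) -[in sector _ (clamp y)](addr0 (clamp y)).
rewrite -sector_clamp // !addr0.
by have := clampD_eq0 x l0; have := clampD_eq0 y l0; rewrite !addr0 => -> ->.
Qed.

(* [v] and [w] tell whether the steps [e] and [f] start from a vertical edge. *)
Definition triangle_ok (v : bool) (e f : int * int) : bool :=
  let turned (b : bool) (g : int * int) := (if b then g.1 * g.2 else - (g.1 * g.2)) in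
  let w := if e.1 * e.2 == 0 then v else ~~ v in
  (if v then e.1 != 0 else e.2 != 0) &&
  (if w then 0 < e.1 * f.1 else 0 < e.2 * f.2) ==>
  (rotation e.1 e.2 (e.1 + f.1) (e.2 + f.2) + rotation (e.1 + f.1) (e.2 + f.2) f.1 f.2
   == turned v e + turned w f).

Lemma triangle v e f : e \in step_vectors -> f \in step_vectors -> triangle_ok v e f.
Proof.
have /allP h : all (fun e => all (triangle_ok v e) step_vectors) step_vectors.
  by case: v; vm_compute.
by move=> /h/allP; apply.
Qed.

(** * Midpoints, rhombi and steps in doubled coordinates *)

(** Coordinates in the basis (1, exp(I theta)), doubled to make midpoints integral. The angle
    disappears from the combinatorics, which is that of the square lattice. *)
Definition px (e : edge) : int := if e.1 then e.2.1 *+ 2 else e.2.1 *+ 2 + 1.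
Definition py (e : edge) : int := if e.1 then e.2.2 *+ 2 + 1 else e.2.2 *+ 2.

Lemma edge_inj (a b : edge) : px a = px b -> py a = py b -> a = b.
Proof.
case: a b => [[] [i j]] [[] [k l]]; rewrite /px /py /= => hx hy; do ?lia.
  by have [-> ->] : i = k /\ j = l by lia.
by have [-> ->] : i = k /\ j = l by lia.
Qed.

Lemma px_type e : ((px e %% 2)%Z == 0) = e.1.
Proof. by case: e => [[] [i j]]; rewrite /px /=; lia. Qed.

Lemma py_type e : ((py e %% 2)%Z == 0) = ~~ e.1.
Proof. by case: e => [[] [i j]]; rewrite /py /=; lia. Qed.

Definition sides (r : rhombus) : seq edge := [:: south r; east r; north r; west r].

Definition cx (r : rhombus) : int := r.1 *+ 2 + 1.
Definition cy (r : rhombus) : int := r.2 *+ 2 + 1.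

Lemma center_inj r r' : cx r = cx r' -> cy r = cy r' -> r = r'.
Proof. by case: r r' => [i j] [k l]; rewrite /cx /cy /= => ? ?; congr pair; lia. Qed.

Lemma in_sides e r : (e \in sides r) = (`|px e - cx r| + `|py e - cy r| == 1).
Proof.
apply/idP/idP.
  rewrite !inE => /or4P[] /eqP ->; rewrite /px /py /cx /cy /=; lia.
move=> h; rewrite !inE; apply/or4P.
have ox : (cx r %% 2)%Z = 1 by rewrite /cx; lia.
have oy : (cy r %% 2)%Z = 1 by rewrite /cy; lia.
have := px_type e; have := py_type e; case h1 : e.1 => /= h2 h3.
- have hy : py e = cy r by lia.
  have [hx|hx] : px e = cx r + 1 \/ px e = cx r - 1 by lia.
    by constructor 2; apply/eqP/edge_inj; rewrite ?hx ?hy /px /py /cx /cy /=; lia.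
  by constructor 4; apply/eqP/edge_inj; rewrite ?hx ?hy /px /py /cx /cy /=; lia.
- have hy : px e = cx r by lia.
  have [hx|hx] : py e = cy r + 1 \/ py e = cy r - 1 by lia.
    by constructor 3; apply/eqP/edge_inj; rewrite ?hx ?hy /px /py /cx /cy /=; lia.
  by constructor 1; apply/eqP/edge_inj; rewrite ?hx ?hy /px /py /cx /cy /=; lia.
Qed.

Definition shared (r : rhombus) (ab : edge * edge) : bool :=
  [&& ab.1 \in sides r, ab.2 \in sides r & ab.1 != ab.2].

(** The offsets of two distinct sides from the centre add up to -1, 0 or 1 in each coordinate, so
    for the rhombus (i, j) the sums are 4 i + 2 and 4 j + 2 up to 1, and the division recovers i and
    j. *)
Definition face (ab : edge * edge) : rhombus :=
  (((px ab.1 + px ab.2) %/ 4)%Z, ((py ab.1 + py ab.2) %/ 4)%Z).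

Lemma edge_neq a b : a != b -> (px a != px b) || (py a != py b).
Proof.
by apply: contraR; rewrite negb_or !negbK => /andP[/eqP h /eqP k]; apply/eqP/edge_inj.
Qed.

Lemma shared_face r ab : shared r ab -> r = face ab.
Proof.
case: ab => a b /and3P[/= ha hb /edge_neq hn].
move: ha hb; rewrite !in_sides => ha hb.
have := px_type a; have := py_type a; have := px_type b; have := py_type b.
by move=> t1 t2 t3 t4; apply: center_inj; move: ha hb; rewrite /cx /cy /face /=; lia.
Qed.

Lemma shared_inj r r' ab : shared r ab -> shared r' ab -> r = r'.
Proof. by move=> /shared_face -> /shared_face. Qed.

Lemma shared_sym r a b : shared r (a, b) = shared r (b, a).
Proof. by rewrite /shared /= eq_sym !andbA (andbC (a \in _)). Qed.

Definition piece_ends (r : rhombus) (p : piece) (a b : edge) : Prop :=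
  ends r p = (a, b) \/ ends r p = (b, a).

Lemma ends_shared r p : shared r (ends r p).
Proof. by rewrite /shared !in_sides; case: p; rewrite /px /py /cx /cy /south /east /north /west /hedge /vedge /= ?xpair_eqE; lia. Qed.

Lemma sharedP r a b : shared r (a, b) <-> exists p, piece_ends r p a b.
Proof.
split; last first.
  by case=> p [h|h]; have := ends_shared r p; rewrite h // shared_sym.
rewrite /shared /= !inE /piece_ends => /and3P[/or4P ha /or4P hb].
case: ha => /eqP ->; case: hb => /eqP -> ; rewrite ?eqxx // => _.
- by exists ArcSE; left.
- by exists LineSN; left.
- by exists ArcSW; left.
- by exists ArcSE; right.
- by exists ArcNE; right.
- by exists LineWE; right.
- by exists LineSN; right.
- by exists ArcNE; left.
- by exists ArcNW; left.
- by exists ArcSW; right.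
- by exists LineWE; left.
- by exists ArcNW; right.
Qed.

Lemma side_neq r : uniq (sides r).
Proof.
rewrite /sides /= !inE !negb_or; case: r => i j.
by rewrite /south /east /north /west /hedge /vedge /= ?xpair_eqE; lia.
Qed.

Lemma ends_inj r p p' : (ends r p = ends r p' \/ ends r p = ((ends r p').2, (ends r p').1)) -> p = p'.
Proof. by case: r => i j; case: p; case: p' => //; rewrite /south /north /east /west /hedge /vedge /= => -[] [] *; lia. Qed.

(* Left turns count 1 and right turns -1: an arc entered through a horizontal
   edge with displacement (dx, dy) turns from (0, dy) to (dx, 0). *)
Definition turn (a b : edge) : int :=
  let p := (px b - px a) * (py b - py a) in if a.1 then p else - p.

Lemma shared_step r a b : shared r (a, b) -> (px b - px a, py b - py a) \in step_vectors.
Proof.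
rewrite /shared /= !inE => /and3P[/or4P ha /or4P hb].
case: ha => /eqP ->; case: hb => /eqP -> ; rewrite ?eqxx // => _; rewrite !xpair_eqE /px /py /=; lia.
Qed.

(** * Steps and traces of walks *)

Lemma steps_cons a b g : steps (a :: b :: g) = (a, b) :: steps (b :: g).
Proof. by []. Qed.

Lemma steps_cat p a q : steps (p ++ a :: q) = steps (rcons p a) ++ steps (a :: q).
Proof.
elim: p => [|x [|y p] IH] //.
by rewrite !rcons_cons !cat_cons !steps_cons -rcons_cons -cat_cons IH.
Qed.

Lemma steps_rcons p a b : steps (rcons (rcons p a) b) = rcons (steps (rcons p a)) (a, b).
Proof. by rewrite -cats1 cat_rcons steps_cat cats1. Qed.

Definition swap_step (ab : edge * edge) : edge * edge := (ab.2, ab.1).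

Lemma steps_rev g : steps (rev g) = rev (map swap_step (steps g)).
Proof.
elim: g => [|x [|y g] IH] //; rewrite steps_cons map_cons !rev_cons -IH.
by rewrite rev_cons steps_rcons.
Qed.

Lemma mem_steps_rev g a b : ((a, b) \in steps (rev g)) = ((b, a) \in steps g).
Proof.
rewrite steps_rev mem_rev; apply/mapP/idP => [[[c d] h [-> ->]]//|h].
by exists (b, a).
Qed.

Lemma mem_steps g a b : (a, b) \in steps g -> a \in g /\ b \in g.
Proof.
elim: g => [|x [|y g] IH] //; rewrite steps_cons inE => /orP[/eqP[-> ->]|/IH[ha hb]].
  by rewrite !inE !eqxx orbT.
by split; rewrite inE ?ha ?hb orbT.
Qed.

Lemma steps_split g a b : (a, b) \in steps g -> exists p q, g = p ++ a :: b :: q.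
Proof.
elim: g => [|x [|y g] IH] //; rewrite steps_cons inE => /orP[/eqP[-> ->]|/IH[p [q ->]]].
  by exists [::], g.
by exists (x :: p), q.
Qed.

Lemma joined_sym g a b : joined g (a, b) = joined g (b, a).
Proof. by rewrite /joined orbC. Qed.

Lemma joined_rev g ab : joined (rev g) ab = joined g ab.
Proof. by case: ab => a b; rewrite /joined /= !mem_steps_rev orbC. Qed.

Lemma joined_cat p a q ab :
  joined (p ++ a :: q) ab = joined (rcons p a) ab || joined (a :: q) ab.
Proof. by rewrite /joined steps_cat !mem_cat orbACA. Qed.

Lemma joined_in g a b : joined g (a, b) -> a \in g /\ b \in g.
Proof. by case/orP => /mem_steps[]. Qed.

Definition piece_rank (p : piece) : nat :=
  match p with
  | ArcSW => 0 | ArcNE => 1 | ArcSE => 2 | ArcNW => 3 | LineSN => 4 | LineWE => 5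
  end.

Lemma piece_rank_inj : injective piece_rank.
Proof. by case; case. Qed.

HB.instance Definition _ := Equality.copy piece (inj_type piece_rank_inj).

Definition pieces : seq piece := [:: ArcSW; ArcNE; ArcSE; ArcNW; LineSN; LineWE].

(** The half-turn of the rhombus. A line is its own opposite, so that [compatible] lets two
    different pieces coexist only when they are arcs around opposite vertices. *)
Definition opposite (p : piece) : piece :=
  match p with
  | ArcSW => ArcNE | ArcNE => ArcSW | ArcSE => ArcNW | ArcNW => ArcSE
  | LineSN => LineSN | LineWE => LineWE
  end.

Definition compatible (p p' : piece) : bool := (p == p') || (p' == opposite p).

Definition selected (c : piece -> bool) : seq piece := [seq p <- pieces | c p].

Lemma traceE g r : trace g r = selected (fun p => joined g (ends r p)).
Proof. by []. Qed.

Lemma eq_selected (c c' : piece -> bool) : c =1 c' -> selected c = selected c'.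
Proof. by move=> h; apply: eq_filter. Qed.

(** The pairwise form is inherited by any smaller selection of pieces, hence by the parts of a
    walk. *)
Lemma admissibleP (c : piece -> bool) : reflect (forall p p', c p -> c p' -> compatible p p')
  (admissible (selected c)).
Proof.
rewrite /selected /=; apply: (iffP idP) => [|h].
  case h1: (c ArcSW); case h2: (c ArcNE); case h3: (c ArcSE); case h4: (c ArcNW);
  case h5: (c LineSN); case h6: (c LineWE) => //= _ [] [];
  by rewrite ?h1 ?h2 ?h3 ?h4 ?h5 ?h6.
have k p p' : ~~ compatible p p' -> c p -> c p' = false.
  by move=> hn hp; apply/negP => hp'; rewrite h in hn.
case h1: (c ArcSW).
  by rewrite (k ArcSW ArcSE isT h1) (k ArcSW ArcNW isT h1) (k ArcSW LineSN isT h1) (k ArcSW LineWE isT h1); case: ifP.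
case h2: (c ArcNE).
  by rewrite (k ArcNE ArcSE isT h2) (k ArcNE ArcNW isT h2) (k ArcNE LineSN isT h2) (k ArcNE LineWE isT h2).
case h3: (c ArcSE).
  by rewrite (k ArcSE LineSN isT h3) (k ArcSE LineWE isT h3); case: ifP.
case h4: (c ArcNW); first by rewrite (k ArcNW LineSN isT h4) (k ArcNW LineWE isT h4).
by case h5: (c LineSN); [rewrite (k LineSN LineWE isT h5)|case: ifP].
Qed.

Lemma saw_face g a b : is_saw g -> (a, b) \in steps g -> shared (face (a, b)) (a, b).
Proof.
case=> _ _ h _ /h[r [p /= hp]].
by have /[dup] /shared_face <- : shared r (a, b) by apply/sharedP; exists p.
Qed.

Lemma saw_compatible g r p p' : is_saw g -> joined g (ends r p) -> joined g (ends r p') ->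
  compatible p p'.
Proof. by case=> _ _ _ /(_ r); rewrite traceE => /admissibleP; apply. Qed.

Lemma joined_piece g r p a b : piece_ends r p a b -> joined g (ends r p) = joined g (a, b).
Proof. by case=> ->; rewrite // joined_sym. Qed.

Lemma joined_face g a b : is_saw g -> joined g (a, b) -> shared (face (a, b)) (a, b).
Proof.
move=> hg /orP[|]/(saw_face hg) //=.
by rewrite /face /= addrC (addrC (py b)) shared_sym.
Qed.

Lemma sub_saw g g' : is_saw g -> g' != [::] -> uniq g' ->
  (forall ab, joined g' ab -> joined g ab) -> is_saw g'.
Proof.
move=> hg h1 h2 h3; split=> // [a b hab|r].
  have /(joined_face hg) : joined g (a, b) by apply: h3; rewrite /joined hab.
  by move=> /sharedP[p hp]; exists (face (a, b)), p.
case: hg => _ _ _ /(_ r); rewrite !traceE => /admissibleP h; apply/admissibleP => p p' hp hp'.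
by apply: h; apply: h3.
Qed.

Lemma saw_rev g : is_saw g -> is_saw (rev g).
Proof.
move=> hg; apply: (sub_saw hg); last by move=> ab; rewrite joined_rev.
- by case: hg => h _ _ _; rewrite -size_eq0 size_rev size_eq0.
- by rewrite rev_uniq; case: hg.
Qed.

Lemma saw_prefix p q : p != [::] -> is_saw (p ++ q) -> is_saw p.
Proof.
move=> hp hg; apply: (sub_saw hg) => //; first by case: hg => _; rewrite cat_uniq => /and3P[].
case/lastP: p hp {hg} => // p a _ ab; rewrite cat_rcons joined_cat.
by move=> ->.
Qed.

Lemma saw_suffix p q : q != [::] -> is_saw (p ++ q) -> is_saw q.
Proof.
move=> hp hg; apply: (sub_saw hg) => //; first by case: hg => _; rewrite cat_uniq => /and3P[].
by case: q hp {hg} => // a q _ ab; rewrite joined_cat => ->; rewrite orbT.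
Qed.

Lemma opposite_disjoint r p a b : p != opposite p -> piece_ends r p a b ->
  ~ exists c, piece_ends r (opposite p) a c.
Proof.
have := side_neq r; rewrite /sides /= !inE !negb_or.
move=> /and3P[/and3P[/eqP h1 /eqP h2 /eqP h3] /andP[/eqP h4 /eqP h5] _].
have h6 : north r <> west r by [].
by case: p => //= _ [] [] ? ? [c [] []] *; congruence.
Qed.

(** Opposite pieces have no common end, so two pieces of one rhombus that meet at [b] are the same
    piece. Thus a walk crosses every edge that it does not end on. *)
Lemma saw_turn g a b c r : is_saw g -> joined g (a, b) -> joined g (b, c) ->
  shared r (a, b) -> shared r (b, c) -> a = c.
Proof.
move=> hg hab hbc /sharedP[p hp] /sharedP[p' hp'].
have hcp : compatible p p'.
  by apply: (saw_compatible (r := r) hg); rewrite (joined_piece _ hp, joined_piece _ hp').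
have hp2 : piece_ends r p b a by case: hp; [right|left].
case: (eqVneq p p') => [e|np].
  by subst p'; case: hp => e1; case: hp'; rewrite e1 => -[] *; congruence.
have e' : p' = opposite p by move: hcp; rewrite /compatible (negPf np) => /eqP.
by case: (opposite_disjoint _ hp2); [rewrite -e' | exists c; rewrite -e'].
Qed.

(** The middle of a piece determines its rhombus, and inside a rhombus only the two crossing lines
    have the same middle; these are not compatible. This rules out the exceptional case of
    [secant_cell]. *)
Lemma saw_mid g a b c d : is_saw g -> joined g (a, b) -> joined g (c, d) ->
  px a + px b = px c + px d -> py a + py b = py c + py d -> a = c \/ a = d.
Proof.
move=> hg hab hcd hx hy.
have := joined_face hg hab; have := joined_face hg hcd; rewrite /face /= -hx -hy.
set r := (_, _) => /sharedP[p' hp'] /sharedP[p hp].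
have hcp : compatible p p'.
  by apply: (saw_compatible (r := r) hg); rewrite (joined_piece _ hp, joined_piece _ hp').
case: (eqVneq p p') => [e|np].
  by subst p'; case: hp => e1; case: hp'; rewrite e1 => -[] *; subst; tauto.
have e' : p' = opposite p by move: hcp; rewrite /compatible (negPf np) => /eqP.
move: hx; case: r p {hcp hab hcd} hp hp' np e' hy => i j.
case=> /= + + np e' hx; rewrite {p'}e' in np *; move: np hx => //= _ + [] [] <- <- [] [] <- <-;
  by rewrite /px /py /=; lia.
Qed.

(** * Total turning of a self-avoiding walk *)

(* Rotation of the secant when it moves from (a, c) to (a', c'). *)
Definition secant (a c a' c' : edge) : int :=
  rotation (px c - px a) (py c - py a) (px c' - px a') (py c' - py a').

Lemma odd_pos a : ((px a + py a) %% 2)%Z = 1.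
Proof. by case: a => [[] [i j]]; rewrite /px /py /=; lia. Qed.

Lemma secant_cell a b c d :
  (px b - px a, py b - py a) \in step_vectors ->
  (px d - px c, py d - py c) \in step_vectors ->
  a != c -> a != d -> b != c -> b != d ->
  (px a + px b != px c + px d) || (py a + py b != py c + py d) ->
  secant a c a d + secant a d b d = secant a c b c + secant b c b d.
Proof.
move=> hab hcd /edge_neq nac /edge_neq nad /edge_neq nbc /edge_neq nbd nm.
have := cell (px c - px a) (py c - py a) hab hcd; rewrite /cell_ok /=.
have oa := odd_pos a; have oc := odd_pos c.
have e1 x y : x - y + - 0 = x - y :> int by lia.
have -> : px c - px a + (px d - px c) = px d - px a by lia.
have -> : py c - py a + (py d - py c) = py d - py a by lia.
have -> : px c - px a + - (px b - px a) = px c - px b by lia.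
have -> : py c - py a + - (py b - py a) = py c - py b by lia.
have -> : px c - px a + (px d - px c - (px b - px a)) = px d - px b by lia.
have -> : py c - py a + (py d - py c - (py b - py a)) = py d - py b by lia.
move=> /implyP h; apply/eqP; apply: h; clear -nac nad nbc nbd nm oa oc.
by apply/and5P; split; last (apply/andP; split); lia.
Qed.

Definition wsum (D : edge -> edge -> int) (g : seq edge) : int :=
  \sum_(s <- steps g) D s.1 s.2.

Lemma wsum_cons D a b g : wsum D (a :: b :: g) = D a b + wsum D (b :: g).
Proof. by rewrite /wsum steps_cons big_cons. Qed.

Lemma wsum1 D a : wsum D [:: a] = 0.
Proof. by rewrite /wsum big_nil. Qed.

Lemma wsum_cat D p a q : wsum D (p ++ a :: q) = wsum D (rcons p a) + wsum D (a :: q).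
Proof. by rewrite /wsum steps_cat big_cat. Qed.

Lemma wsum_rcons D p a b : wsum D (rcons (rcons p a) b) = wsum D (rcons p a) + D a b.
Proof. by rewrite /wsum steps_rcons -cats1 big_cat /= big_seq1. Qed.

Lemma wsum_rev D g : (forall a b, D a b = - D b a) -> wsum D (rev g) = - wsum D g.
Proof.
move=> hD; rewrite /wsum steps_rev big_rev big_map -sumrN.
by apply: eq_bigr => -[a b] _ /=; rewrite hD.
Qed.

Definition mid_neq (a b c d : edge) : bool :=
  (px a + px b != px c + px d) || (py a + py b != py c + py d).

(* Moving the base or the tip of the secants along a step that meets no step of
   [g] does not change their total rotation. *)
Definition crosses_not (a b : edge) (g : seq edge) : Prop :=
  [/\ a \notin g, b \notin g & forall c d, (c, d) \in steps g ->
    (px d - px c, py d - py c) \in step_vectors /\ mid_neq a b c d].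

Lemma crosses_not_cons a b c d g : crosses_not a b (c :: d :: g) ->
  [/\ crosses_not a b (d :: g), a != c, a != d, b != c & b != d] /\
  (px d - px c, py d - py c) \in step_vectors /\ mid_neq a b c d.
Proof.
case=> ha hb h; split; last by apply: h; rewrite steps_cons mem_head.
move: ha hb; rewrite !inE !negb_or => /and3P[? ? ?] /and3P[? ? ?].
split=> //; split; rewrite ?inE ?negb_or; do ?by apply/andP.
by move=> x y hxy; apply: h; rewrite steps_cons inE hxy orbT.
Qed.

Lemma slide_base a b c g : (px b - px a, py b - py a) \in step_vectors ->
  crosses_not a b (c :: g) ->
  wsum (fun p p' => secant b p b p') (c :: g) + secant a c b c =
  wsum (fun p p' => secant a p a p') (c :: g) + secant a (last c g) b (last c g).
Proof.
move=> hab; elim: g c => [|d g IH] c h; first by rewrite !wsum1.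
have [[h1 h2 h3 h4 h5] [h6 h7]] := crosses_not_cons h.
have := IH _ h1; have := secant_cell hab h6 h2 h3 h4 h5 h7.
by rewrite !wsum_cons /=; lia.
Qed.

Lemma slide_tip a b c g : (px b - px a, py b - py a) \in step_vectors ->
  crosses_not a b (c :: g) ->
  wsum (fun p p' => secant p b p' b) (c :: g) + secant c a c b =
  wsum (fun p p' => secant p a p' a) (c :: g) + secant (last c g) a (last c g) b.
Proof.
move=> hab; elim: g c => [|d g IH] c h; first by rewrite !wsum1.
have [[h1 h2 h3 h4 h5] [h6 h7]] := crosses_not_cons h.
have h7' : mid_neq c d a b by move: h7; rewrite /mid_neq; lia.
have := IH _ h1.
have := secant_cell h6 hab; rewrite !(eq_sym c) !(eq_sym d) => /(_ h2 h4 h3 h5 h7').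
by rewrite !wsum_cons /=; lia.
Qed.

Lemma side_across r a b : shared r (a, b) ->
  if b.1 then py b = cy r /\ (px b = cx r + 1 /\ px a < px b \/ px b = cx r - 1 /\ px b < px a)
  else px b = cx r /\ (py b = cy r + 1 /\ py a < py b \/ py b = cy r - 1 /\ py b < py a).
Proof.
move=> /and3P[/= ha hb nab]; move: ha hb nab; rewrite !inE.
by move=> /or4P[] /eqP -> /or4P[] /eqP ->; rewrite ?eqxx // => _;
  rewrite /px /py /cx /cy /=; lia.
Qed.

(** Changing rhombus at [b], the walk keeps its sense across that edge, which is the condition of
    the finite check [triangle]. *)
Lemma secant_triangle r r' a b c : shared r (a, b) -> shared r' (b, c) -> r != r' ->
  secant a b a c + secant a c b c = turn a b + turn b c.
Proof.
move=> hab hbc hr.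
have := triangle a.1 (shared_step hab) (shared_step hbc); rewrite /triangle_ok /=.
have -> : px b - px a + (px c - px b) = px c - px a by lia.
have -> : py b - py a + (py c - py b) = py c - py a by lia.
have e1 : (if (px b - px a) * (py b - py a) == 0 then a.1 else ~~ a.1) = b.1.
  move: hab => /and3P[/= ha hb nab]; move: ha hb nab; rewrite !inE.
  move=> /or4P[] /eqP -> /or4P[] /eqP ->; rewrite ?eqxx // => _; rewrite /px /py /=; case: ifP => /eqP; lia.
have hv : if a.1 then px b - px a != 0 else py b - py a != 0.
  move: hab => /and3P[/= ha hb nab]; move: ha hb nab; rewrite !inE.
  move=> /or4P[] /eqP -> /or4P[] /eqP ->; rewrite ?eqxx // => _; rewrite /px /py /=; lia.
have hw : if b.1 then 0 < (px b - px a) * (px c - px b) else 0 < (py b - py a) * (py c - py b).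
  have nr : (cx r != cx r') || (cy r != cy r').
    apply: contraR hr; rewrite negb_or !negbK => /andP[/eqP hx /eqP hy].
    exact/eqP/center_inj.
  have := side_across hab; rewrite shared_sym in hbc; have := side_across hbc.
  case: b.1 => -[h1 h2] [h3 h4].
    have /orP[] : (0 < px b - px a) && (0 < px c - px b) ||
       (px b - px a < 0) && (px c - px b < 0).
    - by move: h2 h4 nr; rewrite -h1 -h3 eqxx orbF; lia.
    - by case/andP; apply: mulr_gt0.
    - by case/andP => ? ?; rewrite nmulr_rgt0.
  have /orP[] : (0 < py b - py a) && (0 < py c - py b) ||
       (py b - py a < 0) && (py c - py b < 0).
  - by move: h2 h4 nr; rewrite -h1 -h3 eqxx; lia.
  - by case/andP; apply: mulr_gt0.
  - by case/andP => ? ?; rewrite nmulr_rgt0.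
by rewrite e1 hv hw /= => /eqP; rewrite /secant /turn; case: a.1; case: b.1.
Qed.

Definition final_turn (a b : edge) (g : seq edge) : int :=
  let s := last (a, b) (steps (b :: g)) in turn s.1 s.2.

(* Hopf's argument for a polygonal arc: the secant from the first to the last
   point is moved over the triangle of all secants. *)
Lemma hopf a b g : is_saw (a :: b :: g) ->
  wsum turn (a :: b :: g) *+ 2 - turn a b - final_turn a b g =
  wsum (fun p p' => secant a p a p') (b :: g) +
  wsum (fun p p' => secant p (last b g) p' (last b g)) (belast a (b :: g)).
Proof.
elim: g a b => [|c g IH] a b hg.
  by rewrite /final_turn /= !wsum_cons !wsum1; lia.
have hg' : is_saw (b :: c :: g) by apply: (@saw_suffix [:: a]).
have jab : joined (a :: b :: c :: g) (a, b) by rewrite /joined steps_cons mem_head.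
have jbc : joined (a :: b :: c :: g) (b, c).
  by rewrite /joined !steps_cons !inE eqxx orbT.
have sab := joined_face hg jab; have sbc := joined_face hg jbc.
have u : uniq (a :: b :: c :: g) by case: hg.
have nac : a != c by move: u; rewrite /= !inE !negb_or => /andP[/and3P[]].
have nr : face (a, b) != face (b, c).
  apply: contraNneq nac => e; apply/eqP; apply: (saw_turn hg jab jbc sab).
  by rewrite e.
have tri := secant_triangle sab sbc nr.
have cr : crosses_not a b (c :: g).
  move: u; rewrite /= inE negb_or => /and3P[/andP[_ u1] u2 _].
  split=> // x y hxy.
  have hxy' : (x, y) \in steps (a :: b :: c :: g) by rewrite !steps_cons !inE hxy !orbT.
  split; first exact: shared_step (saw_face hg hxy').
  have jxy : joined (a :: b :: c :: g) (x, y) by rewrite /joined hxy'.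
  have [hx hy] := mem_steps hxy.
  rewrite /mid_neq; apply: contraT; rewrite negb_or !negbK => /andP[/eqP h1 /eqP h2].
  by case: (saw_mid hg jab jxy h1 h2) => e; move: u1; rewrite e ?hx ?hy.
(* The induction hypothesis has its secants based at [b]; they are moved back along the first step
   to the base [a]. *)
have sl := slide_base (shared_step sab) cr.
move: (IH _ _ hg') tri sl; rewrite /final_turn.
have -> : last (a, b) (steps [:: b, c & g]) = last (b, c) (steps (c :: g)) by [].
by rewrite [belast a _]/= [belast b _]/= [last b _]/= !wsum_cons; lia.
Qed.

Definition neg_ok (x y : int) (e : int * int) : bool :=
  [&& ((x + y) %% 2)%Z == 0, (x != 0) || (y != 0) & (x + e.1 != 0) || (y + e.2 != 0)] ==>
  (rotation x y (x + e.1) (y + e.2) == rotation (- x) (- y) (- x + - e.1) (- y + - e.2)).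

Lemma neg_small : all (fun x => all (fun y => all (neg_ok x y) step_vectors) small) small.
Proof. by vm_compute. Qed.

Lemma clampN x : clamp (- x) = - clamp x.
Proof.
rewrite /clamp (_ : ((- x %% 2)%Z == 0) = ((x %% 2)%Z == 0)); last by lia.
by case: (_ == 0); case: ifP => h1; case: ifP => h2; try case: ifP => h3; try case: ifP => h4; lia.
Qed.

Lemma rotationN x y e : e \in step_vectors -> neg_ok x y e.
Proof.
case: e => [a b] he; have [/= e1 e2] := step_vectors_le he.
have le1 : `|a| <= 4 by lia.
have le2 : `|b| <= 4 by lia.
have le3 : `|- a| <= 4 by lia.
have le4 : `|- b| <= 4 by lia.
have par : ((clamp x + clamp y) %% 2)%Z = ((x + y) %% 2)%Z.
  by have := clamp_parity x; have := clamp_parity y; lia.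
have l0 : `|0 : int| <= 4 by [].
have cl u v : sector (clamp u) (clamp v) = sector u v.
  by have := sector_clamp u v l0 l0; rewrite !addr0.
have := allP (allP (allP neg_small _ (clamp_small x)) _ (clamp_small y)) _ he.
rewrite /neg_ok /rotation /= par -!clampN -!sector_clamp // !clampD_eq0 // !cl.
by have := clampD_eq0 x l0; have := clampD_eq0 y l0; rewrite !addr0 => -> ->.
Qed.

(** Reading a secant from its other end adds a half-turn to both directions. *)
Lemma secant_flip a p p' : (px p' - px p, py p' - py p) \in step_vectors ->
  a != p -> a != p' -> secant p a p' a = secant a p a p'.
Proof.
move=> hs /edge_neq n1 /edge_neq n2.
have := rotationN (px p - px a) (py p - py a) hs; rewrite /neg_ok /=.
have oa := odd_pos a; have op := odd_pos p.
have -> : px p - px a + (px p' - px p) = px p' - px a by lia.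
have -> : py p - py a + (py p' - py p) = py p' - py a by lia.
have -> : - (px p - px a) + - (px p' - px p) = px a - px p' by lia.
have -> : - (py p - py a) + - (py p' - py p) = py a - py p' by lia.
rewrite !opprB => /implyP h; apply/esym/eqP; apply: h.
by apply/and3P; split; lia.
Qed.

Lemma secant_antisym a c a' c' : secant a c a' c' = - secant a' c' a c.
Proof.
by rewrite /secant /rotation; do 4?[case: ifP => ?]; lia.
Qed.

Lemma turn_antisym r a b : shared r (a, b) -> turn a b = - turn b a.
Proof.
rewrite /shared /= !inE => /and3P[/or4P ha /or4P hb].
by case: ha => /eqP ->; case: hb => /eqP -> ; rewrite ?eqxx // => _; rewrite /turn /px /py /=; lia.
Qed.

Definition winding (g : seq edge) : int := wsum turn g.

Lemma winding_rev g : is_saw g -> winding (rev g) = - winding g.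
Proof.
move=> hg; rewrite /winding /wsum steps_rev big_rev big_map -sumrN.
rewrite [LHS]big_seq [RHS]big_seq; apply: eq_bigr => -[a b] hab /=.
have := saw_face hg hab; rewrite shared_sym; exact: turn_antisym.
Qed.

Lemma last_steps s a p z : last s (steps (a :: rcons p z)) = (last a p, z).
Proof. by elim: p s a => [|b p IH] s a //; rewrite rcons_cons steps_cons !last_cons IH. Qed.

Lemma hopf_rcons o p z : is_saw (o :: rcons p z) ->
  winding (o :: rcons p z) *+ 2 - turn o (head z p) - turn (last o p) z =
  wsum (fun q q' => secant o q o q') (rcons p z) +
  wsum (fun q q' => secant q z q' z) (o :: p).
Proof.
case: p => [|b p] hg; have := hopf hg; rewrite /final_turn //=.
by rewrite last_rcons last_steps belast_rcons.
Qed.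

Lemma wsum_telescope D (h : edge -> int) a g :
  (forall p p', (p, p') \in steps (a :: g) -> D p p' = h p' - h p) ->
  wsum D (a :: g) = h (last a g) - h a.
Proof.
elim: g a => [|b g IH] a hD; first by rewrite wsum1 subrr.
rewrite wsum_cons IH /=; last first.
  by move=> p p' hp; apply: hD; rewrite steps_cons inE hp orbT.
by rewrite hD ?steps_cons ?mem_head //; lia.
Qed.

Definition dir (a b : edge) : int := sector (px b - px a) (py b - py a).

Lemma sector_bounds x y : 0 <= sector x y <= 7.
Proof. by rewrite /sector; do !case: ifP. Qed.

Lemma sector_upper x y : 0 <= y -> sector x y <= 4.
Proof. by rewrite /sector; do ![case: ifP => //]; lia. Qed.

(** Directions of the closed upper half-plane have sectors 0 to 4, so their differences need no
    reduction. *)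
Lemma secant_upper a c a' c' : py a <= py c -> py a' <= py c' ->
  secant a c a' c' = dir a' c' - dir a c.
Proof.
move=> h1 h2; rewrite /secant /rotation /dir.
have k1 : sector (px c - px a) (py c - py a) <= 4 by apply: sector_upper; lia.
have k2 : sector (px c' - px a') (py c' - py a') <= 4 by apply: sector_upper; lia.
have := sector_bounds (px c - px a) (py c - py a).
have := sector_bounds (px c' - px a') (py c' - py a').
by case: ifP => [|_]; [|case: ifP]; lia.
Qed.

Lemma dir_up r a b : shared r (a, b) -> ~~ a.1 -> py a <= py b -> dir a b = 2 + turn a b.
Proof.
rewrite /shared /= !inE => /and3P[/or4P ha /or4P hb].
case: ha => /eqP ->; case: hb => /eqP -> ; rewrite ?eqxx // => _ _;
by rewrite /dir /sector /turn /px /py /= => h; do ![case: ifP => [?|?]]; lia.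
Qed.

(** As [o] is lowest, the secants from [o] stay in the upper half-plane and their rotations
    telescope; the direction of the first step, 2 plus its turn, cancels the initial turn in
    [hopf_rcons]. Only the secants to the tip remain. *)
Lemma winding_bottom o p z : is_saw (o :: rcons p z) -> ~~ o.1 ->
  (forall e, e \in rcons p z -> py o <= py e) ->
  winding (o :: rcons p z) *+ 2 =
  turn (last o p) z + dir o z - 2 + wsum (fun q q' => secant q z q' z) (o :: p).
Proof.
move=> hg ho hp; have := hopf_rcons hg.
have -> : wsum (fun q q' => secant o q o q') (rcons p z) = dir o z - dir o (head z p).
  rewrite headI (wsum_telescope (h := dir o)); last first.
    move=> q q' hq; have [h1 h2] := mem_steps hq.
    by apply: secant_upper; apply: hp; rewrite headI.
  by rewrite -[last _ _]/(last o (head z p :: _)) -headI last_rcons.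
have hs : (o, head z p) \in steps (o :: rcons p z) by rewrite headI steps_cons mem_head.
have -> := dir_up (saw_face hg hs) ho; first by lia.
by apply: hp; rewrite headI mem_head.
Qed.

Lemma mid_neq_face r a b c d : shared r (a, b) -> (face (c, d) != r) -> mid_neq a b c d.
Proof.
move=> /shared_face ->; apply: contraR; rewrite negb_or !negbK => /andP[/eqP h1 /eqP h2].
by rewrite /face /= h1 h2.
Qed.

(* The closed curve through [r] formed by the loop [z2 :: rcons m z3] turns by
   an amount determined by the sides of [r]: by [winding_bottom], it is the
   variation of secants, which are slid from [z2] to [z3]. *)
Lemma loop_winding o p z1 z2 m z3 r :
  let ell := z2 :: rcons m z3 in
  head z1 p = o -> ~~ o.1 ->
  is_saw (rcons p z1 ++ ell) -> is_saw (rcons p z1 ++ rev ell) ->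
  (forall e, e \in rcons p z1 ++ ell -> py o <= py e) ->
  shared r (z1, z2) -> shared r (z1, z3) -> shared r (z2, z3) ->
  (forall s, s \in steps (rcons p z1) -> face s != r) ->
  winding ell *+ 2 = (turn z1 z3 - turn z1 z2) *+ 2 +
    secant z1 z2 z1 z3 + secant z1 z3 z2 z3 - secant z1 z2 z3 z2.
Proof.
move=> ell ho oh sg1 sg2 hup s12 s13 s23 hr.
have [P hP] : exists P, rcons p z1 = o :: P.
  by exists (behead (rcons p z1)); rewrite headI ho.
have elast : last o P = z1 by rewrite -[last o P]/(last o (o :: P)) -hP last_rcons.
have re : rev ell = z3 :: rcons (rev m) z2 by rewrite /ell rev_cons rev_rcons.
have split1 x n y : o :: P ++ x :: rcons n y = o :: rcons (P ++ x :: n) y.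
  by rewrite rcons_cat.
have wcat D x n : wsum D (o :: P ++ x :: n) = wsum D (o :: P) + D z1 x + wsum D (x :: n).
  have -> : o :: P ++ x :: n = p ++ z1 :: x :: n by rewrite -cat_cons -hP cat_rcons.
  by rewrite wsum_cat hP wsum_cons addrA.
have sell : is_saw ell by apply: saw_suffix sg1.
have lastcat x n : last o (P ++ x :: n) = last x n by rewrite last_cat.
(* Four linear relations are collected: [h1] and [h2] for the walk with the loop run forwards and
   backwards, [h3] for the loop alone, and [h4], which slides the tip of the secants of the initial
   part from [z2] to [z3]. The unknown sums of secants cancel between them. *)
have w1 := sg1; rewrite hP /ell cat_cons split1 in w1.
have h1 := winding_bottom w1 oh; rewrite -split1 {1}/winding !wcat lastcat in h1.
rewrite -/ell -!/(winding _) in h1.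
have w2 := sg2; rewrite hP re cat_cons split1 in w2.
have h2 := winding_bottom w2 oh; rewrite -split1 {1}/winding !wcat lastcat -re in h2.
rewrite -!/(winding _) (winding_rev sell) in h2.
have h3 := hopf_rcons sell; rewrite -/ell in h3.
have hc : (z2, head z3 m) \in steps ell by rewrite /ell headI steps_cons mem_head.
have tc := turn_antisym (saw_face sell hc).
have e2 : wsum (fun q q' : edge => secant q z2 q' z2) (z3 :: rev m) =
   - wsum (fun q q' : edge => secant z2 q z2 q') (rcons m z3).
  rewrite -rev_rcons wsum_rev; last by move=> a b; exact: secant_antisym.
  congr (- _); rewrite /wsum [LHS]big_seq [RHS]big_seq; apply: eq_bigr => -[a b] hab /=.
  have hab' : (a, b) \in steps ell by rewrite /ell headI steps_cons inE -headI hab orbT.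
  have u : uniq ell by case: sell.
  move: u => /= /andP[/negP u _]; have [ha hb] := mem_steps hab.
  apply: secant_flip; first exact: shared_step (saw_face sell hab').
    by apply/negP => /eqP e; apply: u; rewrite e.
  by apply/negP => /eqP e; apply: u; rewrite e.
have cr : crosses_not z2 z3 (o :: P).
  have u : uniq (rcons p z1 ++ ell) by case: sg1.
  rewrite -hP; split.
  - by move: u; rewrite cat_uniq => /and3P[_ /hasPn h _]; apply: h; rewrite mem_head.
  - by move: u; rewrite cat_uniq => /and3P[_ /hasPn h _]; apply: h; rewrite inE mem_rcons mem_head orbT.
  - move=> c d hcd; split; last by apply: mid_neq_face s23 _; apply: hr.
    have hcd' : (c, d) \in steps (rcons p z1 ++ ell) by rewrite cat_rcons steps_cat mem_cat hcd.
    exact: shared_step (saw_face sg1 hcd').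
have h4 := slide_tip (shared_step s23) cr; rewrite elast in h4.
have up x : x \in rcons p z1 ++ ell -> py o <= py x := hup x.
have h5 : secant o z2 o z3 = dir o z3 - dir o z2.
  by apply: secant_upper; apply: up; rewrite mem_cat !inE ?mem_rcons ?inE ?eqxx ?orbT.
have k1 e : e \in rcons (P ++ z2 :: m) z3 -> py o <= py e.
  by move=> he; apply: up; rewrite hP cat_cons split1 inE he orbT.
have k2 e : e \in rcons (P ++ z3 :: rev m) z2 -> py o <= py e.
  move=> he; have : e \in rcons p z1 ++ rev ell by rewrite hP re cat_cons split1 inE he orbT.
  by move=> he'; apply: up; move: he'; rewrite !mem_cat mem_rev.
have {}h1 := h1 k1; have {}h2 := h2 k2.
have l2 : last z3 (rev m) = head z3 m by case: (m) => [|x n] //=; rewrite rev_cons last_rcons.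
rewrite l2 e2 in h2; rewrite h5 in h4.
move: h1 h2 h3 h4 tc.
set A3 := wsum (fun q q' => secant q z3 q' z3) (o :: P).
set A2 := wsum (fun q q' => secant q z2 q' z2) (o :: P).
set B3 := wsum (fun q q' => secant q z3 q' z3) (z2 :: m).
set B2 := wsum (fun q q' => secant z2 q z2 q') (rcons m z3).
set T2 := turn (head z3 m) z2; set T2' := turn z2 (head z3 m).
set T3 := turn (last z2 m) z3; set D2 := dir o z2; set D3 := dir o z3.
by clearbody A3 A2 B3 B2 T2 T2' T3 D2 D3; lia.
Qed.

(** * Winding of walks ending on the boundary *)

(** In the right half-plane the sectors jump from 7 to 0, and [lift] is a continuous choice of the
    direction there. Parity and the bound 2 on the move forbid going from straight up to straight
    down. *)
Lemma rotation_right x y x' y' : 0 <= x -> 0 <= x' -> (x != 0) || (y != 0) ->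
  (x' != 0) || (y' != 0) -> ((x + y) %% 2)%Z = 0 -> ((x' + y') %% 2)%Z = 0 ->
  `|x' - x| <= 2 -> `|y' - y| <= 2 ->
  let lift s : int := if 4 < s then s - 8 else s in
  rotation x y x' y' = lift (sector x' y') - lift (sector x y).
Proof.
move=> h1 h2 h3 h4 h5 h6 h7 h8 /=.
have k u v : 0 <= u -> (u != 0) || (v != 0) ->
    [\/ sector u v = 2 /\ u = 0 /\ 0 < v, sector u v = 6 /\ u = 0 /\ v < 0,
       0 <= sector u v <= 1 | sector u v = 7].
  by move=> ? ?; rewrite /sector; do ?[case: ifP => [?|?]];
    solve [constructor 1; lia | constructor 2; lia | constructor 3; lia | constructor 4; lia | lia].
rewrite /rotation; case: (k x y h1 h3) => [[s1 [e1 e2]]|[s1 [e1 e2]]|s1|s1];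
  case: (k x' y' h2 h4) => [[s2 [e3 e4]]|[s2 [e3 e4]]|s2|s2]; do ?[case: ifP => ?]; lia.
Qed.

Lemma rotation_lower x y x' y' : y <= 0 -> y' <= 0 -> (x != 0) || (y != 0) ->
  (x' != 0) || (y' != 0) -> ((x + y) %% 2)%Z = 0 -> ((x' + y') %% 2)%Z = 0 ->
  `|x' - x| <= 2 -> `|y' - y| <= 2 ->
  let lift s : int := if s == 0 then 8 else s in
  rotation x y x' y' = lift (sector x' y') - lift (sector x y).
Proof.
move=> h1 h2 h3 h4 h5 h6 h7 h8 /=.
have k u v : v <= 0 -> (u != 0) || (v != 0) ->
    [\/ sector u v = 0 /\ v = 0 /\ 0 < u, sector u v = 4 /\ v = 0 /\ u < 0 |
        5 <= sector u v <= 7].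
  by move=> ? ?; rewrite /sector; do ?[case: ifP => [?|?]];
    solve [constructor 1; lia | constructor 2; lia | constructor 3; lia | lia].
rewrite /rotation; case: (k x y h1 h3) => [[s1 [e1 e2]]|[s1 [e1 e2]]|s1];
  case: (k x' y' h2 h4) => [[s2 [e3 e4]]|[s2 [e3 e4]]|s2]; do ?[case: ifP => ?]; lia.
Qed.

Lemma rotation_left x y x' y' : x <= 0 -> x' <= 0 ->
  rotation x y x' y' = sector x' y' - sector x y.
Proof.
have k u v : u <= 0 -> 2 <= sector u v <= 6.
  by move=> ?; rewrite /sector; do ?[case: ifP => [?|?]]; lia.
by move=> /k + /k; rewrite /rotation => /(_ y) ? /(_ y') ?; do ?[case: ifP => ?]; lia.
Qed.

Lemma dir_arrival r a b : shared r (a, b) ->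
  [/\ ~~ b.1 -> py a <= py b -> dir a b = 2 - turn a b,
      ~~ b.1 -> py b <= py a -> dir a b = 6 - turn a b,
      b.1 -> px b <= px a -> dir a b = 4 - turn a b &
      b.1 -> px a <= px b -> dir a b = (if turn a b == 1 then 7 else - turn a b)].
Proof.
rewrite /shared /= !inE => /and3P[/or4P ha /or4P hb].
by case: ha => /eqP ->; case: hb => /eqP -> ; rewrite ?eqxx // => _;
  split=> // _; rewrite /dir /sector /turn /px /py /=; move=> h; do ?[case: ifP => [?|?]]; lia.
Qed.

Lemma turn_bounds r a b : shared r (a, b) -> -1 <= turn a b <= 1.
Proof.
rewrite /shared /= !inE => /and3P[/or4P ha /or4P hb].
by case: ha => /eqP ->; case: hb => /eqP -> ; rewrite ?eqxx // => _; rewrite /turn /px /py /=; lia.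
Qed.

Section BoundaryWinding.
Variables (o z : edge) (p : seq edge).
Hypotheses (hg : is_saw (o :: rcons p z)) (ho : ~~ o.1).
Hypothesis hup : forall e, e \in rcons p z -> py o <= py e.

Let y := last o p.

Lemma last_step_shared : exists r, shared r (y, z).
Proof.
exists (face (y, z)); apply: (saw_face hg).
by rewrite -(last_steps (o, o) o p z) headI steps_cons last_cons mem_last.
Qed.

Lemma tip_step q q' : (q, q') \in steps (o :: p) ->
  [/\ (px q' - px q, py q' - py q) \in step_vectors, q \in o :: p, q' \in o :: p,
      z != q & z != q'].
Proof.
move=> hq; have [h1 h2] := mem_steps hq.
have u : z \notin o :: p by case: hg => _; rewrite -rcons_cons rcons_uniq => /andP[].
have hq' : (q, q') \in steps (o :: rcons p z).
  by rewrite -rcons_cons -cats1; case/lastP: (o :: p) hq => // s x hq; rewrite cat_rcons steps_cat mem_cat hq.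
split=> //; first exact: shared_step (saw_face hg hq').
  by apply: contraNneq u => ->.
by apply: contraNneq u => ->.
Qed.

Lemma winding_end : winding (o :: rcons p z) *+ 2 =
  turn y z + dir o z - 2 + wsum (fun q q' => secant q z q' z) (o :: p).
Proof. exact: winding_bottom. Qed.

(** For an extremal [z] the secants to [z] also stay in a half-plane, so that the sum left in
    [winding_end] telescopes, and [dir_arrival] gives the direction of the last step. The other
    walls differ only in the half-plane. *)
Lemma winding_top : ~~ z.1 -> (forall e, e \in o :: p -> py e <= py z) ->
  winding (o :: rcons p z) = 0.
Proof.
move=> hz hp; have := winding_end.
rewrite (wsum_telescope (h := fun q => dir q z)) => [|q q' /tip_step[_ /hp h1 /hp h2 _ _]];
  last exact: secant_upper.
have [r /dir_arrival[h _ _ _]] := last_step_shared.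
by rewrite -/y h //; [lia|apply: hp; apply: mem_last].
Qed.

Lemma winding_left : z.1 -> (forall e, e \in o :: p -> px z <= px e) ->
  winding (o :: rcons p z) = 1.
Proof.
move=> hz hp; have := winding_end.
rewrite (wsum_telescope (h := fun q => dir q z)) => [|q q' /tip_step[_ /hp h1 /hp h2 _ _]];
  last by apply: rotation_left; lia.
have [r /dir_arrival[_ _ h _]] := last_step_shared.
by rewrite -/y h //; [lia|apply: hp; apply: mem_last].
Qed.

Lemma winding_right : z.1 -> (forall e, e \in o :: p -> px e <= px z) ->
  winding (o :: rcons p z) = -1.
Proof.
move=> hz hp; have := winding_end.
pose lift s : int := if 4 < s then s - 8 else s.
rewrite (wsum_telescope (h := fun q => lift (dir q z))); last first.
  move=> q q' /tip_step[/step_vectors_le[/= k1 k2] /hp h1 /hp h2 /edge_neq n1 /edge_neq n2].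
  have := odd_pos q; have := odd_pos q'; have := odd_pos z => o1 o2 o3.
  by apply: rotation_right; lia.
have [r /dir_arrival[_ _ _ h]] := last_step_shared.
have hd : dir o z <= 4.
  by apply: sector_upper; have := hup (e := z); rewrite mem_rcons mem_head => /(_ isT); lia.
rewrite -/y h //; last by apply: hp; apply: mem_last.
have ht : -1 <= turn y z <= 1.
  by have [r' hr'] := last_step_shared; apply: turn_bounds hr'.
have -> : lift (dir o z) = dir o z by rewrite /lift; case: ifP => //; lia.
have -> : lift (if turn y z == 1 then 7 else - turn y z) = - turn y z.
  by rewrite /lift; case: (turn y z =P 1) => [->|_] //; case: ifP => //; lia.
by set d := dir o z; set t := turn y z; clearbody d t; lia.
Qed.

(** The sign tells on which side of [o] the walk comes back; it can be left open because [phase]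
    agrees at 2 and -2. *)
Lemma winding_same_side : ~~ z.1 -> py z = py o ->
  winding (o :: rcons p z) = 2 \/ winding (o :: rcons p z) = -2.
Proof.
move=> hz hp; have := winding_end.
pose lift s : int := if s == 0 then 8 else s.
have hp' e : e \in o :: p -> py z <= py e.
  by rewrite inE hp => /orP[/eqP->//|he]; apply: hup; rewrite mem_rcons inE he orbT.
rewrite (wsum_telescope (h := fun q => lift (dir q z))); last first.
  move=> q q' /tip_step[/step_vectors_le[/= k1 k2] /hp' h1 /hp' h2 /edge_neq n1 /edge_neq n2].
  have := odd_pos q; have := odd_pos q'; have := odd_pos z => o1 o2 o3.
  by apply: rotation_lower; lia.
have [r' hr'] := last_step_shared; have [_ h _ _] := dir_arrival hr'.
have ht := turn_bounds hr'.
have hd : dir o z = 0 \/ dir o z = 4.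
  by rewrite /dir /sector; case: ifP => [_|]; [case: ifP; [left|right]|lia].
rewrite -/y h //; last by apply: hp'; apply: mem_last.
have -> : lift (6 - turn y z) = 6 - turn y z by rewrite /lift; case: ifP => //; lia.
by rewrite /lift; set t := turn y z; clearbody t; case: hd => -> /=; lia.
Qed.

End BoundaryWinding.

Lemma turn_parity r a b : shared r (a, b) -> ((turn a b %% 2)%Z == 1) = (a.1 != b.1).
Proof.
rewrite /shared /= !inE => /and3P[/or4P ha /or4P hb].
by case: ha => /eqP ->; case: hb => /eqP -> ; rewrite ?eqxx // => _; rewrite /turn /px /py /=; lia.
Qed.

(** Arcs exchange the two kinds of edges and straight lines keep them; this justifies the parity
    test in [phase]. *)
Lemma winding_parity a g : is_saw (a :: g) ->
  ((winding (a :: g) %% 2)%Z == 1) = (a.1 != (last a g).1).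
Proof.
elim: g a => [|b g IH] a hg; first by rewrite /winding wsum1 eqxx.
have hs : (a, b) \in steps (a :: b :: g) by rewrite steps_cons mem_head.
have := turn_parity (saw_face hg hs); have := IH b (@saw_suffix [:: a] (b :: g) isT hg).
rewrite /winding wsum_cons /=; case: a.1; case: b.1; case: (last b g).1 => /=; lia.
Qed.

(** * Phases and local identities *)

Inductive compass := South | East | North | West.

Definition compass_rank (d : compass) : nat :=
  match d with South => 0 | East => 1 | North => 2 | West => 3 end.

Lemma compass_rank_inj : injective compass_rank.
Proof. by case; case. Qed.

HB.instance Definition _ := Equality.copy compass (inj_type compass_rank_inj).

Definition side (r : rhombus) (d : compass) : edge :=
  match d with South => south r | East => east r | North => north r | West => west r end.

Definition others (d : compass) : seq compass :=
  match d with
  | South => [:: East; North; West] | East => [:: South; North; West]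
  | North => [:: South; East; West] | West => [:: South; East; North]
  end.

Definition ox (d : compass) : int := match d with East => 2 | West => 0 | _ => 1 end.
Definition oy (d : compass) : int := match d with South => 0 | North => 2 | _ => 1 end.
Definition vertical (d : compass) : bool := match d with East | West => true | _ => false end.

Definition compass_turn (d d' : compass) : int :=
  let p := (ox d' - ox d) * (oy d' - oy d) in if vertical d then p else - p.

Definition compass_secant (d1 d2 d3 d4 : compass) : int :=
  rotation (ox d2 - ox d1) (oy d2 - oy d1) (ox d4 - ox d3) (oy d4 - oy d3).

(* The winding given by [loop_winding] for a walk entering through [d1] and
   whose loop leaves through [d2] and comes back through [d3]. *)
Definition compass_loop (d1 d2 d3 : compass) : int :=
  (((compass_turn d1 d3 - compass_turn d1 d2) *+ 2 + compass_secant d1 d2 d1 d3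
   + compass_secant d1 d3 d2 d3 - compass_secant d1 d2 d3 d2) %/ 2)%Z.

Definition link (d d' : compass) : piece :=
  match d, d' with
  | South, West | West, South => ArcSW
  | North, East | East, North => ArcNE
  | South, East | East, South => ArcSE
  | North, West | West, North => ArcNW
  | South, North | North, South => LineSN
  | _, _ => LineWE
  end.

Section Phases.
Variables (R : realType) (theta : R).

(** [eta] is the phase for a half-turn, and [alpha] = theta - 5 theta / 8 is what is left of the
    direction exp(I theta) of a vertical edge after a left turn by theta. *)
Let eta : R := 5 * pi / 8.
Let alpha : R := 3 * theta / 8.
Let C : R := cos eta.
Let S : R := sin eta.
Let h : R := - sin (eta *+ 2).

(* [phase q] is the real part of exp(- 5i W / 8) times the direction of the
   final edge, where W is the angle by which a walk starting on a horizontal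
   edge has turned after [q] signed quarter turns. *)
Definition phase (q : int) : R :=
  if (q %% 2)%Z == 1 then cos (alpha + eta / 2 - eta / 2 * q%:~R)
  else cos (eta / 2 * q%:~R).

(** Twice [eta] is 5 pi / 4, on the diagonal of the plane, hence equal cosine and sine. *)
Lemma octant_double : [/\ C * C + S * S = 1, 2 * (C * S) = - h & C * C - S * S = - h].
Proof.
have e1 : C * C + S * S = 1 by rewrite -!expr2 cos2Dsin2.
have e2 : 2 * (C * S) = - h by rewrite /h opprK mulr2n sinD -/S -/C; ring.
split=> //; rewrite /h opprK.
have -> : C * C - S * S = cos (eta *+ 2) by rewrite mulr2n cosD.
have -> : eta *+ 2 = pi / 2 / 2 + pi by rewrite /eta mulr2n; field.
rewrite cosDpi sinDpi; congr (- _).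
have {1}-> : pi / 2 / 2 = pi / 2 - pi / 2 / 2 :> R by field.
by rewrite cosB cos_pihalf sin_pihalf mul0r mul1r add0r.
Qed.

Lemma octant_products : [/\ h * h = 1 / 2, h * S = (S - C) / 2, h * C = - (S + C) / 2,
  C * S = - h / 2 & C * C = (1 - h) / 2 /\ S * S = (1 + h) / 2].
Proof.
have [e1 e2 e3] := octant_double.
have eC : C * C = (1 - h) / 2 by lra.
have eS : S * S = (1 + h) / 2 by lra.
have eCS : C * S = - h / 2 by lra.
have k1 : C * (S * S) = (C * S) * S by ring.
have k2 : (C * C) * S = C * (C * S) by ring.
have k3 : (C * C) * (S * S) = (C * S) * (C * S) by ring.
rewrite eS eCS in k1; rewrite eC eCS in k2; rewrite eC eS eCS in k3.
by split => //; lra.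
Qed.

(** A table of cos (n eta) and sin (n eta) for the small multiples met in the local identities; the
    last case makes [octantE] hold for every n. *)
Definition octant (n : int) : R * R :=
  match n with
  | Posz 0 => (1, 0) | Posz 1 => (C, S) | Posz 2 => (- h, - h) | Posz 3 => (S, C)
  | Negz 0 => (C, - S) | Negz 1 => (- h, h) | Negz 2 => (S, - C)
  | _ => (cos (eta * n%:~R), sin (eta * n%:~R))
  end.

Lemma octantE n : octant n = (cos (eta * n%:~R), sin (eta * n%:~R)).
Proof.
have [k1 k2 k3 k4 [k5 k6]] := octant_products.
have [e1 e2 e3] := octant_double.
have c2 : cos (eta + eta) = - h by rewrite cosD -/C -/S.
have s2 : sin (eta + eta) = - h by rewrite /h opprK mulr2n.
have c3 : cos (eta + (eta + eta)) = S by rewrite cosD c2 s2 -/C -/S; lra.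
have s3 : sin (eta + (eta + eta)) = C by rewrite sinD c2 s2 -/C -/S; lra.
have p1 : eta * 1%:~R = eta by rewrite mulr1.
have p2 : eta * 2%:~R = eta + eta by ring.
have p3 : eta * 3%:~R = eta + (eta + eta) by ring.
case: n => [[|[|[|[|n]]]]|[|[|[|n]]]] //=.
- by rewrite mulr0 cos0 sin0.
- by rewrite p1.
- by rewrite p2 c2 s2.
- by rewrite p3 c3 s3.
- by rewrite NegzE mulrNz mulrN cosN sinN p1.
- by rewrite NegzE mulrNz mulrN cosN sinN p2 c2 s2 opprK.
- by rewrite NegzE mulrNz mulrN cosN sinN p3 c3 s3.
Qed.

(** The phase is linear in the cosine [A] and the sine [B] of the turning done so far. In the local
    identities these become free variables, so that the real parts carry the whole complex
    identity. *)
Definition phase_value (A B : R) (b : bool) (n : int) : R :=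
  let: (c, s) := octant n in
  if b then (cos alpha * c + sin alpha * s) * A + (sin alpha * c - cos alpha * s) * B
  else A * c - B * s.

Lemma phase_at p c : phase (p *+ 2 + c) =
  phase_value (cos (eta * p%:~R)) (sin (eta * p%:~R)) ((c %% 2)%Z == 1) (c %/ 2)%Z.
Proof.
have hb : ((p *+ 2 + c) %% 2)%Z = (c %% 2)%Z by lia.
rewrite /phase /phase_value octantE hb.
set n := (c %/ 2)%Z; case: eqP => hc.
  have -> : p *+ 2 + c = p *+ 2 + n *+ 2 + 1 by rewrite /n; lia.
  rewrite !mulr2n !intrD.
  have -> : alpha + eta / 2 - eta / 2 * (p%:~R + p%:~R + (n%:~R + n%:~R) + 1%:~R) =
    alpha - eta * n%:~R - eta * p%:~R by field.
  by rewrite cosB (cosB alpha) (sinB alpha).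
have -> : p *+ 2 + c = p *+ 2 + n *+ 2 by rewrite /n; lia.
rewrite !mulr2n !intrD.
have -> : eta / 2 * (p%:~R + p%:~R + (n%:~R + n%:~R)) = eta * p%:~R + eta * n%:~R by field.
by rewrite cosD.
Qed.

(** Orientation of the side when the boundary of the rhombus is run counterclockwise: the local
    relation is a vanishing discrete contour integral. *)
Definition sgn (d : compass) : R := match d with South | East => 1 | _ => -1 end.

Let u1 := weight_u1 theta.
Let u2 := weight_u2 theta.
Let v := weight_v theta.
Let w1 := weight_w1 theta.
Let w2 := weight_w2 theta.
Let rw := rhombus_weight u1 u2 v w1 w2.
Let ca := cos alpha.
Let sa := sin alpha.
Let D := weight_denom theta.

Lemma weightsE : [/\ D = (- h * ca - h * sa) * (S * ca - C * sa),
  u1 = - h * (S * ca + C * sa) / D, u2 = - h * sa / D,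
  v = (S * ca + C * sa) * (- sa) / D &
  w1 = (S * ca + C * sa) * (- h * ca + h * sa) / D /\
  w2 = (C * ca + S * sa) * (- sa) / D].
Proof.
have [e1 e2 e3] := octant_double.
have a2 : 5 * pi / 4 = eta * 2%:~R by rewrite /eta; field.
have a3 : 15 * pi / 8 = eta * 3%:~R by rewrite /eta; field.
have := octantE 2; have := octantE 3; rewrite /= -a2 -a3 => -[c3 s3] [c2 s2].
have eD : D = (- h * ca - h * sa) * (S * ca - C * sa).
  by rewrite /D /weight_denom -/alpha -/eta sinD sinB -c2 -s2 -/C -/S -/ca -/sa; ring.
rewrite /u1 /u2 /v /w1 /w2 /weight_u1 /weight_u2 /weight_v /weight_w1 /weight_w2.
rewrite -/D -/alpha -/eta !sinN !(sinB, sinD) -c2 -s2 -c3 -s3 -/C -/S -/ca -/sa.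
by split=> //; try (split=> //); congr (_ / D); ring.
Qed.

Hypothesis htheta : pi / 3 <= theta <= 2 * pi / 3.

Lemma denom_neq0 : D != 0.
Proof.
have p0 := pi_gt0 R; case/andP: htheta => t1 t2.
rewrite /D /weight_denom mulf_neq0 //; last first.
  by rewrite gt_eqF // sin_gt0_pi //; lra.
have -> : 5 * pi / 4 + 3 * theta / 8 = pi / 4 + 3 * theta / 8 + pi by field.
by rewrite sinDpi oppr_eq0 gt_eqF // sin_gt0_pi //; lra.
Qed.

(* Everything is expressed through [x] = 2 sin (5 pi / 8) and [y] = sqrt 2. *)
Lemma octant_param : exists x y, [/\ y * y = 2, x * x = 2 + y, h = y / 2, S = x / 2 &
  C = (x - y * x) / 2].
Proof.
have [k1 k2 k3 k4 [k5 k6]] := octant_products.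
exists (S * 2), (h * 2); split; rewrite ?mulfK ?pnatr_eq0 //; lra.
Qed.

Let oneD (x : R) : x = D * D^-1 * x.
Proof. by rewrite mulfV ?mul1r // denom_neq0. Qed.

Lemma phase_shift p b x : phase (p *+ 2 + b + x) = phase (p *+ 2 + (b + x)).
Proof. by rewrite addrA. Qed.

Ltac compute_phases :=
  rewrite ?phase_shift !phase_at;
  repeat match goal with |- context [phase_value ?A ?B (?c == 1) ?n] =>
    let b' := eval vm_compute in (c == 1) in let n' := eval vm_compute in n in
    change (phase_value A B (c == 1) n) with (phase_value A B b' n')
  end; rewrite /phase_value /=.

(** A walk that stops at a still empty rhombus cancels against its three continuations by one piece;
    only [u1], [u2] and [v] enter. *)
Lemma local_open (d : compass) (q : int) : ((q %% 2)%Z == 1) = vertical d ->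
  sgn d * phase q + \sum_(d' <- others d)
     rw [:: link d d'] * (sgn d' * phase (q + compass_turn d d')) = 0.
Proof.
move=> hq.
have [p ->] : exists p, q = p *+ 2 + (vertical d)%:Z.
  by exists (q %/ 2)%Z; move: hq; case: (vertical d) => /=; lia.
have [x [y [k1 k2 k3 k4 k5]]] := octant_param.
have [eD e1 e2 e3 [e4 e5]] := weightsE.
have k7 : ca * ca = 1 - sa * sa.
  by rewrite -(cos2Dsin2 alpha) !expr2 addrK.
(* The walk without continuation carries no denominator; it is given the common factor 1 / D of the
   other terms. *)
rewrite (oneD (sgn d * _)) [X in X * D^-1 * _]eD.
move: hq => _; case: d; rewrite !big_cons big_nil /= ?e1 ?e2 ?e3; compute_phases.
all: rewrite -/ca -/sa; move: (cos (eta * p%:~R)) (sin (eta * p%:~R)) => A B.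
all: clear eD e1 e2 e3 e4 e5; move: (D^-1) => Di; clearbody C S h ca sa; subst h S C.
(* Polynomial identities modulo y^2 = 2, x^2 = 2 + y and cos^2 + sin^2 = 1. *)
all: by field: k1 k2 k7.
Qed.

(* Contribution of the two walks that enter through [d1], leave through [a],
   come back through [b] after [l] quarter turns, and either stop there or go
   on to [d4]; the second one counts 0 when its pieces are incompatible. *)
Definition loop_part (d1 a b d4 : compass) (q l : int) : R :=
  rw [:: link d1 a] * (sgn b * phase (q + (compass_turn d1 a + l)))
  + rw (selected (fun p => (p == link d1 a) || (p == link b d4)))
    * (sgn d4 * phase (q + (compass_turn d1 a + l + compass_turn b d4))).

(** The loop may be run in both directions, and each time the only free side for a continuation is
    [d4]. These are the relations that involve [w1] and [w2]. *)
Lemma local_loop (d1 d2 d3 d4 : compass) (q : int) :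
  ((q %% 2)%Z == 1) = vertical d1 -> uniq [:: d1; d2; d3; d4] ->
  loop_part d1 d2 d3 d4 q (compass_loop d1 d2 d3)
  + loop_part d1 d3 d2 d4 q (- compass_loop d1 d2 d3) = 0.
Proof.
move=> hq.
have [p ->] : exists p, q = p *+ 2 + (vertical d1)%:Z.
  by exists (q %/ 2)%Z; move: hq; case: (vertical d1) => /=; lia.
have [x [y [k1 k2 k3 k4 k5]]] := octant_param.
have [eD e1 e2 e3 [e4 e5]] := weightsE.
have k7 : ca * ca = 1 - sa * sa.
  by rewrite -(cos2Dsin2 alpha) !expr2 addrK.
rewrite /loop_part; case: d1 hq => _; case: d2 => //; case: d3 => //; case: d4 => // _ /=.
all: compute_phases; rewrite ?e1 ?e2 ?e3 ?e4 ?e5.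
all: rewrite -/ca -/sa; move: (cos (eta * p%:~R)) (sin (eta * p%:~R)) => A B.
all: clear eD e1 e2 e3 e4 e5; move: (D^-1) => Di; clearbody C S h ca sa; subst h S C.
all: by field: k1 k2 k7.
Qed.
End Phases.

(** * Signs and sizes of the weights *)

Lemma cos_le (R : realType) (x y : R) : 0 <= x -> x <= y -> y <= pi -> cos y <= cos x.
Proof.
move=> x0; rewrite le_eqVlt => /orP[/eqP-> //|xy] ypi.
by apply/ltW; rewrite ltr_cos ?in_itv /=; lra.
Qed.

Section WeightBounds.
Variables (R : realType) (theta : R).
Hypothesis htheta : pi / 3 <= theta <= 2 * pi / 3.

Let eta : R := 5 * pi / 8.
Let alpha : R := 3 * theta / 8.
Let C : R := cos eta.
Let S : R := sin eta.
Let h : R := - sin (eta *+ 2).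
Let ca := cos alpha.
Let sa := sin alpha.
Let D := weight_denom theta.

Lemma alpha_bounds : pi / 8 <= alpha <= pi / 4.
Proof. by rewrite /alpha; have := pi_gt0 R; case/andP: htheta => ? ? ?; lra. Qed.

Lemma octant_signs : [/\ C < 0, 0 < S & 0 < h].
Proof.
have p0 := pi_gt0 R.
have hS : 0 < S by rewrite sin_gt0_pi // /eta; lra.
have hC : C < 0.
  have -> : C = - sin (pi / 8).
    rewrite /C /eta (_ : 5 * pi / 8 = pi / 8 + pi / 2); last by field.
    by rewrite cosD cos_pihalf sin_pihalf mulr0 mulr1 sub0r.
  by rewrite oppr_lt0 sin_gt0_pi //; lra.
have [_ e _] := octant_double R.
by split=> //; move: e; rewrite -/eta -/C -/S -/h; nra.
Qed.

Lemma angle_signs : [/\ 0 < ca, 0 < sa, 0 < S * ca + C * sa, 0 < S * ca - C * sa &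
  [/\ sa <= ca, 0 <= C * ca + S * sa & C * ca - S * sa < 0]].
Proof.
have p0 := pi_gt0 R; have /andP[a1 a2] := alpha_bounds.
have hsc : sa <= ca.
  rewrite /sa /ca -cosBpihalf -cosN opprB.
  by apply: cos_le; lra.
split; last split=> //.
- by rewrite cos_gt0_pihalf //; lra.
- by rewrite sin_gt0_pi //; lra.
- by rewrite /S /ca /C /sa -sinD sin_gt0_pi // /eta; lra.
- by rewrite /S /ca /C /sa -sinB sin_gt0_pi // /eta; lra.
- by rewrite /S /ca /C /sa -cosB cos_ge0_pihalf // /eta; lra.
- rewrite /S /ca /C /sa -cosD.
  have -> : eta + alpha = (alpha + pi / 8) + pi / 2 by rewrite /eta; field.
  by rewrite cosD cos_pihalf sin_pihalf mulr0 mulr1 sub0r oppr_lt0 sin_gt0_pi //; lra.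
Qed.

(** The inequality behind both w1 <= u1^2 and w2 <= u2^2. The difference of the two sides is sin b
    (cos eta + cos (eta - 2 b)), and eta - 2 b lies between pi / 8 and 3 pi / 8 = pi - eta. *)
Lemma double_visit_trig (b : R) : pi / 8 <= b <= pi / 4 ->
  (cos b * cos b - sin b * sin b) * sin (eta - b) <= sin (eta + b).
Proof.
move=> /andP[b1 b2]; have p0 := pi_gt0 R.
have hs : 0 < sin b by rewrite sin_gt0_pi //; lra.
have k : - C <= cos (eta - b *+ 2).
  have -> : - C = cos (pi - eta) by rewrite cosB cospi sinpi mul0r addr0 mulN1r.
  by apply: cos_le; rewrite /eta ?mulr2n; lra.
have e : cos b * cos b = 1 - sin b * sin b by rewrite -(cos2Dsin2 b) !expr2 addrK.
have e2 : cos (eta - b *+ 2) = C * (1 - 2 * (sin b * sin b)) + 2 * (S * (sin b * cos b)).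
  by rewrite cosB mulr2n cosD sinD -/C -/S e; ring.
rewrite e2 in k; rewrite sinB sinD -/S -/C e.
rewrite -subr_ge0.
have -> : S * cos b + C * sin b - (1 - sin b * sin b - sin b * sin b) * (S * cos b - C * sin b) =
  sin b * (C + (C * (1 - 2 * (sin b * sin b)) + 2 * (S * (sin b * cos b)))) by ring.
by rewrite mulr_ge0 ?(ltW hs) //; move: k; rewrite -subr_ge0 opprK addrC.
Qed.

Let u1 := weight_u1 theta.
Let u2 := weight_u2 theta.
Let v := weight_v theta.
Let w1 := weight_w1 theta.
Let w2 := weight_w2 theta.

Lemma denom_lt0 : D < 0.
Proof.
have [eD _ _ _ _] := weightsE theta; have [c1 c2 c3] := octant_signs.
have [a1 a2 a3 a4 _] := angle_signs.
rewrite /D eD -/eta -/alpha -/C -/S -/h -/ca -/sa.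
by rewrite nmulr_rlt0 //; nra.
Qed.

Lemma weights_gt0 : [/\ 0 < u1, 0 < u2 & 0 < v].
Proof.
have [_ e1 e2 e3 _] := weightsE theta; have [c1 c2 c3] := octant_signs.
have [a1 a2 a3 a4 _] := angle_signs; have d0 := denom_lt0.
rewrite /u1 /u2 /v e1 e2 e3 -/eta -/alpha -/C -/S -/h -/ca -/sa -/D.
clear e1 e2 e3; clearbody h C S ca sa D.
by split; rewrite nmulr_lgt0 ?invr_lt0 // ?mulNr ?mulrN oppr_lt0 mulr_gt0.
Qed.

(** The range of theta is used to its ends: [w1] vanishes at 2 pi / 3, where [sa] = [ca], and [w2]
    at pi / 3, where eta - alpha = pi / 2. *)
Lemma double_ge0 : 0 <= w1 /\ 0 <= w2.
Proof.
have [_ _ _ _ [e4 e5]] := weightsE theta; have [c1 c2 c3] := octant_signs.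
have [a1 a2 a3 a4 [a5 a6 _]] := angle_signs; have d0 := denom_lt0.
rewrite /w1 /w2 e4 e5 -/eta -/alpha -/C -/S -/h -/ca -/sa -/D.
clear e4 e5; clearbody h C S ca sa D.
split; rewrite nmulr_lge0 ?invr_lt0 //.
  by rewrite pmulr_rle0 // mulNr addrC -mulrBr pmulr_rle0 // subr_le0.
by rewrite mulrN oppr_le0 mulr_ge0 // ltW.
Qed.

Lemma double_w1 : w1 <= u1 * u1.
Proof.
have [eD e1 _ _ [e4 _]] := weightsE theta; have [c1 c2 c3] := octant_signs.
have [a1 a2 a3 a4 _] := angle_signs; have d0 := denom_lt0.
have k := double_visit_trig alpha_bounds.
rewrite sinB sinD -/S -/C -/ca -/sa in k.
rewrite /u1 /w1 e1 e4 -/eta -/alpha -/C -/S -/h -/ca -/sa -/D -subr_ge0.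
have -> : - h * (S * ca + C * sa) / D * (- h * (S * ca + C * sa) / D) -
  (S * ca + C * sa) * (- h * ca + h * sa) / D =
  ((S * ca + C * sa) * h) * (h * (S * ca + C * sa) + (ca - sa) * D) * (D^-1) ^+ 2.
  by field; rewrite lt_eqF.
rewrite mulr_ge0 ?sqr_ge0 // mulr_ge0 //; first by rewrite mulr_ge0 ?ltW.
rewrite /D eD -/eta -/alpha -/C -/S -/h -/ca -/sa.
have -> : h * (S * ca + C * sa) + (ca - sa) * ((- h * ca - h * sa) * (S * ca - C * sa)) =
  h * ((S * ca + C * sa) - (ca * ca - sa * sa) * (S * ca - C * sa)) by ring.
by rewrite mulr_ge0 ?subr_ge0 // ltW.
Qed.

Lemma double_w2 : w2 <= u2 * u2.
Proof.
have [eD _ e2 _ [_ e5]] := weightsE theta; have [c1 c2 c3] := octant_signs.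
have [a1 a2 a3 a4 _] := angle_signs; have d0 := denom_lt0.
have [_ k2 k3 _ [_ _]] := octant_products R; rewrite -/eta -/C -/S -/h in k2 k3.
have [k1 _ _ _ _] := octant_products R; rewrite -/eta -/h in k1.
have p0 := pi_gt0 R.
(* This is [alpha] for the angle pi - theta, the exchange of the two kinds of arcs. *)
have hb : pi / 8 <= 3 * pi / 8 - alpha <= pi / 4 by have := alpha_bounds; lra.
have k := double_visit_trig hb.
have e1 : 3 * pi / 8 - alpha = pi - (eta + alpha) by rewrite /eta; field.
have f1 : sin (3 * pi / 8 - alpha) = S * ca + C * sa.
  by rewrite e1 sinB sinpi cospi mul0r sub0r mulN1r opprK sinD.
have f2 : cos (3 * pi / 8 - alpha) = S * sa - C * ca.
  by rewrite e1 cosB sinpi cospi mul0r addr0 mulN1r cosD opprB.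
have f3 : sin (eta + (3 * pi / 8 - alpha)) = sa.
  rewrite (_ : eta + _ = pi - alpha); last by rewrite /eta; field.
  by rewrite sinB sinpi cospi mul0r sub0r mulN1r opprK.
have f4 : sin (eta - (3 * pi / 8 - alpha)) = h * (ca + sa).
  rewrite (_ : eta - _ = alpha + eta *+ 2 - pi); last by rewrite /eta mulr2n; field.
  have [_ _ e] := octant_double R; rewrite -/eta -/C -/S -/h in e.
  have s2 : sin (eta *+ 2) = - h by rewrite /h opprK.
  have c2' : cos (eta *+ 2) = - h by rewrite mulr2n cosD -/C -/S e.
  by rewrite sinB sinpi cospi mulr0 subr0 mulrN1 sinD s2 c2' -/ca -/sa; ring.
rewrite f1 f2 f3 f4 in k.
have [d1 d2 d3] := octant_double R; rewrite -/eta -/C -/S -/h in d1 d2 d3.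
(* That is cos (2 eta + 2 alpha) = sin (2 eta - 2 alpha), true because 2 eta = 5 pi / 4. *)
have f5 : (S * sa - C * ca) * (S * sa - C * ca) - (S * ca + C * sa) * (S * ca + C * sa) =
   2 * ((C * ca + S * sa) * (S * ca - C * sa)).
  have -> : (S * sa - C * ca) * (S * sa - C * ca) - (S * ca + C * sa) * (S * ca + C * sa) =
    (C * C - S * S) * (ca * ca - sa * sa) - 2 * (2 * (C * S)) * (sa * ca) by ring.
  have -> : 2 * ((C * ca + S * sa) * (S * ca - C * sa)) =
    2 * (C * S) * (ca * ca - sa * sa) - 2 * (C * C - S * S) * (sa * ca) by ring.
  by rewrite d2 d3; ring.
rewrite f5 in k.
rewrite /u2 /w2 e2 e5 -/eta -/alpha -/C -/S -/h -/ca -/sa -/D -subr_ge0.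
have -> : - h * sa / D * (- h * sa / D) - (C * ca + S * sa) * - sa / D =
  sa * ((h * h) * sa + (C * ca + S * sa) * D) * (D^-1) ^+ 2.
  by field; rewrite lt_eqF.
rewrite mulr_ge0 ?sqr_ge0 // mulr_ge0 ?(ltW a2) //.
rewrite /D eD -/eta -/alpha -/C -/S -/h -/ca -/sa.
have -> : (h * h) * sa + (C * ca + S * sa) * ((- h * ca - h * sa) * (S * ca - C * sa)) =
  h * (h * sa - (C * ca + S * sa) * ((ca + sa) * (S * ca - C * sa))) by ring.
rewrite mulr_ge0 ?(ltW c3) //.
have k4 : h * (2 * ((C * ca + S * sa) * (S * ca - C * sa)) * (h * (ca + sa))) <= h * sa.
  by rewrite ler_pM2l.
have k5 : h * (2 * ((C * ca + S * sa) * (S * ca - C * sa)) * (h * (ca + sa))) =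
  (2 * (h * h)) * ((C * ca + S * sa) * ((ca + sa) * (S * ca - C * sa))) by ring.
by rewrite k5 k1 in k4; lra.
Qed.
End WeightBounds.

(** * Weights and lengths as finite products and sums *)

Lemma trace_visited g r : trace g r != [::] -> r \in map face (steps g).
Proof.
rewrite traceE -has_filter => /hasP[p _ /orP[]] /= h; apply/mapP.
  by exists (ends r p); [case: (ends r p) h|exact: shared_face (ends_shared r p)].
exists ((ends r p).2, (ends r p).1) => //; apply: shared_face.
by rewrite shared_sym; case: (ends r p) (ends_shared r p).
Qed.

(** A finite support for the product over all rhombi. A list common to several walks lets their
    weights be compared factor by factor. *)
Definition covers (rs : seq rhombus) (g : seq edge) : Prop :=
  uniq rs /\ forall r, trace g r != [::] -> r \in rs.

Definition visited (g : seq edge) : seq rhombus := undup (map face (steps g)).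

Lemma visited_covers g : covers (visited g) g.
Proof.
by split; [exact: undup_uniq|move=> r /trace_visited; rewrite mem_undup].
Qed.

Lemma covers_all (gs : seq (seq edge)) :
  exists rs, forall g, g \in gs -> covers rs g.
Proof.
exists (undup (flatten (map visited gs))) => g hg; split; first exact: undup_uniq.
move=> r hr; rewrite mem_undup; apply/flattenP; exists (visited g).
  exact: map_f.
by have [_ ->] := visited_covers g.
Qed.

Lemma walk_lengthE k m rs g : covers rs g ->
  walk_length k m g = (\sum_(r <- rs) \sum_(p <- trace g r) piece_length k m p)%N.
Proof.
move=> [u h]; rewrite /walk_length (fsbigE rs) //; last first.
  move=> r _ hr; have /eqP -> : trace g r == [::] by apply: contraNT hr; apply: h.
  by rewrite big_nil.
by apply: eq_bigl => r; rewrite in_setT.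
Qed.

Section Weights.
Variables (R : realType) (u1 u2 v w1 w2 : R).

Definition rw (t : seq piece) : R := rhombus_weight u1 u2 v w1 w2 t.
Definition wt (g : seq edge) : R := walk_weight u1 u2 v w1 w2 g.

Lemma wtE rs g : covers rs g -> wt g = \prod_(r <- rs) rw (trace g r).
Proof.
move=> [u h]; rewrite /wt /walk_weight (fsbigE rs) //; last first.
  by move=> r _ hr; have /eqP -> : trace g r == [::] by apply: contraNT hr; apply: h.
by apply: eq_bigl => r; rewrite in_setT.
Qed.

Definition wt_off (r : rhombus) (g : seq edge) : R :=
  \prod_(r' <- visited g | r' != r) rw (trace g r').

Lemma wt_offE rs r g : covers rs g -> wt_off r g = \prod_(r' <- rs | r' != r) rw (trace g r').
Proof.
move=> [u h].
have [u' h'] := visited_covers g.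
have E (ss : seq rhombus) : uniq ss -> (forall r', trace g r' != [::] -> r' \in ss) ->
    \prod_(r' <- ss | r' != r) rw (trace g r') =
    \big[*%R/1]_(r' \in [set: rhombus]) (if r' != r then rw (trace g r') else 1).
  move=> us hs; rewrite (fsbigE ss) //; last first.
    by move=> r' _ hr; case: ifP => // _;
      have /eqP -> : trace g r' == [::] by apply: contraNT hr; apply: hs.
  by rewrite big_mkcond; apply: eq_bigl => r'; rewrite in_setT.
by rewrite /wt_off !E.
Qed.

Lemma wt_split r g : wt g = rw (trace g r) * wt_off r g.
Proof.
have [u h] := visited_covers g; pose rs := undup (r :: visited g).
have c : covers rs g.
  by split; [exact: undup_uniq|move=> r' /h hr'; rewrite mem_undup inE hr' orbT].
rewrite (wtE c) (wt_offE r c) (bigD1_seq r) ?undup_uniq //.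
by rewrite mem_undup mem_head.
Qed.

Lemma eq_wt_off r g g' : (forall r', r' != r -> trace g r' = trace g' r') ->
  wt_off r g = wt_off r g'.
Proof.
move=> h; have [rs hrs] := covers_all [:: g; g'].
have c1 : covers rs g by apply: hrs; rewrite mem_head.
have c2 : covers rs g' by apply: hrs; rewrite !inE eqxx orbT.
rewrite (wt_offE r c1) (wt_offE r c2).
by apply: eq_bigr => r' /h ->.
Qed.

Lemma eq_wt g g' : (forall r, trace g r = trace g' r) -> wt g = wt g'.
Proof.
move=> h; have [rs hrs] := covers_all [:: g; g'].
have c1 : covers rs g by apply: hrs; rewrite mem_head.
have c2 : covers rs g' by apply: hrs; rewrite !inE eqxx orbT.
rewrite (wtE c1) (wtE c2).
by apply: eq_bigr => r' _; rewrite h.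
Qed.

Lemma wt1 a : wt [:: a] = 1.
Proof. by rewrite (wtE (rs := [::])) ?big_nil //; split=> // r /trace_visited. Qed.

Lemma wt_nil : wt [::] = 1.
Proof. by rewrite (wtE (rs := [::])) ?big_nil //; split=> // r /trace_visited. Qed.

Lemma trace_rev g r : trace (rev g) r = trace g r.
Proof. by rewrite !traceE; apply: eq_selected => p; rewrite joined_rev. Qed.

Lemma wt_rev g : wt (rev g) = wt g.
Proof. by apply: eq_wt => r; rewrite trace_rev. Qed.

Section NonNeg.
Hypotheses (hu1 : 0 < u1) (hu2 : 0 < u2) (hv : 0 < v) (hw1 : 0 <= w1) (hw2 : 0 <= w2).

Lemma rw_ge0 t : 0 <= rw t.
Proof.
by rewrite /rw; case: t => [|[] [|[] [|]]] //=; rewrite ?ler01 ?ltW.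
Qed.

Lemma wt_ge0 g : 0 <= wt g.
Proof. by rewrite (wtE (visited_covers g)) prodr_ge0 // => r _; exact: rw_ge0. Qed.

Hypotheses (hd1 : w1 <= u1 * u1) (hd2 : w2 <= u2 * u2).

(** Equality, except when two opposite arcs are shared out between the parts, where the bounds on
    [w1] and [w2] are used. *)
Lemma rw_sub c c' c'' : admissible (selected c) ->
  (forall p, c p = c' p || c'' p) -> (forall p, ~~ (c' p && c'' p)) ->
  rw (selected c) <= rw (selected c') * rw (selected c'').
Proof.
move=> + hc hn; rewrite /selected /=.
case e1: (c ArcSW); case e2: (c ArcNE); case e3: (c ArcSE); case e4: (c ArcNW);
case e5: (c LineSN); case e6: (c LineWE) => //= _;
move: (hn ArcSW) (hn ArcNE) (hn ArcSE) (hn ArcNW) (hn LineSN) (hn LineWE);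
move: (hc ArcSW) (hc ArcNE) (hc ArcSE) (hc ArcNW) (hc LineSN) (hc LineWE);
rewrite e1 e2 e3 e4 e5 e6;
case: (c' ArcSW); case: (c'' ArcSW) => //; case: (c' ArcNE); case: (c'' ArcNE) => //;
case: (c' ArcSE); case: (c'' ArcSE) => //; case: (c' ArcNW); case: (c'' ArcNW) => //;
case: (c' LineSN); case: (c'' LineSN) => //; case: (c' LineWE); case: (c'' LineWE) => //= *;
by rewrite ?mul1r ?mulr1.
Qed.
End NonNeg.
End Weights.

Lemma selected_length k m (c : piece -> bool) :
  (\sum_(p <- selected c) piece_length k m p =
   (c ArcSW + c ArcNE) * 1 + (c ArcSE + c ArcNW) * k + (c LineSN + c LineWE) * m)%N.
Proof.
rewrite /selected big_filter big_mkcond !big_cons big_nil /= !mulnDl !addn0 !addnA.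
by case: (c ArcSW); case: (c ArcNE); case: (c ArcSE); case: (c ArcNW);
  case: (c LineSN); case: (c LineWE); rewrite /= ?mul1n ?mul0n ?addn0 ?add0n.
Qed.

(** * Lattice symmetries: translations, half-turns and transposition *)

Definition transpose_piece (p : piece) : piece :=
  match p with
  | ArcSW => ArcSW | ArcNE => ArcNE | ArcSE => ArcNW | ArcNW => ArcSE
  | LineSN => LineWE | LineWE => LineSN
  end.

Definition congruent (P : piece -> piece) : Prop :=
  P = id \/ P = opposite \/ P = transpose_piece.

Section Congruent.
Variables (P : piece -> piece) (c c' : piece -> bool).
Hypotheses (hP : congruent P) (hc : forall p, c' (P p) = c p).

Ltac by_pieces :=
  rewrite /selected /= -(hc ArcSW) -(hc ArcNE) -(hc ArcSE) -(hc ArcNW) -(hc LineSN) -(hc LineWE);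
  case: hP => [->|[->|->]] /=; case: (c' ArcSW); case: (c' ArcNE); case: (c' ArcSE);
  case: (c' ArcNW); case: (c' LineSN); case: (c' LineWE).

Lemma congruent_nil : (selected c' == [::]) = (selected c == [::]).
Proof. by by_pieces. Qed.

Lemma congruent_weight (R : realType) (u1 u2 v w1 w2 : R) :
  rw u1 u2 v w1 w2 (selected c') = rw u1 u2 v w1 w2 (selected c).
Proof. by by_pieces. Qed.

Lemma congruent_length k m :
  (\sum_(p <- selected c') piece_length k m p = \sum_(p <- selected c) piece_length k m p)%N.
Proof.
rewrite !selected_length -(hc ArcSW) -(hc ArcNE) -(hc ArcSE) -(hc ArcNW) -(hc LineSN) -(hc LineWE).
by case: hP => [->|[->|->]] /=; lia.
Qed.
End Congruent.

Definition lattice_symmetry (f : edge -> edge) : Prop :=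
  injective f /\ exists (F F' : rhombus -> rhombus) (P : piece -> piece),
  [/\ cancel F F', cancel F' F, congruent P
    & forall r p, piece_ends (F r) (P p) (f (ends r p).1) (f (ends r p).2)].

Section Symmetry.
Variable f : edge -> edge.
Hypothesis hf : lattice_symmetry f.

Lemma steps_map g : steps (map f g) = [seq (f s.1, f s.2) | s <- steps g].
Proof.
elim: g => [|x [|y g] IH] //.
by rewrite -[LHS]/(steps [:: f x, f y & map f g]) steps_cons -[f y :: _]/(map f (y :: g)) IH.
Qed.

Lemma joined_map g a b : joined (map f g) (f a, f b) = joined g (a, b).
Proof.
have [hi _] := hf.
have m x y : ((f x, f y) \in steps (map f g)) = ((x, y) \in steps g).
  rewrite steps_map; apply/mapP/idP => [[[c d] h [/hi-> /hi->]]//|h].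
  by exists (x, y).
by rewrite /joined /= !m.
Qed.

Lemma saw_map g : is_saw g -> is_saw (map f g).
Proof.
move=> hg; have [hi [F [F' [P [FK FK' hP he]]]]] := hf.
have [h1 h2 h3 h4] := hg; split.
- by case: g h1 {hg h2 h3 h4}.
- by rewrite map_inj_uniq.
- move=> a b; rewrite steps_map => /mapP[[c d] hcd [-> ->]].
  have /sharedP[p hp] := saw_face hg hcd.
  exists (F (face (c, d))), (P p); have := he (face (c, d)) p.
  by case: hp => -> /= [] ->; [left|right|right|left].
- move=> r; rewrite -(FK' r) traceE; apply/admissibleP => p p'.
  have PK : cancel P P by case: hP => [->|[->|->]] // -[].
  have hc q : joined (map f g) (ends (F (F' r)) q) = joined g (ends (F' r) (P q)).
    rewrite -{1}(PK q) (joined_piece _ (he _ _)) joined_map.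
    by case: (ends _ _).
  rewrite !hc => hp hp'; have := saw_compatible hg hp hp'.
  rewrite -{2}(PK p) -{2}(PK p') /compatible.
  case/orP => /eqP ->; first by rewrite eqxx.
  by case: hP => [->|[->|->]]; case: p {hp hc}.
Qed.

Lemma symmetry_trace : exists F F' P, [/\ cancel F F', cancel F' F, congruent P &
  forall g r p, joined (map f g) (ends (F r) (P p)) = joined g (ends r p)].
Proof.
have [_ [F [F' [P [FK FK' hP he]]]]] := hf; exists F, F', P; split=> // g r p.
by rewrite (joined_piece _ (he r p)) joined_map; case: (ends r p).
Qed.

Lemma covers_map F F' P g : cancel F F' -> cancel F' F -> congruent P ->
  (forall g r p, joined (map f g) (ends (F r) (P p)) = joined g (ends r p)) ->
  covers (map F (visited g)) (map f g).
Proof.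
move=> FK FK' hP h; have [u hv] := visited_covers g.
split; first by rewrite map_inj_uniq //; exact: can_inj FK.
move=> r; rewrite -(FK' r) traceE (congruent_nil hP (h g _)) => /hv hr.
by apply/mapP; exists (F' r).
Qed.

Lemma wt_map (R : realType) (u1 u2 v w1 w2 : R) g :
  wt u1 u2 v w1 w2 (map f g) = wt u1 u2 v w1 w2 g.
Proof.
have [F [F' [P [FK FK' hP h]]]] := symmetry_trace.
rewrite (wtE _ _ _ _ _ (covers_map g FK FK' hP h)) (wtE _ _ _ _ _ (visited_covers g)) big_map.
by apply: eq_bigr => r _; rewrite !traceE; apply: (congruent_weight hP).
Qed.

Lemma walk_length_map k m g : walk_length k m (map f g) = walk_length k m g.
Proof.
have [F [F' [P [FK FK' hP h]]]] := symmetry_trace.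
rewrite (walk_lengthE _ _ (covers_map g FK FK' hP h)) (walk_lengthE _ _ (visited_covers g)) big_map.
by apply: eq_bigr => r _; rewrite !traceE; apply: (congruent_length hP).
Qed.
End Symmetry.

Definition shift (a b : int) (e : edge) : edge := (e.1, (e.2.1 + a, e.2.2 + b)).

Lemma shift_symmetry a b : lattice_symmetry (shift a b).
Proof.
split; first by move=> [? [? ?]] [? [? ?]] [-> h1 h2]; congr (_, (_, _)); lia.
exists (fun r => (r.1 + a, r.2 + b)), (fun r => (r.1 - a, r.2 - b)), id; split.
- by move=> [i j] /=; congr pair; lia.
- by move=> [i j] /=; congr pair; lia.
- by left.
- by move=> [i j] p; left; case: p; rewrite /ends /shift /south /north /east /west /hedge /vedge /=;
    congr (_, (_, _), (_, (_, _))); lia.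
Qed.

(* The half-turn exchanging the midpoints [hedge 0 0] and [hedge a b]. *)
Definition halfturn (a b : int) (e : edge) : edge :=
  if e.1 then (true, (a + 1 - e.2.1, b - 1 - e.2.2)) else (false, (a - e.2.1, b - e.2.2)).

Lemma halfturn_symmetry a b : lattice_symmetry (halfturn a b).
Proof.
split; first by move=> [[] [? ?]] [[] [? ?]] //= [h1 h2]; congr (_, (_, _)); lia.
exists (fun r => (a - r.1, b - 1 - r.2)), (fun r => (a - r.1, b - 1 - r.2)), opposite; split.
- by move=> [i j] /=; congr pair; lia.
- by move=> [i j] /=; congr pair; lia.
- by right; left.
- by move=> [i j] p; case: p; (left + right);
    solve [rewrite /ends /halfturn /south /north /east /west /hedge /vedge /=;
    congr (_, (_, _), (_, (_, _))); lia].
Qed.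

(** The reflection in the bisector of the angle theta. It serves to start from a vertical edge. *)
Definition transpose (e : edge) : edge := (~~ e.1, (e.2.2, e.2.1)).

Lemma transpose_symmetry : lattice_symmetry transpose.
Proof.
split; first by move=> [[] [? ?]] [[] [? ?]] //= [-> ->].
exists (fun r => (r.2, r.1)), (fun r => (r.2, r.1)), transpose_piece; split.
- by case.
- by case.
- by right; right.
- by move=> [i j] p; case: p; solve [by left | by right].
Qed.

(** * Cancellation around a rhombus *)

Lemma joined2E r q a b r' p' : piece_ends r q a b ->
  joined [:: a; b] (ends r' p') = (r' == r) && (p' == q).
Proof.
move=> hq; rewrite /joined /= !inE.
apply/idP/andP => [h|[/eqP -> /eqP ->]]; last first.
  by case: hq => ->; rewrite eqxx ?orbT.
have e : ends r' p' = (a, b) \/ ends r' p' = (b, a).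
  by case/orP: h => /eqP; case: (ends r' p') => x y [-> ->]; [left|right].
have rr : r' = r.
  have h1 := ends_shared r' p'; have h2 := ends_shared r q; apply: (shared_inj h1).
  by case: e hq => -> [] e2; move: h2; rewrite e2 // shared_sym.
split; apply/eqP => //; subst r'; apply: (@ends_inj r).
by case: e hq => -> [] ->; [left|right|right|left].
Qed.

Lemma joined_glue p a b q ab :
  joined (rcons p a ++ b :: q) ab = [|| joined (rcons p a) ab, joined [:: a; b] ab | joined (b :: q) ab].
Proof.
rewrite cat_rcons joined_cat; congr (_ || _).
by rewrite (joined_cat [:: a]).
Qed.

Lemma joined_rcons p a b ab :
  joined (rcons (rcons p a) b) ab = joined (rcons p a) ab || joined [:: a; b] ab.
Proof.
by rewrite -cats1 joined_glue; congr (_ || _); rewrite orbC.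
Qed.

Lemma rw_inadmissible (R : realType) (u1 u2 v w1 w2 : R) t :
  ~~ admissible t -> rw u1 u2 v w1 w2 t = 0.
Proof. by case: t => [|[] [|[] [|]]]. Qed.

Lemma saw_rcons p a b r q : is_saw (rcons p a) -> b \notin rcons p a ->
  piece_ends r q a b -> admissible (trace (rcons (rcons p a) b) r) ->
  is_saw (rcons (rcons p a) b).
Proof.
move=> hg hb hq ha; have [h1 h2 h3 h4] := hg; split.
- by case: (rcons p a).
- by rewrite rcons_uniq hb.
- move=> x y; rewrite steps_rcons mem_rcons inE => /orP[/eqP[-> ->]|/h3//].
  by exists r, q.
- move=> r'; case: (eqVneq r' r) => [->//|nr].
  suff -> : trace (rcons (rcons p a) b) r' = trace (rcons p a) r' by [].
  by rewrite !traceE; apply: eq_selected => p';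
    rewrite joined_rcons (joined2E _ _ hq) (negPf nr) orbF.
Qed.

Lemma two_faces z r r1 r2 : z \in sides r -> z \in sides r1 -> z \in sides r2 -> r1 != r2 ->
  r = r1 \/ r = r2.
Proof.
rewrite !in_sides => h h1 h2 n.
have nc : (cx r1 != cx r2) || (cy r1 != cy r2).
  apply: contraR n; rewrite negb_or !negbK => /andP[/eqP hx /eqP hy].
  exact/eqP/center_inj.
have oc s : ((cx s %% 2)%Z = 1) /\ ((cy s %% 2)%Z = 1) by rewrite /cx /cy; split; lia.
have [q1 q2] := oc r1; have [q3 q4] := oc r2; have [q5 q6] := oc r.
have := px_type z; have := py_type z; clear oc; case: z.1 => /= t1 t2.
  have e : cy r = py z by lia.
  have e1 : cy r1 = py z by lia.
  have e2 : cy r2 = py z by lia.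
  have [k|k] : cx r = cx r1 \/ cx r = cx r2 by lia.
    by left; apply: center_inj; rewrite // e.
  by right; apply: center_inj; rewrite // e.
have e : cx r = px z by lia.
have e1 : cx r1 = px z by lia.
have e2 : cx r2 = px z by lia.
have [k|k] : cy r = cy r1 \/ cy r = cy r2 by lia.
  by left; apply: center_inj; rewrite // e.
by right; apply: center_inj; rewrite // e.
Qed.

Definition origin : edge := hedge 0 0.

(** The sides of the rhombi in the columns -L to L and the rows 0 to T - 1; the east wall of column
    L has abscissa 2 L + 2. *)
Definition in_box (T L : nat) (e : edge) : bool :=
  [&& - (L%:Z *+ 2) <= px e, px e <= L%:Z *+ 2 + 2, 0 <= py e & py e <= T%:Z *+ 2].

Definition rhombus_in_box (T L : nat) (r : rhombus) : bool :=
  [&& - L%:Z <= r.1, r.1 <= L%:Z, 0 <= r.2 & r.2 < T%:Z].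

Definition box_walk (T L : nat) (g : seq edge) : Prop :=
  [/\ is_saw g, ohead g = Some origin & all (in_box T L) g].

Lemma side_in_box T L r e : rhombus_in_box T L r -> e \in sides r -> in_box T L e.
Proof.
move=> /and4P[h1 h2 h3 h4]; rewrite !inE /in_box.
by move=> /or4P[] /eqP ->; rewrite /px /py /=; lia.
Qed.

Lemma side_inP r e : e \in sides r -> exists d, e = side r d.
Proof.
rewrite !inE => /or4P[] /eqP ->;
by [exists South|exists East|exists North|exists West].
Qed.

Lemma side_in r d : side r d \in sides r.
Proof. by rewrite !inE; case: d; rewrite /= eqxx ?orbT. Qed.

Lemma side_inj r : injective (side r).
Proof.
move=> d d'; case: r => i j.
by case: d; case: d' => // -[] *; lia.
Qed.

Lemma link_ends r d d' : d != d' -> piece_ends r (link d d') (side r d) (side r d').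
Proof. by case: d; case: d' => //= _; by [left|right]. Qed.

Lemma turn_side r d d' : turn (side r d) (side r d') = compass_turn d d'.
Proof.
by case: r => i j; case: d; case: d'; rewrite /turn /compass_turn /px /py /=; lia.
Qed.

Lemma secant_side r a b c d :
  secant (side r a) (side r b) (side r c) (side r d) = compass_secant a b c d.
Proof.
have hx e : px (side r e) = r.1 *+ 2 + ox e by case: e; rewrite /px /=; lia.
have hy e : py (side r e) = r.2 *+ 2 + oy e by case: e; rewrite /py /=; lia.
by rewrite /secant /compass_secant !hx !hy; congr rotation; lia.
Qed.

Lemma side_vertical r d : (side r d).1 = vertical d.
Proof. by case: d. Qed.

Section Visits.
Variables (T L : nat) (r : rhombus).
Hypothesis hr : rhombus_in_box T L r.

(** A walk that has met no side of [r] before [z] arrives there through the other rhombus of [z], so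
    it goes on inside [r]. If it starts at [z], the other rhombus is below the box. *)
Lemma first_visit p z z' q : box_walk T L (p ++ z :: z' :: q) -> z \in sides r ->
  all (fun e => e \notin sides r) p -> shared r (z, z').
Proof.
move=> [hg ho hb] hz hp.
have hzz : (z, z') \in steps (p ++ z :: z' :: q).
  by rewrite steps_cat steps_cons mem_cat mem_head orbT.
have sh := saw_face hg hzz; set r1 := face (z, z') in sh.
have hz1 : z \in sides r1 by case/and3P: sh.
case/lastP: p hg ho hb hp hzz => [|p x] hg ho hb hp hzz.
  suff -> : r = r1 by [].
  have ez : z = origin by case: ho.
  have hz' : z' \in sides r1 by case/and3P: sh.
  have /and3P[_ /and4P[_ _ hy _] _] : [&& in_box T L z, in_box T L z' & all (in_box T L) q] := hb.
  have /edge_neq n : origin != z' by rewrite -ez; case/and3P: sh.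
  move: hz hz1 hz' hr; rewrite ez !in_sides => h1 h2 h3 /and4P[_ _ h4 _].
  have e0 : (px origin = 1) * (py origin = 0) by [].
  rewrite !e0 in h1 h2 n.
  have k1 : cx r1 = 1 /\ (cy r1 = 1 \/ cy r1 = -1) by move: h2; rewrite /cx /cy; lia.
  by apply: center_inj; move: h1 h3 h4 hy n k1; rewrite /cx /cy; lia.
have hxz : (x, z) \in steps (rcons p x ++ z :: z' :: q).
  by rewrite cat_rcons steps_cat steps_cons mem_cat mem_head orbT.
have sh2 := saw_face hg hxz; set r2 := face (x, z) in sh2.
have hz2 : z \in sides r2 by case/and3P: sh2.
have n12 : r2 != r1.
  apply/eqP => e; have j1 : joined (rcons p x ++ z :: z' :: q) (x, z) by rewrite /joined hxz.
  have j2 : joined (rcons p x ++ z :: z' :: q) (z, z') by rewrite /joined hzz.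
  have := saw_turn hg j1 j2 sh2; rewrite e => /(_ sh) exz.
  have : uniq (rcons p x ++ z :: z' :: q) by case: hg.
  by rewrite exz cat_uniq => /and3P[_ /hasPn/(_ z')]; rewrite !inE eqxx orbT mem_rcons mem_head => /(_ isT).
case: (two_faces hz hz2 hz1 n12) => [er|->//].
move: hp; rewrite all_rcons => /andP[/negP[]].
by rewrite er; case/and3P: sh2.
Qed.

Lemma visit g z : box_walk T L g -> z \in g -> z != last origin g -> z \in sides r ->
  exists2 z', joined g (z, z') & shared r (z, z').
Proof.
move=> hw hz hl hs.
have [p [q eg]] : exists p q, g = p ++ z :: q by case/splitPr: hz => p q; exists p, q.
case: q eg => [|z' q] eg; first by move: hl; rewrite eg last_cat /= eqxx.
have hg : is_saw g by case: hw.
have hzz : (z, z') \in steps g by rewrite eg steps_cat steps_cons mem_cat mem_head orbT.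
case: (lastP p) eg => [|p' x] eg.
  exists z'; first by rewrite /joined hzz.
  by apply: (@first_visit [::] z z' q); rewrite // -eg.
case: (boolP (x \in sides r)) => hx; last first.
  have hxz : (x, z) \in steps g by rewrite eg cat_rcons steps_cat steps_cons mem_cat mem_head orbT.
  exists z'; first by rewrite /joined hzz.
  have sh := saw_face hg hzz; have sh2 := saw_face hg hxz.
  have n12 : face (x, z) != face (z, z').
    apply/eqP => e; have j1 : joined g (x, z) by rewrite /joined hxz.
    have j2 : joined g (z, z') by rewrite /joined hzz.
    have := saw_turn hg j1 j2 sh2; rewrite e => /(_ sh) exz.
    have : uniq g by case: hg.
    by rewrite eg exz cat_uniq => /and3P[_ /hasPn/(_ z')]; rewrite !inE eqxx orbT mem_rcons mem_head => /(_ isT).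
  have hz2 : z \in sides (face (x, z)) by case/and3P: sh2.
  have hz1 : z \in sides (face (z, z')) by case/and3P: sh.
  case: (two_faces hs hz2 hz1 n12) => [er|->//].
  by move: hx; rewrite er; case/and3P: sh2 => ->.
have hxz : (x, z) \in steps g by rewrite eg cat_rcons steps_cat steps_cons mem_cat mem_head orbT.
exists x; first by rewrite joined_sym /joined hxz.
have nxz : x != z by case/and3P: (saw_face hg hxz).
by rewrite /shared /= hs hx eq_sym.
Qed.
End Visits.

Section Flux.
Variables (R : realType) (theta : R).
Variable r : rhombus.

Let weight := wt (weight_u1 theta) (weight_u2 theta) (weight_v theta) (weight_w1 theta) (weight_w2 theta).

Definition side_sign (e : edge) : R :=
  (e == south r)%:R + (e == east r)%:R - (e == north r)%:R - (e == west r)%:R.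

Lemma side_signE d : side_sign (side r d) = sgn R d.
Proof.
have hi x y : (side r x == side r y) = (x == y).
  by apply/eqP/eqP => [/side_inj|->].
rewrite /side_sign -[south r]/(side r South) -[east r]/(side r East)
  -[north r]/(side r North) -[west r]/(side r West) !hi.
by case: d => /=; ring.
Qed.

Definition flux (g : seq edge) : R :=
  weight g * phase theta (winding g) * side_sign (last origin g).
End Flux.

Lemma find_all (A : eqType) (a : pred A) p (x : A) s :
  all (fun e => ~~ a e) p -> a x -> find a (rcons p x ++ s) = size p.
Proof.
move=> hp hx; rewrite cat_rcons find_cat.
have /hasPn/negPf -> : {in p, forall e, ~~ a e} by exact/allP.
by rewrite /= hx addn0.
Qed.

Lemma step_to_last p y z x : uniq (rcons (rcons p y) z) ->
  joined (rcons (rcons p y) z) (x, z) -> x = y.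
Proof.
move=> u; rewrite joined_rcons => /orP[/joined_in[_ h]|].
  by move: u; rewrite rcons_uniq h.
by rewrite /joined /= !inE => /orP[] /eqP [-> //].
Qed.

Lemma compass_fourth (d1 d2 d3 : compass) : uniq [:: d1; d2; d3] ->
  exists d4, uniq [:: d1; d2; d3; d4].
Proof.
by case: d1; case: d2; case: d3 => // _;
  first [by exists South | by exists East | by exists North | by exists West].
Qed.

Lemma selected1 q : selected (fun p => p == q) = [:: q].
Proof. by case: q. Qed.

Lemma compass_perm (s : seq compass) : uniq s -> size s = 4%N ->
  perm_eq [:: South; East; North; West] s.
Proof.
move=> us hs; apply: uniq_perm; rewrite ?us //.
have h : {subset s <= [:: South; East; North; West]} by case.
have [//|_ e] := uniq_min_size us h; first by rewrite hs.
by move=> d; rewrite e.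
Qed.

Section LocalRelation.
Variables (R : realType) (theta : R).
Hypothesis htheta : pi / 3 <= theta <= 2 * pi / 3.
Variables (T L : nat) (r : rhombus).
Hypothesis hr : rhombus_in_box T L r.
Variable ws : seq (seq edge).
Hypotheses (uws : uniq ws) (hws : forall g, g \in ws <-> box_walk T L g).

Let rwt := rw (weight_u1 theta) (weight_u2 theta) (weight_v theta) (weight_w1 theta) (weight_w2 theta).
Let weight := wt (weight_u1 theta) (weight_u2 theta) (weight_v theta) (weight_w1 theta) (weight_w2 theta).
Let off := wt_off (weight_u1 theta) (weight_u2 theta) (weight_v theta) (weight_w1 theta) (weight_w2 theta) r.
Let flow := flux theta r.

(** The last step lies in [r]. These walks are continuations; the other walks that end on [r] index
    the groups. *)
Definition arriving (g : seq edge) : bool :=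
  let p := take (size g).-1 g in (p != [::]) && shared r (last origin p, last origin g).

Lemma arriving_rcons p y z : arriving (rcons (rcons p y) z) = shared r (y, z).
Proof.
rewrite /arriving; have -> : take (size (rcons (rcons p y) z)).-1 (rcons (rcons p y) z) = rcons p y.
  by rewrite size_rcons /= -[X in take _ X]cats1 take_size_cat.
by rewrite !last_rcons; case: (rcons p y) (size_rcons p y).
Qed.

(* A walk that reaches [r] from outside is grouped with its continuations by one
   more step inside [r]. *)
Definition group (g : seq edge) : R :=
  flow g + \sum_(z <- sides r | rcons g z \in ws) flow (rcons g z).

Lemma box_walk_rcons g d : box_walk T L g -> g != [::] -> is_saw (rcons g (side r d)) ->
  box_walk T L (rcons g (side r d)).
Proof.
move=> [h1 h2 h3] hg h; split=> //; first by case: g hg h2 {h h1 h3}.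
by rewrite all_rcons h3 andbT; apply: (side_in_box hr); exact: side_in.
Qed.

Lemma group_ends p z d (ok : compass -> bool) :
  box_walk T L (rcons p z) -> z = side r d ->
  (forall d', side r d' \notin rcons p z -> ok d') ->
  (forall d', ok d' -> side r d' \notin rcons p z) ->
  group (rcons p z) = flow (rcons p z) + \sum_(d' <- [:: South; East; North; West] | ok d')
    rwt (trace (rcons (rcons p z) (side r d')) r) * off (rcons p z) *
    phase theta (winding (rcons p z) + turn z (side r d')) * sgn R d'.
Proof.
move=> hw ez ok1 ok2; rewrite /group; congr (_ + _).
rewrite -[sides r]/(map (side r) [:: South; East; North; West]) big_map.
rewrite [LHS]big_mkcond [RHS]big_mkcond; apply: eq_bigr => d' _.
have hsaw : is_saw (rcons p z) by case: hw.
case: (boolP (ok d')) => hok; last first.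
  case: ifP => // /hws[[_ u _ _] _ _]; move: u; rewrite rcons_uniq => /andP[/ok1 h _].
  by rewrite h in hok.
have hn := ok2 _ hok.
have nd : d != d' by apply: contraNneq hn => <-; rewrite -ez mem_rcons mem_head.
have hl := link_ends r nd; rewrite -ez in hl.
have e : flow (rcons (rcons p z) (side r d')) = rwt (trace (rcons (rcons p z) (side r d')) r) *
    off (rcons p z) * phase theta (winding (rcons p z) + turn z (side r d')) * sgn R d'.
  rewrite /flow /flux last_rcons side_signE (wt_split _ _ _ _ _ r).
  rewrite /winding wsum_rcons; congr (_ * _ * _ * _); apply: eq_wt_off => r' nr.
  by rewrite !traceE; apply: eq_selected => q; rewrite joined_rcons (joined2E _ _ hl) (negPf nr) orbF.
(* A continuation that is not a walk has an inadmissible trace in [r], of weight 0, so it may be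
   included in the sum. *)
case: ifP => [_ //|/negP hnot].
have hna : ~~ admissible (trace (rcons (rcons p z) (side r d')) r).
  apply/negP => ha; apply: hnot; apply/hws; apply: box_walk_rcons => //; first by case: (p).
  exact: saw_rcons hsaw hn hl ha.
by rewrite /rwt rw_inadmissible // !mul0r.
Qed.

(** The rhombus is still empty, and what the walk weighs elsewhere is a common factor of the group:
    [local_open] applies. *)
Lemma group_open p z d : box_walk T L (rcons p z) -> z = side r d ->
  all (fun e => e \notin sides r) p -> group (rcons p z) = 0.
Proof.
move=> hw ez hp.
have hs : is_saw (rcons p z) by case: hw.
have hno d' : d' != d -> side r d' \notin rcons p z.
  move=> nd; rewrite mem_rcons inE negb_or ez; apply/andP; split.
    by apply: contraNneq nd => /side_inj ->.
  by apply/negP => /(allP hp); rewrite side_in.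
rewrite (group_ends (ok := fun d' => d' != d) hw ez) //; last first.
  move=> d'; apply: contraNneq => ->; by rewrite -ez mem_rcons mem_head.
have tn q : joined (rcons p z) (ends r q) = false.
  apply/negP => hj.
  have /and3P[s1 s2 s3] := ends_shared r q.
  have [h1 h2] : (ends r q).1 \in rcons p z /\ (ends r q).2 \in rcons p z.
    by apply: joined_in; case: (ends r q) hj.
  move: s3; have k e : e \in rcons p z -> e \in sides r -> e = z.
    by rewrite mem_rcons inE => /orP[/eqP->//|/(allP hp) /negPf ->].
  by rewrite (k _ h1 s1) (k _ h2 s2) eqxx.
have -> : flow (rcons p z) = off (rcons p z) * (sgn R d * phase theta (winding (rcons p z))).
  rewrite /flow /flux last_rcons ez side_signE (wt_split _ _ _ _ _ r) -ez.
  have -> : trace (rcons p z) r = [::].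
    rewrite traceE (@eq_selected _ (fun=> false)) //.
  by rewrite /rw /= mul1r -/(off _) -mulrA [_ * sgn _ _]mulrC.
have he d' : d' != d -> rwt (trace (rcons (rcons p z) (side r d')) r) = rwt [:: link d d'].
  move=> nd; congr rwt; rewrite traceE -selected1; apply: eq_selected => q.
  have hl : piece_ends r (link d d') z (side r d') by rewrite ez; apply: link_ends; rewrite eq_sym.
  by rewrite joined_rcons tn (joined2E _ _ hl) eqxx.
have perm4 (a b x y : R) : a * b * x * y = b * (a * (y * x)) by ring.
have par : ((winding (rcons p z) %% 2)%Z == 1) = vertical d.
  have [q eq] : exists q, rcons p z = origin :: q.
    by case: hw => _; case: (rcons p z) => // x q [->] _; exists q.
  have := hs; rewrite eq => /winding_parity ->; rewrite -(side_vertical r) -ez.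
  have <- : last origin q = z by rewrite -(last_rcons origin p z) eq.
  by case: (last origin q).1.
have := local_open htheta par; set F := \sum_(_ <- others d) _ => hF.
rewrite (_ : \sum_(_ <- _ | _) _ = off (rcons p z) * F) -?mulrDr ?hF ?mulr0 //.
rewrite /F mulr_sumr.
rewrite (_ : \sum_(d' <- others d) _ = \sum_(d' <- [:: South; East; North; West] | d' != d)
   off (rcons p z) * (rw (weight_u1 theta) (weight_u2 theta) (weight_v theta) (weight_w1 theta)
     (weight_w2 theta) [:: link d d'] * (sgn R d' * phase theta (winding (rcons p z) + compass_turn d d')))).
  by apply: eq_bigr => d' nd; rewrite he // perm4 ez turn_side.
by case: (d); rewrite !big_cons !big_nil.
Qed.

Lemma winding_glue p z1 z2 s :
  winding (rcons p z1 ++ z2 :: s) = winding (rcons p z1) + turn z1 z2 + winding (z2 :: s).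
Proof. by rewrite /winding cat_rcons wsum_cat wsum_cons addrA. Qed.

Lemma fourth_side (d1 d2 d3 d4 d : compass) : uniq [:: d1; d2; d3; d4] ->
  d \in [:: d1; d2; d3; d4].
Proof. by move=> ud; rewrite -(perm_mem (compass_perm ud erefl)); case: d. Qed.

(** Besides the entering piece, [r] could hold only the opposite one, on the two other sides; as
    [d4] is not visited, both of its ends would be [z3]. *)
Lemma loop_trace p z1 z2 m z3 d1 d2 d3 d4 :
  let g := rcons p z1 ++ z2 :: rcons m z3 in
  is_saw g -> all (fun e => e \notin sides r) p ->
  z1 = side r d1 -> z2 = side r d2 -> z3 = side r d3 -> uniq [:: d1; d2; d3; d4] ->
  side r d4 \notin m ->
  side r d4 \notin g /\ forall q, joined g (ends r q) = (q == link d1 d2).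
Proof.
move=> g hs hp e1 e2 e3 ud n4.
have ug : uniq g by case: hs.
have [n1 n2] : z1 \notin m /\ z2 \notin m.
  move: ug; rewrite /g cat_uniq => /and3P[_ /hasPn h u]; split.
    apply/negP => h1; have := h z1; rewrite !inE !mem_rcons !inE h1 eqxx !orbT => /(_ isT) //.
  by move: u => /= /andP[]; rewrite mem_rcons inE negb_or => /andP[].
have mem_g e : e \in g -> e \in sides r -> [\/ e = z1, e = z2, e = z3 | e \in m].
  move=> + sr; rewrite /g mem_cat !inE !mem_rcons !inE.
  by case/orP=> [/orP[/eqP|/(allP hp)]|/or3P[/eqP|/eqP|]] k;
    [constructor 1|rewrite sr in k|constructor 2|constructor 3|constructor 4].
have only : side r d4 \notin g.
  apply/negP => h.
  move: ud => /= /and4P[]; rewrite !inE !negb_or => /and3P[? ? k1] /andP[? k2] k3 _.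
  case: (mem_g _ h (side_in _ _)) => [|||hm]; last by rewrite hm in n4.
  - by rewrite e1 => /side_inj e; rewrite e eqxx in k1.
  - by rewrite e2 => /side_inj e; rewrite e eqxx in k2.
  - by rewrite e3 => /side_inj e; rewrite e eqxx in k3.
split=> // q.
have n12 : d1 != d2 by move: ud => /= /and4P[]; rewrite !inE !negb_or => /andP[].
have l12 := link_ends r n12; rewrite -e1 -e2 in l12.
have j12 : joined g (z1, z2).
  by rewrite /g joined_glue /joined /= !inE eqxx orbT.
apply/idP/eqP => [hj|->]; last by rewrite (joined_piece _ l12).
have j12' : joined g (ends r (link d1 d2)) by rewrite (joined_piece _ l12).
have := saw_compatible hs j12' hj => /orP[/eqP-> //|/eqP eq].
case: (eqVneq (link d1 d2) (opposite (link d1 d2))) => [->//|no].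
have /and3P[s1 s2 s3] := ends_shared r q.
have [h1 h2] : (ends r q).1 \in g /\ (ends r q).2 \in g.
  by apply: joined_in; case: (ends r q) hj.
have q12 : piece_ends r q (ends r q).1 (ends r q).2 by left; case: (ends r q).
have q21 : piece_ends r q (ends r q).2 (ends r q).1 by right; case: (ends r q).
have l21 : piece_ends r (link d1 d2) z2 z1 by case: l12; [right|left].
have third a b : piece_ends r q a b -> a \in g -> a \in sides r -> a = z3.
  move=> hab ha sa; have [d' ed] := side_inP sa.
  case: (mem_g _ ha sa) => // [e|e|am].
  - by case: (opposite_disjoint no l12); exists b; rewrite -eq -e.
  - by case: (opposite_disjoint no l21); exists b; rewrite -eq -e.
  - have := fourth_side d' ud.
    rewrite !inE => /or4P[] /eqP k; move: am; rewrite ed k -?e1 -?e2 -?e3 ?(negPf n1) ?(negPf n2) ?(negPf n4) //.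
by move: s3; rewrite (third _ _ q12 h1 s1) (third _ _ q21 h2 s2) eqxx.
Qed.

Lemma group_loop p z1 z2 m z3 d1 d2 d3 d4 :
  let g := rcons p z1 ++ z2 :: rcons m z3 in
  box_walk T L g -> all (fun e => e \notin sides r) p ->
  z1 = side r d1 -> z2 = side r d2 -> z3 = side r d3 -> uniq [:: d1; d2; d3; d4] ->
  side r d4 \notin m ->
  group g = off g * loop_part theta d1 d2 d3 d4 (winding (rcons p z1)) (winding (z2 :: rcons m z3)).
Proof.
move=> g hw hp e1 e2 e3 ud n4.
have hs : is_saw g by case: hw.
have eg : g = rcons (rcons p z1 ++ z2 :: m) z3 by rewrite /g rcons_cat.
have n12 : d1 != d2 by move: ud => /= /and4P[]; rewrite !inE !negb_or => /andP[].
have n34 : d3 != d4 by move: ud => /= /and4P[]; rewrite !inE.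
have l12 := link_ends r n12; have l34 := link_ends r n34.
rewrite -e1 -e2 in l12; rewrite -e3 in l34.
have [only tg] := loop_trace hs hp e1 e2 e3 ud n4.
have hw' := hw; rewrite eg in hw'.
rewrite eg (group_ends (ok := fun d' => d' == d4) hw' e3); first last.
- by move=> d' /eqP ->; rewrite -eg.
- move=> d' hn; have := fourth_side d' ud.
  rewrite !inE => /or4P[] // /eqP k; move: hn; rewrite -eg /g k -?e1 -?e2 -?e3 mem_cat !inE !mem_rcons !inE eqxx ?orbT //.
rewrite -eg (_ : \sum_(_ <- _ | _) _ = rwt (trace (rcons g (side r d4)) r) * off g *
   phase theta (winding g + turn z3 (side r d4)) * sgn R d4); last first.
  by case: (d4); rewrite !big_cons big_nil /= addr0.
have -> : trace (rcons g (side r d4)) r = selected (fun q => (q == link d1 d2) || (q == link d3 d4)).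
  by rewrite eg traceE; apply: eq_selected => q; rewrite joined_rcons -eg tg (joined2E _ _ l34) eqxx.
have eF : flow g = off g * (rwt [:: link d1 d2] * (sgn R d3 * phase theta (winding g))).
  rewrite /flow /flux eg last_rcons -eg e3 side_signE (wt_split _ _ _ _ _ r) -/(off g).
  rewrite traceE (eq_selected tg) selected1 -/rwt.
  by rewrite [rwt _ * _]mulrC -!mulrA [phase _ _ * _]mulrC.
have ew : winding g = winding (rcons p z1) + (compass_turn d1 d2 + winding (z2 :: rcons m z3)).
  by rewrite /g winding_glue e1 e2 turn_side addrA.
have perm4 (a b x y : R) : a * b * x * y = b * (a * (y * x)) by ring.
by rewrite eF perm4 -mulrDr /loop_part ew -addrA e3 turn_side.
Qed.
End LocalRelation.

(** * Reversing the loop of a walk *)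

Section Reroute.
Variables (T L : nat) (r : rhombus).
Hypothesis hr : rhombus_in_box T L r.

(** All that follows the first midpoint on [r] is reversed: a loop is run backwards, and a walk
    ending at its first contact is fixed. *)
Definition reroute (g : seq edge) : seq edge :=
  let i := (find (mem (sides r)) g).+1 in take i g ++ rev (drop i g).

Lemma reroute_glue p z1 s : all (fun e => e \notin sides r) p -> z1 \in sides r ->
  reroute (rcons p z1 ++ s) = rcons p z1 ++ rev s.
Proof.
move=> hp hz; rewrite /reroute (find_all (a := mem (sides r)) _ _ hz) //.
by rewrite -(size_rcons p z1) take_size_cat // drop_size_cat.
Qed.

(* The walk enters [r] through the side [d1], leaves through [d2] and comes back
   to the side [d3] from outside, so that [d4] is the only free side. *)
Definition detour (p : seq edge) (z1 z2 : edge) (m : seq edge) (z3 : edge)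
    (d1 d2 d3 d4 : compass) : Prop :=
  let g := rcons p z1 ++ z2 :: rcons m z3 in
  [/\ box_walk T L g /\ ~~ arriving r g, all (fun e => e \notin sides r) p,
      [/\ z1 = side r d1, z2 = side r d2 & z3 = side r d3], uniq [:: d1; d2; d3; d4]
    & side r d4 \notin m].

Lemma first_side g : g != [::] -> last origin g \in sides r -> exists p z s,
  [/\ g = rcons p z ++ s, all (fun e => e \notin sides r) p & z \in sides r].
Proof.
move=> hg hl; have hh : has (mem (sides r)) g.
  by apply/hasP; exists (last origin g) => //; case: (g) hg => // a q _; rewrite /= mem_last.
case: (split_find hh) => z p s hz hp; exists p, z, s; split=> //.
by apply/allP => e he; apply: contra hp => hes; apply/hasP; exists e.
Qed.

(** Only the piece in [r] changes, from the one joining [d1] and [d2] to the one joining [d1] and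
    [d3]; the other rhombi keep their traces. *)
Lemma detour_rev p z1 z2 m z3 d1 d2 d3 d4 : detour p z1 z2 m z3 d1 d2 d3 d4 ->
  detour p z1 z3 (rev m) z2 d1 d3 d2 d4.
Proof.
case=> -[hw ha] hp [e1 e2 e3] ud n4.
set g := rcons p z1 ++ z2 :: rcons m z3 in hw ha.
have hs : is_saw g by case: hw.
have [no tg] := loop_trace hs hp e1 e2 e3 ud n4.
have rs : z3 :: rcons (rev m) z2 = rev (z2 :: rcons m z3) by rewrite rev_cons rev_rcons.
have pg : perm_eq (rcons p z1 ++ z3 :: rcons (rev m) z2) g.
  by rewrite rs perm_cat2l perm_rev.
have ug : uniq g by case: hs.
have ud' : uniq [:: d1; d3; d2; d4].
  by rewrite -(perm_uniq (s1 := [:: d1; d2; d3; d4])) // perm_cons (perm_catCA [:: d2] [:: d3]).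
have n12 : d1 != d2 by move: ud => /= /and4P[]; rewrite !inE !negb_or => /andP[].
have n13 : d1 != d3 by move: ud' => /= /and4P[]; rewrite !inE !negb_or => /andP[].
have l12 := link_ends r n12; have l13 := link_ends r n13.
rewrite -e1 -e2 in l12; rewrite -e1 -e3 in l13.
pose K ab := joined (rcons p z1) ab || joined (z2 :: rcons m z3) ab.
have jg ab : joined g ab = K ab || joined [:: z1; z2] ab.
  by rewrite /g joined_glue /K orbCA -orbA orbC -!orbA; case: joined; case: joined; case: joined.
have jg' ab : joined (rcons p z1 ++ z3 :: rcons (rev m) z2) ab = K ab || joined [:: z1; z3] ab.
  rewrite joined_glue rs joined_rev /K.
  by case: (joined (rcons p z1) ab); case: (joined [:: z1; z3] ab); case: joined.
have uc := ug; rewrite /g cat_uniq in uc; case/and3P: uc => _ /hasPn un us.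
have K12 : K (z1, z2) = false.
  apply/negP => /orP[] /joined_in[h1 h2].
    by have := un z2; rewrite mem_head h2 => /(_ isT).
  by have := un z1 h1; rewrite mem_rcons mem_head.
have K21 : K (z2, z1) = false.
  by rewrite -K12 /K (joined_sym (rcons p z1)) (joined_sym (z2 :: _)).
have Kr q : K (ends r q) = false.
  apply/negP => hK; have : joined g (ends r q) by rewrite jg hK.
  rewrite tg => /eqP eq; move: hK; rewrite eq.
  by case: l12 => ->; rewrite ?K12 ?K21.
have tr' r' : trace (rcons p z1 ++ z3 :: rcons (rev m) z2) r' =
    if r' == r then [:: link d1 d3] else trace g r'.
  case: eqVneq => [->|nr].
    rewrite traceE -selected1; apply: eq_selected => q.
    by rewrite jg' Kr (joined2E _ _ l13) eqxx.
  rewrite !traceE; apply: eq_selected => q.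
  by rewrite jg' jg (joined2E _ _ l13) (joined2E _ _ l12) (negPf nr).
have hs' : is_saw (rcons p z1 ++ z3 :: rcons (rev m) z2).
  split.
  - by case: (rcons p z1).
  - by rewrite (perm_uniq pg).
  - move=> a b hab; have : joined (rcons p z1 ++ z3 :: rcons (rev m) z2) (a, b).
      by rewrite /joined hab.
    rewrite jg' => /orP[hK|].
      have : joined g (a, b) by rewrite jg hK.
      by move=> /(joined_face hs)/sharedP[q hq]; exists (face (a, b)), q.
    rewrite /joined /= !inE => /orP[] /eqP [-> ->]; exists r, (link d1 d3);
      by move: l13; rewrite /piece_ends; tauto.
  - by move=> r'; rewrite tr'; case: hs => _ _ _ h; case: ifP => _; [case: (link d1 d3)|apply: h].
split=> //; last by rewrite mem_rev.
split.
  have [_ ho hb] := hw; split=> //; first by move: ho; rewrite /g; case: (p).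
  by rewrite (perm_all _ pg).
rewrite (_ : rcons p z1 ++ _ = rcons (rcons (rcons p z1 ++ belast z3 (rev m)) (last z3 (rev m))) z2); last first.
  by rewrite !rcons_cat -lastI.
rewrite arriving_rcons; apply/negP => /sharedP[q hq].
set y := last z3 (rev m) in hq.
have yl : y \in rcons m z3.
  by rewrite -mem_rev rev_rcons /y mem_last.
have jy : joined g (y, z2).
  rewrite jg /K -(joined_rev (z2 :: _)) -rs.
  rewrite (_ : z3 :: rcons (rev m) z2 = rcons (rcons (belast z3 (rev m)) y) z2); last by rewrite -lastI.
  by rewrite joined_rcons /joined /= !inE eqxx !orbT.
have : joined g (ends r q) by rewrite (joined_piece _ hq).
rewrite tg => /eqP eq; subst q.
have ey : y = z1.
  by case: l12 => e12; case: hq; rewrite e12 => -[] *; congruence.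
have := un y; rewrite inE yl orbT ey mem_rcons mem_head => /(_ isT) //.
Qed.

Lemma detour_exists g : box_walk T L g -> last origin g \in sides r -> ~~ arriving r g ->
  (exists p z, [/\ g = rcons p z, all (fun e => e \notin sides r) p & z \in sides r]) \/
  (exists p z1 z2 m z3 d1 d2 d3 d4, g = rcons p z1 ++ z2 :: rcons m z3 /\
    detour p z1 z2 m z3 d1 d2 d3 d4).
Proof.
move=> hw hl ha; have hs : is_saw g by case: hw.
have hg : g != [::] by case: hs.
have [p [z1 [s [eg hp hz]]]] := first_side hg hl.
case/lastP: s eg => [|s z3] eg; first by left; exists p, z1; rewrite eg cats0.
case: s eg => [|z2 m] eg.
  move: ha; rewrite eg cats1 arriving_rcons.
  have -> // : shared r (z1, z3).
  by apply: (first_visit hr (p := p) (q := [::])) => //; rewrite -cat_rcons; move: hw; rewrite eg.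
right.
have s12 : shared r (z1, z2).
  apply: (first_visit hr (p := p) (q := rcons m z3)) => //.
  by move: eg hw; rewrite cat_rcons rcons_cons => ->.
have eg2 : g = rcons (rcons p z1 ++ z2 :: m) z3 by rewrite eg rcons_cat.
have hz3 : z3 \in sides r by move: hl; rewrite eg2 last_rcons.
have ug : uniq g by case: hs.
have [d1 e1] := side_inP hz; have [d3 e3] := side_inP hz3.
have hz2 : z2 \in sides r by case/and3P: s12.
have [d2 e2] := side_inP hz2.
have uc := ug; rewrite eg rcons_cons cat_uniq in uc; case/and3P: uc => _ /hasPn un us.
have nz x : x \in z2 :: rcons m z3 -> x != z1.
  by move=> hx; apply: contraTneq (un x hx) => ->; rewrite mem_rcons mem_head.
have us' : z2 != z3.
  by move: us => /= /andP[]; rewrite mem_rcons inE negb_or => /andP[].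
have ud : uniq [:: d1; d2; d3].
  rewrite /= !inE !negb_or andbT; apply/andP; split; first (apply/andP; split).
  - by apply: contraNneq (nz z2 (mem_head _ _)) => e; rewrite e1 e2 e.
  - by apply: contraTneq (nz z3 _) => [e|]; rewrite ?e1 ?e3 ?e ?eqxx // inE mem_rcons mem_head orbT.
  - by apply: contraNneq us' => e; rewrite e2 e3 e.
have [d4 ud4] := compass_fourth ud.
exists p, z1, z2, m, z3, d1, d2, d3, d4; split; first by rewrite eg.
have eg' : g = rcons p z1 ++ z2 :: rcons m z3 by rewrite eg.
split=> //; first by split; rewrite -?eg'.
(* If the fourth side were visited on the way, a piece in [r] would join it to another side. At [z1]
   or [z2] this meets the entering piece; at [z3] it is the last step, which was assumed to lie
   outside [r]. *)
apply/negP => hm.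
have hin : side r d4 \in g by rewrite eg' mem_cat in_cons !mem_rcons !in_cons hm !orbT.
have nl : side r d4 != last origin g.
  rewrite eg2 last_rcons; apply/eqP => e.
  by move: us; rewrite -rcons_cons rcons_uniq -e inE hm orbT.
have [z' jz sz] := visit hr hw hin nl (side_in r d4).
have j12 : joined g (z1, z2) by rewrite eg' joined_glue /joined /= !inE eqxx orbT.
have : z' \in sides r by case/and3P: sz.
case/side_inP => d' ed'.
have ud4' := ud4; move: ud4 => /= /and4P[]; rewrite !inE !negb_or => /and3P[_ _ n14] /andP[_ n24] n34 _.
have t1 x y : z' = x -> joined g (x, y) -> shared r (x, y) -> side r d4 = y.
  by move=> ex jxy sxy; apply: (saw_turn hs _ jxy _ sxy); rewrite -ex.
have := fourth_side d' ud4'; rewrite !inE => /or4P[] /eqP ed; rewrite {d'}ed in ed'.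
- have := t1 z1 z2; rewrite ed' e1 -e1 => /(_ erefl j12 s12).
  by rewrite e2 => /side_inj e; rewrite e eqxx in n24.
- have := t1 z2 z1; rewrite joined_sym shared_sym ed' e2 -e2 => /(_ erefl j12 s12).
  by rewrite e1 => /side_inj e; rewrite e eqxx in n14.
- have [k ek] : exists k, g = rcons (rcons k (last z2 m)) z3.
    by exists (rcons p z1 ++ belast z2 m); rewrite eg2; congr rcons; rewrite rcons_cat -lastI.
  have el : side r d4 = last z2 m.
    by apply: (step_to_last (p := k) (z := z3)); rewrite -ek //; move: jz; rewrite ed' -e3.
  by move: ha; rewrite ek arriving_rcons -el; move: sz; rewrite ed' -e3 => ->.
- by move: sz; rewrite ed' /shared /= eqxx !andbF.
Qed.
End Reroute.

Section LocalRelation.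
Variables (R : realType) (theta : R).
Hypothesis htheta : pi / 3 <= theta <= 2 * pi / 3.
Variables (T L : nat) (r : rhombus).
Hypothesis hr : rhombus_in_box T L r.
Variable ws : seq (seq edge).
Hypotheses (uws : uniq ws) (hws : forall g, g \in ws <-> box_walk T L g).

Lemma detour_off p z1 z2 m z3 d1 d2 d3 d4 u1 u2 v w1 w2 :
  detour T L r p z1 z2 m z3 d1 d2 d3 d4 ->
  wt_off (R := R) u1 u2 v w1 w2 r (rcons p z1 ++ z2 :: rcons m z3) =
  wt_off u1 u2 v w1 w2 r (rcons p z1 ++ z3 :: rcons (rev m) z2).
Proof.
case=> _ _ [e1 e2 e3] ud _; apply: eq_wt_off => r' nr; rewrite !traceE.
have n12 : d1 != d2 by move: ud => /= /and4P[]; rewrite !inE !negb_or => /andP[].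
have n13 : d1 != d3 by move: ud => /= /and4P[]; rewrite !inE !negb_or => /and3P[].
have l12 := link_ends r n12; have l13 := link_ends r n13.
rewrite -e1 -e2 in l12; rewrite -e1 -e3 in l13.
have rs : z3 :: rcons (rev m) z2 = rev (z2 :: rcons m z3) by rewrite rev_cons rev_rcons.
apply: eq_selected => q.
by rewrite !joined_glue (joined2E _ _ l12) (joined2E _ _ l13) (negPf nr) /= rs joined_rev.
Qed.

(** The two walks agree outside [r], and their loops wind oppositely by the amount that
    [loop_winding] computes from the sides alone, so [local_loop] applies. *)
Lemma detour_cancel p z1 z2 m z3 d1 d2 d3 d4 :
  detour T L r p z1 z2 m z3 d1 d2 d3 d4 ->
  group theta r ws (rcons p z1 ++ z2 :: rcons m z3) +
  group theta r ws (rcons p z1 ++ z3 :: rcons (rev m) z2) = 0.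
Proof.
move=> hd; have hd' := detour_rev hd.
have [[hw ha] hp [e1 e2 e3] ud n4] := hd; have [[hw' ha'] _ _ ud' n4'] := hd'.
rewrite (group_loop theta hr hws hw hp e1 e2 e3 ud n4).
rewrite (group_loop theta hr hws hw' hp e1 e3 e2 ud' n4') (detour_off _ _ _ _ _ hd) -mulrDr.
have rs : z3 :: rcons (rev m) z2 = rev (z2 :: rcons m z3) by rewrite rev_cons rev_rcons.
have hs : is_saw (rcons p z1 ++ z2 :: rcons m z3) by case: hw.
have hs' : is_saw (rcons p z1 ++ rev (z2 :: rcons m z3)) by rewrite -rs; case: hw'.
have hl : is_saw (z2 :: rcons m z3) by apply: saw_suffix hs.
rewrite rs (winding_rev hl).
have n12 : d1 != d2 by move: ud => /= /and4P[]; rewrite !inE !negb_or => /andP[].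
have n13 : d1 != d3 by move: ud => /= /and4P[]; rewrite !inE !negb_or => /and3P[].
have n23 : d2 != d3 by move: ud => /= /and4P[_]; rewrite !inE !negb_or => /andP[].
have sh d d' : d != d' -> shared r (side r d, side r d').
  by move=> nd; apply/sharedP; exists (link d d'); apply: link_ends.
have [_ ho hb] := hw.
have [P eP] : exists P, rcons p z1 = origin :: P.
  by move: ho; case: (rcons p z1) (size_rcons p z1) => // a P _ [->]; exists P.
have hh : head z1 p = origin by case: (p) eP => [|a q] /= [].
have hup e : e \in rcons p z1 ++ z2 :: rcons m z3 -> py origin <= py e.
  by move=> he; have /and4P[_ _ h _] := allP hb _ he.
have hfar s : s \in steps (rcons p z1) -> face s != r.
  case: s => a b hab; apply/eqP => ef.
  have hp1 : is_saw (rcons p z1) by apply: saw_prefix hs; case: (p).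
  have /and3P[sa _ _] := saw_face hp1 hab; rewrite ef /= in sa.
  have [k [l ekl]] := steps_split hab.
  have ap : a \in p.
    have : rcons p z1 = rcons (k ++ a :: belast b l) (last b l).
      by rewrite rcons_cat /= -lastI.
    by move=> /rcons_inj[-> _]; rewrite mem_cat mem_head orbT.
  by have := allP hp _ ap; rewrite sa.
have s12 : shared r (z1, z2) by rewrite e1 e2 sh.
have s13 : shared r (z1, z3) by rewrite e1 e3 sh.
have s23 : shared r (z2, z3) by rewrite e2 e3 sh.
have lw := loop_winding hh isT hs hs' hup s12 s13 s23 hfar.
have -> : winding (z2 :: rcons m z3) = compass_loop d1 d2 d3.
  have lw2 : winding (z2 :: rcons m z3) *+ 2 =
      (compass_turn d1 d3 - compass_turn d1 d2) *+ 2 + compass_secant d1 d2 d1 d3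
      + compass_secant d1 d3 d2 d3 - compass_secant d1 d2 d3 d2.
    by rewrite lw e1 e2 e3 !turn_side !secant_side.
  by rewrite /compass_loop -lw2; move: (winding _) => w; clear; lia.
rewrite local_loop ?mulr0 //.
have hp1 : is_saw (rcons p z1) by apply: saw_prefix hs; case: (p).
rewrite eP in hp1 *; rewrite winding_parity // -(side_vertical r) -e1.
have <- : last origin P = z1 by rewrite -(last_rcons origin p z1) eP.
by case: (last origin P).1.
Qed.

(** Not the [arriving] walks: these reach [r] from outside, or start on it, and have not yet used
    their last side for a step in [r]. *)
Let arrivals := [seq g <- ws | (last origin g \in sides r) && ~~ arriving r g].

Lemma arrivalsP g : g \in arrivals ->
  [/\ reroute r (reroute r g) = g, reroute r g \in arrivals &
      group theta r ws g + group theta r ws (reroute r g) = 0].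
Proof.
move=> hga; move: (hga); rewrite mem_filter => /andP[/andP[hl ha] /hws hw].
case: (detour_exists hr hw hl ha) => [[p [z [eg hp hz]]]|].
  have e : reroute r g = g by rewrite eg -[rcons p z]cats0 reroute_glue.
  rewrite !e; split=> //; have [d ez] := side_inP hz.
  by rewrite eg (group_open htheta hr hws (d := d)) ?addr0 // -eg.
move=> [p [z1 [z2 [m [z3 [d1 [d2 [d3 [d4 [eg hd]]]]]]]]]].
have hd' := detour_rev hd.
have [[_ _] hp [e1 e2 _] _ _] := hd; have [[hw' ha'] _ _ _ _] := hd'.
have hz : z1 \in sides r by rewrite e1 side_in.
have rs : z3 :: rcons (rev m) z2 = rev (z2 :: rcons m z3) by rewrite rev_cons rev_rcons.
have e : reroute r g = rcons p z1 ++ z3 :: rcons (rev m) z2 by rewrite eg reroute_glue // rs.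
split.
- by rewrite e rs reroute_glue // revK eg.
- rewrite mem_filter; apply/andP; split; last by apply/hws; rewrite e.
  by rewrite e ha' andbT last_cat /= last_rcons e2 side_in.
- by rewrite e eg (detour_cancel hd).
Qed.

Lemma local_relation : \sum_(g <- ws) flux theta r g = 0.
Proof.
have side0 e : e \notin sides r -> side_sign R r e = 0.
  rewrite !inE !negb_or => /and4P[/negPf h1 /negPf h2 /negPf h3 /negPf h4].
  by rewrite /side_sign h1 h2 h3 h4; ring.
rewrite (bigID (fun g => last origin g \in sides r)) /= addrC big1 ?add0r; last first.
  by move=> g /side0 h; rewrite /flux h mulr0.
rewrite (bigID (arriving r)) /= addrC.
have -> : \sum_(g <- ws | (last origin g \in sides r) && arriving r g) flux theta r g =
   \sum_(g <- arrivals) \sum_(z <- sides r | rcons g z \in ws) flux theta r (rcons g z).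
  (* Dropping the last step of an arriving walk gives an element of [arrivals], since [saw_turn]
     forbids two consecutive steps inside [r]. *)
  transitivity (\sum_(g <- [seq rcons g z | g <- arrivals, z <- sides r] | g \in ws) flux theta r g).
    rewrite -big_filter -[RHS]big_filter; apply: perm_big; apply: uniq_perm.
    - by rewrite filter_uniq.
    - rewrite filter_uniq // allpairs_uniq ?filter_uniq //; first exact: side_neq.
      by move=> [g1 z1] [g2 z2] _ _ /= /rcons_inj.
    move=> g; rewrite !mem_filter; apply/idP/idP.
      move=> /andP[/andP[hl ha] hg]; rewrite hg andTb.
      move: ha hg hl; case/lastP: g => [|g z] //; case/lastP: g => [|g y] //.
      rewrite arriving_rcons last_rcons => ha hg hl.
      apply/allpairsP; exists (rcons g y, z); split=> //=.
      have hw : box_walk T L (rcons (rcons g y) z) by apply/hws.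
      have [hs ho hb] := hw.
      rewrite mem_filter last_rcons -andbA; apply/and3P; split.
      - by case/and3P: ha.
      - move: hs hb {ho hg hw}; case/lastP: g => [|g x] // hs hb.
        rewrite arriving_rcons; apply/negP => h.
        have j1 : joined (rcons (rcons (rcons g x) y) z) (x, y).
          by rewrite joined_rcons (joined_rcons g) (_ : joined [:: x; y] (x, y)) ?orbT // /joined mem_head.
        have j2 : joined (rcons (rcons (rcons g x) y) z) (y, z).
          by rewrite joined_rcons (_ : joined [:: y; z] (y, z)) ?orbT // /joined mem_head.
        have exz := saw_turn hs j1 j2 h ha.
        have : uniq (rcons (rcons (rcons g x) y) z) by case: hs.
        by rewrite rcons_uniq !(mem_rcons, inE) exz eqxx orbT.
      - apply/hws; split.
        + by apply: (saw_prefix (q := [:: z])); rewrite ?cats1 //; case: (g).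
        + by move: ho; case: (rcons g y) (size_rcons g y).
        + by move: hb; rewrite all_rcons => /andP[].
    move=> /andP[hg /allpairsP[[g' z] [/= hg' hz eg]]]; rewrite eg in hg *.
    rewrite last_rcons hz hg /= andbT.
    move: hg'; rewrite mem_filter -andbA => /and3P[hl _ /hws[hs' _ _]].
    move: hs' hg hl {eg}; case/lastP: g' => [[]//|g' y] hs' /hws[hs _ _]; rewrite last_rcons => hl.
    rewrite arriving_rcons /shared /= hl hz /=.
    have : uniq (rcons (rcons g' y) z) by case: hs.
    by rewrite rcons_uniq mem_rcons inE negb_or eq_sym => /andP[/andP[]].
  rewrite big_mkcond big_allpairs_dep; apply: eq_bigr => g _.
  by rewrite [RHS]big_mkcond.
rewrite -big_filter -/arrivals -big_split /=.
set S := \sum_(_ <- _) _.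
(* Summing along the involution shows that twice the sum consists of vanishing pairs; its fixed
   points need no separate treatment. *)
have e : S = \sum_(g <- arrivals) group theta r ws (reroute r g).
  rewrite -(big_map (reroute r) predT (group theta r ws)); apply: perm_big.
  have inj : {in arrivals &, injective (reroute r)}.
    by move=> g g' /arrivalsP[e _ _] /arrivalsP[e' _ _] h; rewrite -e h e'.
  apply: uniq_perm; first by rewrite filter_uniq.
    by rewrite map_inj_in_uniq // filter_uniq.
  move=> g; apply/idP/mapP => [hg|[g' /arrivalsP[_ h _] -> //]].
  by have [e h _] := arrivalsP hg; exists (reroute r g).
have : S + S = 0.
  rewrite {2}e /S -big_split big1_seq //= => g /arrivalsP[_ _].
  by [].
by move=> h; lra.
Qed.
End LocalRelation.

(** * The boundary identity in a box *)

Fixpoint words (A : Type) (es : seq A) (n : nat) : seq (seq A) :=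
  if n is n'.+1 then [::] :: [seq x :: l | x <- es, l <- words es n'] else [:: [::]].

Lemma mem_words (A : eqType) (es : seq A) n l :
  (size l <= n)%N -> all (mem es) l -> l \in words es n.
Proof.
elim: n l => [|n IH] [|x l] //= hs /andP[hx hl]; rewrite inE /=.
by apply: (allpairs_f (fun x l => x :: l)) => //; apply: IH.
Qed.

Definition int_range (N : nat) : seq int := [seq n%:Z - N%:Z | n <- iota 0 N.*2.+1].

Lemma mem_int_range N (i : int) : (i \in int_range N) = (`|i| <= N%:Z).
Proof.
apply/mapP/idP => [[n]|h]; first by rewrite mem_iota => ? ->; lia.
by exists (absz (i + N%:Z)); [rewrite mem_iota|]; lia.
Qed.

Lemma int_range_uniq N : uniq (int_range N).
Proof. by rewrite map_inj_uniq ?iota_uniq // => a b; lia. Qed.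

Definition near_edges (N : nat) : seq edge :=
  [seq (true, (i, j)) | i <- int_range N, j <- int_range N]
  ++ [seq (false, (i, j)) | i <- int_range N, j <- int_range N].

Lemma mem_near_edges N e : `|px e| <= N%:Z -> `|py e| <= N%:Z -> e \in near_edges N.
Proof.
case: e => [b [i j]] hx hy; rewrite mem_cat.
have hi : i \in int_range N by rewrite mem_int_range; move: hx; rewrite /px /=; case: b {hy}; lia.
have hj : j \in int_range N by rewrite mem_int_range; move: hy; rewrite /py /=; case: b {hx}; lia.
case: b {hx hy}; apply/orP; [left|right].
  exact: (allpairs_f (fun i j => (true, (i, j)))).
exact: (allpairs_f (fun i j => (false, (i, j)))).
Qed.

Lemma enumerate (P : seq edge -> Prop) (N n : nat) :
  (forall g, P g -> (size g <= n)%N /\ forall e, e \in g -> `|px e| <= N%:Z /\ `|py e| <= N%:Z) ->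
  exists ws, uniq ws /\ forall g, g \in ws <-> P g.
Proof.
move=> h; exists (undup [seq g <- words (near_edges N) n | `[< P g >]]).
split=> [|g]; first exact: undup_uniq.
rewrite mem_undup mem_filter; split=> [/andP[/asboolP]//|hg].
apply/andP; split; first exact/asboolP.
have [hs he] := h g hg; apply: mem_words => //; apply/allP => e /he[].
exact: mem_near_edges.
Qed.

Lemma box_walks T L : exists ws, uniq ws /\ forall g, g \in ws <-> box_walk T L g.
Proof.
pose N := (L.*2 + 2 + T.*2)%N.
have hb e : in_box T L e -> `|px e| <= N%:Z /\ `|py e| <= N%:Z.
  by move=> /and4P[h1 h2 h3 h4]; rewrite /N; split; lia.
apply: (@enumerate _ N (size (near_edges N))) => g [hs _ /allP ha].
split; last by move=> e /ha /hb.
apply: uniq_leq_size; first by case: hs.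
by move=> e /ha /hb[? ?]; exact: mem_near_edges.
Qed.

Definition box_rhombi (T L : nat) : seq rhombus :=
  [seq r <- [seq (i, j) | i <- int_range (L + T), j <- int_range (L + T)] | rhombus_in_box T L r].

Lemma mem_box_rhombi T L r : (r \in box_rhombi T L) = rhombus_in_box T L r.
Proof.
rewrite mem_filter; case: (boolP (rhombus_in_box T L r)) => // /and4P[h1 h2 h3 h4]; rewrite andTb.
case: r h1 h2 h3 h4 => i j h1 h2 h3 h4; rewrite /= in h1 h2 h3 h4.
by apply/allpairsP; exists (i, j); split=> //; rewrite mem_int_range /=; lia.
Qed.

Lemma box_rhombi_uniq T L : uniq (box_rhombi T L).
Proof.
rewrite filter_uniq // allpairs_uniq ?int_range_uniq //.
by move=> [? ?] [? ?] _ _ /= [-> ->].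
Qed.

Lemma sum_indicator (R : realType) (A : eqType) (s : seq A) (a : A) : uniq s ->
  \sum_(x <- s) (x == a)%:R = (a \in s)%:R :> R.
Proof.
move=> us; case: (boolP (a \in s)) => ha.
  rewrite (bigD1_seq a) //= eqxx big1 ?addr0 // => x /negPf ->; by [].
rewrite big_seq big1 // => x hx.
by case: eqP => // e; rewrite -e hx in ha.
Qed.

Definition ends_bottom (g : seq edge) : bool :=
  [&& (1 < size g)%N, ~~ (last origin g).1 & py (last origin g) == 0].
Definition ends_top (T : nat) (g : seq edge) : bool :=
  ~~ (last origin g).1 && (py (last origin g) == T%:Z *+ 2).
Definition ends_left (L : nat) (g : seq edge) : bool :=
  (last origin g).1 && (px (last origin g) == - (L%:Z *+ 2)).
Definition ends_right (L : nat) (g : seq edge) : bool :=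
  (last origin g).1 && (px (last origin g) == L%:Z *+ 2 + 2).

Section BoxIdentity.
Variables (R : realType) (theta : R).
Hypothesis htheta : pi / 3 <= theta <= 2 * pi / 3.

Let weight := wt (weight_u1 theta) (weight_u2 theta) (weight_v theta) (weight_w1 theta) (weight_w2 theta).

(** An edge counts with opposite signs for its two rhombi, so that only the four walls survive. *)
Lemma side_sign_sum T L e : (0 < T)%N -> in_box T L e ->
  \sum_(r <- box_rhombi T L) side_sign R r e =
  (~~ e.1 && (py e == 0))%:R - (~~ e.1 && (py e == T%:Z *+ 2))%:R
  + (e.1 && (px e == L%:Z *+ 2 + 2))%:R - (e.1 && (px e == - (L%:Z *+ 2)))%:R.
Proof.
move=> T0; case: e => [b [i j]].
pose I a : R := (a \in box_rhombi T L)%:R.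
have ind a : \sum_(r <- box_rhombi T L) (r == a)%:R = I a.
  by rewrite sum_indicator // box_rhombi_uniq.
have -> : \sum_(r <- box_rhombi T L) side_sign R r (b, (i, j)) =
   (if b then I (i - 1, j) - I (i, j) else I (i, j) - I (i, j - 1)).
  rewrite -!ind; case: b; rewrite -sumrB; apply: eq_bigr => -[k l] _; rewrite /side_sign /south /north /east /west /hedge /vedge /= !xpair_eqE /=.
    rewrite (_ : (i == k + 1) = (k == i - 1)); last by apply/eqP/eqP; lia.
    by rewrite (eq_sym i) (eq_sym j) subr0 add0r.
  rewrite (_ : (j == l + 1) = (l == j - 1)); last by apply/eqP/eqP; lia.
  by rewrite (eq_sym i) (eq_sym j) subr0 addr0.
rewrite /I !mem_box_rhombi /rhombus_in_box /in_box /px /py /=.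
have neg (x y : bool) : (~~ x)%:R - (~~ y)%:R = y%:R - x%:R :> R.
  by case: x; case: y; rewrite /= ?subrr ?subr0 ?sub0r.
case: b => /= /and4P[h1 h2 h3 h4].
  rewrite !subr0 add0r -neg.
  by congr (_ %:R - _ %:R); f_equal; lia.
rewrite subr0 addr0 -neg.
by congr (_ %:R - _ %:R); f_equal; lia.
Qed.

Lemma box_flux T L ws : (0 < T)%N -> uniq ws -> (forall g, g \in ws <-> box_walk T L g) ->
  \sum_(g <- ws) weight g * phase theta (winding g) *
   ((~~ (last origin g).1 && (py (last origin g) == 0))%:R - (ends_top T g)%:R
    + (ends_right L g)%:R - (ends_left L g)%:R) = 0.
Proof.
move=> T0 uws hws.
transitivity (\sum_(r <- box_rhombi T L) \sum_(g <- ws) flux theta r g).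
  rewrite exchange_big /= big_seq [RHS]big_seq; apply: eq_bigr => g /hws[hs ho hb].
  rewrite /flux -mulr_sumr side_sign_sum //; apply: (allP hb).
  by case: g hs ho {hb} => // a g _ _; rewrite /= mem_last.
rewrite big_seq big1 // => r; rewrite mem_box_rhombi => hr.
exact: (local_relation htheta hr uws hws).
Qed.

Lemma phase_values : [/\ phase theta 0 = 1, phase theta 2 = cos (5 * pi / 8),
  phase theta (-2) = cos (5 * pi / 8), phase theta 1 = cos (3 * theta / 8)
  & phase theta (-1) = cos (3 * theta / 8 + 5 * pi / 8)].
Proof.
rewrite /phase /=; split.
- by rewrite mulr0 cos0.
- by congr cos; field.
- by rewrite -cosN; congr cos; field.
- by congr cos; field.
- by congr cos; field.
Qed.

Ltac flux_ring := rewrite /=; move: (weight _) => ?; ring.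

Lemma box_term T L g : (0 < T)%N -> box_walk T L g ->
  weight g * phase theta (winding g) *
   ((~~ (last origin g).1 && (py (last origin g) == 0))%:R - (ends_top T g)%:R
    + (ends_right L g)%:R - (ends_left L g)%:R) =
  (g == [:: origin])%:R + cos (5 * pi / 8) * (weight g * (ends_bottom g)%:R)
  - weight g * (ends_top T g)%:R
  + cos (3 * theta / 8 + 5 * pi / 8) * (weight g * (ends_right L g)%:R)
  - cos (3 * theta / 8) * (weight g * (ends_left L g)%:R).
Proof.
move=> T0 [hs ho hb]; have [f0 f2 f2' f1 f1'] := phase_values.
case: g hs ho hb => // a g hs [ea] hb; subst a.
case/lastP: g hs hb => [|p z] hs hb.
  (* The walk reduced to [origin] lies on the bottom wall but is left out of [ends_bottom]: it
     provides the constant term. *)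
  have k1 : (py origin == 0) = true by [].
  have k2 : (py origin == T%:Z *+ 2) = false by rewrite /py /=; lia.
  have k3 : origin.1 = false by [].
  have k4 : last origin [:: origin] = origin by [].
  rewrite /ends_bottom /ends_top /ends_right /ends_left k4 k1 k2 k3 eqxx ltnn ?andFb ?andTb ?andbF.
  by rewrite /weight wt1 /winding wsum1 f0 /=; ring.
have n1 : (origin :: rcons p z == [:: origin]) = false by case: (p).
have hz : last origin (origin :: rcons p z) = z by rewrite /= last_rcons.
have sz : (1 < size (origin :: rcons p z))%N by rewrite /= size_rcons.
rewrite /ends_bottom /ends_top /ends_right /ends_left hz n1 sz.
have bound e : e \in origin :: rcons p z -> in_box T L e := allP hb e.
have hup e : e \in rcons p z -> py origin <= py e.
  by move=> he; have /and4P[_ _ h _] := bound e (mem_behead (s := _ :: _) he).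
have bound' e : e \in origin :: p -> in_box T L e.
  by move=> he; apply: bound; move: he; rewrite !inE mem_rcons inE => /orP[->//|->]; rewrite !orbT.
have /and4P[bz1 bz2 bz3 bz4] : in_box T L z.
  by apply: bound; rewrite inE mem_rcons mem_head orbT.
have ho : ~~ origin.1 by [].
case ez : z.1 => /=.
  case: (eqVneq (px z) (L%:Z *+ 2 + 2)) => hr.
    have -> : (px z == - (L%:Z *+ 2)) = false by lia.
    rewrite (winding_right hs ho hup) ?ez // ?f1'; first by flux_ring.
    by move=> e /bound' /and4P[_ h _ _]; rewrite hr.
  case: (eqVneq (px z) (- (L%:Z *+ 2))) => hl.
    rewrite (winding_left hs ho hup) ?ez // ?f1; first by flux_ring.
    by move=> e /bound' /and4P[h _ _ _]; rewrite hl.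
  by flux_ring.
case: (eqVneq (py z) 0) => h0.
  have -> : (py z == T%:Z *+ 2) = false by lia.
  by case: (winding_same_side hs ho hup) => [||->|->]; rewrite ?ez // ?f2 ?f2'; flux_ring.
case: (eqVneq (py z) (T%:Z *+ 2)) => hT.
  rewrite (winding_top hs ho hup) ?ez // ?f0; first by flux_ring.
  by move=> e /bound' /and4P[_ _ _ h]; rewrite hT.
by flux_ring.
Qed.

(** Signs are arranged so that, in the range of theta, all four coefficients are nonnegative. *)
Lemma box_identity T L ws : (0 < T)%N -> uniq ws -> (forall g, g \in ws <-> box_walk T L g) ->
  1 = - cos (5 * pi / 8) * (\sum_(g <- ws | ends_bottom g) weight g)
  + \sum_(g <- ws | ends_top T g) weight g
  + (- cos (3 * theta / 8 + 5 * pi / 8)) * (\sum_(g <- ws | ends_right L g) weight g)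
  + cos (3 * theta / 8) * (\sum_(g <- ws | ends_left L g) weight g).
Proof.
move=> T0 uws hws; have := box_flux T0 uws hws.
have E (P : seq edge -> bool) : \sum_(g <- ws | P g) weight g = \sum_(g <- ws) weight g * (P g)%:R.
  by rewrite big_mkcond; apply: eq_bigr => g _; case: (P g); rewrite ?mulr1 ?mulr0.
rewrite !E big_seq.
rewrite (eq_bigr _ (fun g hg => box_term T0 ((hws g).1 hg))) -big_seq.
rewrite !(sumrB, big_split) /= -!mulr_sumr sum_indicator //.
have -> : [:: origin] \in ws.
  apply/hws; split=> //.
  by rewrite /= andbT; apply/and4P; split; rewrite /px /py /=; lia.
set A := \sum_(g <- ws) weight g * (ends_bottom g)%:R.
set B := \sum_(g <- ws) weight g * (ends_top T g)%:R.
set E1 := \sum_(g <- ws) weight g * (ends_right L g)%:R.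
set E2 := \sum_(g <- ws) weight g * (ends_left L g)%:R.
by rewrite /=; clearbody A B E1 E2; lra.
Qed.
End BoxIdentity.

(** * Bounded families *)

Section BoundedSums.
Variable R : realType.

(** Summability of a nonnegative family, by its finite partial sums. *)
Definition bounded_sum (X : eqType) (f : X -> R) (P : X -> Prop) (M : R) : Prop :=
  forall s, uniq s -> (forall x, x \in s -> P x) -> \sum_(x <- s) f x <= M.

Lemma bounded_sum_ge0 (X : eqType) (f : X -> R) P M : bounded_sum f P M -> 0 <= M.
Proof. by move=> /(_ [::] isT); rewrite big_nil; apply. Qed.

Lemma bounded_sum_sub (X : eqType) (f : X -> R) (P Q : X -> Prop) M N :
  (forall x, Q x -> P x) -> M <= N -> bounded_sum f P M -> bounded_sum f Q N.
Proof. by move=> h hMN hP s us hs; apply: le_trans hMN; apply: hP => // x /hs /h. Qed.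

Lemma bounded_sum1 (X : eqType) (f : X -> R) x : 0 <= f x -> bounded_sum f (fun y => y = x) (f x).
Proof.
move=> f0 [|a [|b s]] us hs; first by rewrite big_nil.
  by rewrite big_seq1 (hs a) ?mem_head.
move: us; rewrite /= inE negb_or (hs a) ?mem_head // (hs b) ?eqxx //.
by rewrite !inE eqxx orbT.
Qed.

Lemma bounded_sum_or (X : eqType) (f : X -> R) P Q M N :
  bounded_sum f P M -> bounded_sum f Q N -> bounded_sum f (fun x => P x \/ Q x) (M + N).
Proof.
move=> hP hQ s us hs; rewrite (bigID (fun x => `[< P x >])) /=.
rewrite -[X in X + _]big_filter -[X in _ + X]big_filter; apply: lerD.
  apply: hP; first by rewrite filter_uniq.
  by move=> x; rewrite mem_filter => /andP[/asboolP].
apply: hQ; first by rewrite filter_uniq.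
by move=> x; rewrite mem_filter => /andP[/asboolP h /hs[]].
Qed.

Lemma sum_sub (X : eqType) (f : X -> R) (s t : seq X) : (forall x, 0 <= f x) ->
  uniq s -> {subset s <= t} -> \sum_(x <- s) f x <= \sum_(x <- t) f x.
Proof.
move=> f0 us st; rewrite [leRHS](bigID (fun x => x \in s)) /=.
apply: (@le_trans _ _ (\sum_(x <- undup t | x \in s) f x)).
  rewrite -[leRHS]big_filter le_eqVlt; apply/orP; left; apply/eqP.
  apply: perm_big; apply: uniq_perm => //; first by rewrite filter_uniq ?undup_uniq.
  by move=> x; rewrite mem_filter mem_undup; case: (boolP (x \in s)) => //= /st ->.
apply: ler_wpDr; first by rewrite sumr_ge0.
elim: t {st} => [|x t IH] //=; case: ifP => hx; rewrite !big_cons; case: ifP => hs //.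
  by apply: le_trans IH _; rewrite ler_wpDl.
by rewrite lerD2l.
Qed.

(** Distinct elements come from distinct pairs, so a sum over [P] is dominated by a sum over a
    finite rectangle of pairs, which factors. *)
Lemma bounded_sum_prod (X Y Z : eqType) (F : Y -> Z -> X) (f : X -> R) (f1 : Y -> R) (f2 : Z -> R)
    P P1 P2 C M1 M2 : 0 <= C -> (forall y, 0 <= f1 y) -> (forall z, 0 <= f2 z) ->
  (forall x, P x -> exists y z, [/\ P1 y, P2 z, x = F y z & f x <= C * (f1 y * f2 z)]) ->
  bounded_sum f1 P1 M1 -> bounded_sum f2 P2 M2 -> bounded_sum f P (C * (M1 * M2)).
Proof.
move=> C0 f10 f20 h h1 h2 s us hs.
have [t [et ht]] : exists t : seq (Y * Z), s = [seq F yz.1 yz.2 | yz <- t] /\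
    forall yz, yz \in t -> [/\ P1 yz.1, P2 yz.2 & f (F yz.1 yz.2) <= C * (f1 yz.1 * f2 yz.2)].
  elim: s {us} hs => [|x s IH] hs; first by exists [::].
  have [t [-> ht]] := IH (fun y hy => hs y (mem_behead (s := _ :: _) hy)).
  have [y [z [py pz ex hf]]] := h x (hs x (mem_head _ _)).
  exists ((y, z) :: t); split; first by rewrite /= ex.
  by move=> yz; rewrite inE => /orP[/eqP ->|/ht //] /=; rewrite -ex.
have ut : uniq t by move: us; rewrite et => /map_uniq.
rewrite et big_map.
apply: (@le_trans _ _ (\sum_(yz <- t) C * (f1 yz.1 * f2 yz.2))).
  by rewrite big_seq [leRHS]big_seq ler_sum // => yz /ht[].
rewrite -mulr_sumr ler_wpM2l //.
pose ys := undup (map fst t); pose zs := undup (map snd t).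
apply: (@le_trans _ _ (\sum_(yz <- [seq (y, z) | y <- ys, z <- zs]) f1 yz.1 * f2 yz.2)).
  apply: sum_sub => // [yz|yz hyz]; first by rewrite mulr_ge0.
  by apply/allpairsP; exists yz; rewrite !mem_undup !map_f //; case: yz {hyz}.
rewrite big_allpairs_dep /= -big_distrlr /=; apply: ler_pM; rewrite ?sumr_ge0 //.
  apply: h1; first exact: undup_uniq.
  by move=> y; rewrite mem_undup => /mapP[yz /ht[? _ _] ->].
apply: h2; first exact: undup_uniq.
by move=> z; rewrite mem_undup => /mapP[yz /ht[_ ? _] ->].
Qed.

Lemma bounded_sum_map (X Y : eqType) (F : Y -> X) (f : X -> R) (f1 : Y -> R) P P1 M :
  (forall y, 0 <= f1 y) ->
  (forall x, P x -> exists y, [/\ P1 y, x = F y & f x <= f1 y]) ->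
  bounded_sum f1 P1 M -> bounded_sum f P M.
Proof.
move=> f10 h h1; rewrite -[M]mul1r -[M]mulr1.
apply: (bounded_sum_prod (F := fun y (_ : unit) => F y) (f2 := fun=> 1) (P2 := fun=> True)) h1 _ => //.
- by move=> x /h[y [? -> ?]]; exists y, tt; rewrite mul1r mulr1.
- move=> s us _; apply: (@le_trans _ _ (\sum_(x <- [:: tt]) 1)); last by rewrite big_seq1.
  by apply: sum_sub => // -[].
Qed.
End BoundedSums.

(** * Cutting a walk at its last visit to the highest row *)

Lemma last_visit (A : Type) (a : pred A) (s : seq A) : has a s ->
  exists p x q, [/\ s = p ++ x :: q, a x & ~~ has a q].
Proof.
elim/last_ind: s => [|s x IH] //; rewrite has_rcons; case: (boolP (a x)) => [hx _|nx].
  by exists s, x, [::]; rewrite cats1.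
move=> /IH[p [y [q [-> hy hq]]]]; exists p, y, (rcons q x).
by rewrite has_rcons negb_or nx rcons_cat.
Qed.

Definition beside (r : rhombus) (e : edge) : rhombus :=
  if e == west r then (r.1 - 1, r.2) else (r.1 + 1, r.2).

Section Cut.
Variables (R : realType) (u1 u2 v w1 w2 : R).
Hypotheses (hu1 : 0 < u1) (hu2 : 0 < u2) (hv : 0 < v) (hw1 : 0 <= w1) (hw2 : 0 <= w2).
Hypotheses (hd1 : w1 <= u1 * u1) (hd2 : w2 <= u2 * u2).

Let weight := wt u1 u2 v w1 w2.
Let rwt := rw u1 u2 v w1 w2.

(* Bounds the weight of one piece, and the ratio of the weights of two. *)
Definition cut_ratio : R := 1 + (u1 + u2 + v) * (1 + u1^-1 + u2^-1 + v^-1).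

Lemma cut_ratio_ge1 : 1 <= cut_ratio.
Proof. by rewrite lerDl mulr_ge0 // ?addr_ge0 // ?invr_ge0 ltW. Qed.

Lemma rw1_le p : rwt [:: p] <= cut_ratio.
Proof.
have [p1 p2 p3] : [/\ 0 < u1, 0 < u2 & 0 < v] by [].
have i1 : 0 < u1^-1 by rewrite invr_gt0.
have i2 : 0 < u2^-1 by rewrite invr_gt0.
have i3 : 0 < v^-1 by rewrite invr_gt0.
apply: (@le_trans _ _ (u1 + u2 + v)); first by rewrite /rwt /rw /rhombus_weight; case: (p) => /=; lra.
apply: (@le_trans _ _ ((u1 + u2 + v) * (1 + u1^-1 + u2^-1 + v^-1))); last by rewrite lerDr.
by rewrite ler_peMr //; lra.
Qed.

Lemma rw1_le2 p p' : rwt [:: p] <= cut_ratio * rwt [:: p'].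
Proof.
have [p1 p2 p3] : [/\ 0 < u1, 0 < u2 & 0 < v] by [].
have i1 : 0 < u1^-1 by rewrite invr_gt0.
have i2 : 0 < u2^-1 by rewrite invr_gt0.
have i3 : 0 < v^-1 by rewrite invr_gt0.
apply: (@le_trans _ _ (u1 + u2 + v)); first by rewrite /rwt /rw /rhombus_weight; case: (p) => /=; lra.
have h : 0 < rwt [:: p'] by rewrite /rwt /rw /rhombus_weight; case: (p').
rewrite -ler_pdivrMr // /cut_ratio.
apply: (@le_trans _ _ ((u1 + u2 + v) * (1 + u1^-1 + u2^-1 + v^-1))); last by rewrite lerDr.
apply: ler_wpM2l; first lra.
by rewrite /rwt /rw /rhombus_weight; case: (p') => /=; lra.
Qed.

Lemma prod_at_le (rs : seq rhombus) (r : rhombus) : uniq rs ->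
  \prod_(r' <- rs) (if r' == r then cut_ratio else 1) <= cut_ratio.
Proof.
move=> us; have c1 := cut_ratio_ge1; case: (boolP (r \in rs)) => hr.
  by rewrite (bigD1_seq r) //= eqxx big1 ?mulr1 // => r' /negPf ->.
by rewrite big_seq big1 // => r' hr'; case: eqP => // e; rewrite -e hr' in hr.
Qed.

Lemma wt_cut (g b q : seq edge) (r r' : rhombus) :
  (forall s, rwt (trace g s) <= (if s == r then cut_ratio else 1) * (if s == r' then cut_ratio else 1)
     * (rwt (trace b s) * rwt (trace q s))) ->
  weight g <= cut_ratio ^+ 2 * (weight b * weight q).
Proof.
move=> h; have [rs hrs] := covers_all [:: g; b; q].
have cg : covers rs g by apply: hrs; rewrite !inE eqxx.
have cb : covers rs b by apply: hrs; rewrite !inE eqxx orbT.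
have cq : covers rs q by apply: hrs; rewrite !inE eqxx !orbT.
have us : uniq rs by case: cg.
rewrite /weight (wtE _ _ _ _ _ cg) (wtE _ _ _ _ _ cb) (wtE _ _ _ _ _ cq).
have rw0 t : 0 <= rwt t := rw_ge0 hu1 hu2 hv hw1 hw2 t.
apply: (@le_trans _ _ (\prod_(s <- rs) ((if s == r then cut_ratio else 1) *
   (if s == r' then cut_ratio else 1) * (rwt (trace b s) * rwt (trace q s))))).
  by apply: ler_prod => s _; rewrite rw0 h.
rewrite !big_split /= ler_wpM2r ?mulr_ge0 ?prodr_ge0 //; do ?by move=> *; exact: rw0.
have c1 := cut_ratio_ge1; have c0 : 0 <= cut_ratio by lra.
rewrite expr2; apply: ler_pM; rewrite ?prod_at_le // prodr_ge0 // => s _; by case: ifP.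
Qed.
End Cut.

(** Two opposite arcs use all four sides, the north one included. *)
Lemma low_trace g r q a b : is_saw g -> piece_ends r q a b -> joined g (a, b) ->
  north r \notin g -> forall p, joined g (ends r p) = (p == q).
Proof.
move=> hg hq hj hn p; apply/idP/eqP => [hp|->]; last by rewrite (joined_piece _ hq).
have hj' : joined g (ends r q) by rewrite (joined_piece _ hq).
have := saw_compatible hg hj' hp => /orP[/eqP -> //|/eqP ep].
have [n1 n2] : (ends r p).1 != north r /\ (ends r p).2 != north r.
  have [h1 h2] : (ends r p).1 \in g /\ (ends r p).2 \in g.
    by apply: joined_in; case: (ends r p) hp.
  by split; apply: contraNneq hn => <-.
have [m1 m2] : (ends r q).1 != north r /\ (ends r q).2 != north r.
  have [h1 h2] : (ends r q).1 \in g /\ (ends r q).2 \in g.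
    by apply: joined_in; case: (ends r q) hj'.
  by split; apply: contraNneq hn => <-.
by move: n1 n2 m1 m2; rewrite ep; case: (q) => //=; rewrite eqxx.
Qed.

Lemma vertical_side r e : e \in sides r -> e.1 ->
  r.2 *+ 2 + 1 = py e /\ (e = west r \/ e = east r).
Proof.
rewrite !inE => /or4P[] /eqP -> // _; split=> //; first by right.
by left.
Qed.

Section CutWalk.
Variables (R : realType) (u1 u2 v w1 w2 : R).
Hypotheses (hu1 : 0 < u1) (hu2 : 0 < u2) (hv : 0 < v) (hw1 : 0 <= w1) (hw2 : 0 <= w2).
Hypotheses (hd1 : w1 <= u1 * u1) (hd2 : w2 <= u2 * u2).

Let weight := wt u1 u2 v w1 w2.
Let K := cut_ratio u1 u2 v.

(* The part before the last edge at the highest level [2 j + 1] is completed by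
   one step to the north side of its last rhombus [r]; the part after that edge
   starts at the south side of the next rhombus. Only two rhombi change. *)
Lemma cut_last_maximum g (j : int) : is_saw g -> ~~ (head origin g).1 ->
  (forall e, e \in g -> py e <= j *+ 2 + 1) -> has (fun e => py e == j *+ 2 + 1) g ->
  exists p r e q, [/\ [/\ g = p ++ e :: q, p != [::] & r.2 = j], e = west r \/ e = east r,
    is_saw (rcons p (north r)), forall x, x \in q -> py x <= j *+ 2 &
    (q = [::] \/ is_saw q /\ head origin q = south (beside r e)) /\
    weight g <= K ^+ 2 * (weight (rcons p (north r)) * weight q)].
Proof.
move=> hg hh hmax /last_visit[p [z [q [eg /eqP hz hq]]]].
have zv : z.1 by move: hz; case: (z) => [[] [? ?]] //; rewrite /py /=; clear; lia.
have ug : uniq g by case: hg.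
case/lastP: p eg => [|p e] eg; first by move: hh; rewrite eg /= zv.
have sez : (e, z) \in steps g by rewrite eg cat_rcons steps_cat steps_cons mem_cat mem_head orbT.
have jez : joined g (e, z) by rewrite /joined sez.
have sh := saw_face hg sez; move: (face (e, z)) sh => r sh.
have zr : z \in sides r by case/and3P: sh.
have [hr hside] := vertical_side zr zv.
have er : r.2 = j by move: hr; rewrite hz; clear; lia.
have nN x s : s.2 = j -> x \in g -> x != north s.
  move=> es /hmax h; apply: contraTneq h => ->.
  by rewrite /py /= es; clear; lia.
have noN s : s.2 = j -> north s \notin g.
  by move=> es; apply/negP => h; have := nN _ _ es h; rewrite eqxx.
have eing : e \in g by rewrite eg mem_cat mem_rcons mem_head.
have /and3P[es _ _] := sh.
have sN : shared r (e, north r).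
  by rewrite /shared /= es nN // !inE eqxx ?orbT.
have /sharedP[q0 hq0] := sh; have /sharedP[p1 hp1] := sN.
have tg := low_trace hg hq0 jez (noN _ er).
have up : uniq (rcons p e ++ z :: q) by rewrite -eg.
have /and3P[up1 /hasPn upn upq] : [&& uniq (rcons p e), ~~ has (mem (rcons p e)) (z :: q) & uniq (z :: q)].
  by rewrite -cat_uniq.
have zp : z \notin rcons p e by apply: upn; rewrite mem_head.
have eq' : e \notin z :: q by apply/negP => h; have := upn _ h; rewrite /= mem_rcons mem_head.
have sp : is_saw (rcons p e) by apply: (@saw_prefix _ (z :: q)); [case: (p)|rewrite -eg].
have jg ab : joined g ab = [|| joined (rcons p e) ab, joined [:: e; z] ab | joined (z :: q) ab].
  by rewrite eg joined_glue.
have jp s : joined (rcons p e) (ends r s) = false.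
  apply/negP => h; have e1 : s = q0 by apply/eqP; rewrite -tg jg h.
  subst s.
  by move: h; rewrite (joined_piece _ hq0) => /joined_in[_ h]; rewrite h in zp.
have jzq s : joined (z :: q) (ends r s) = false.
  apply/negP => h; have e1 : s = q0 by apply/eqP; rewrite -tg jg h !orbT.
  subst s.
  by move: h; rewrite (joined_piece _ hq0) => /joined_in[h _]; rewrite h in eq'.
have tb s : trace (rcons (rcons p e) (north r)) s = if s == r then [:: p1] else trace (rcons p e) s.
  case: eqVneq => [->|ns].
    rewrite traceE -selected1; apply: eq_selected => t.
    by rewrite joined_rcons jp (joined2E _ _ hp1) eqxx.
  by rewrite !traceE; apply: eq_selected => t; rewrite joined_rcons (joined2E _ _ hp1) (negPf ns) orbF.
have sb : is_saw (rcons (rcons p e) (north r)).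
  apply: (saw_rcons sp _ hp1); last by rewrite tb eqxx; case: (p1).
  by apply: contra (noN _ er) => h; rewrite eg mem_cat h.
have c1 := cut_ratio_ge1 hu1 hu2 hv; have c0 : 0 <= cut_ratio u1 u2 v := le_trans ler01 c1.
have trg : trace g r = [:: q0] by rewrite traceE -selected1; apply: eq_selected.
have rw0 t : 0 <= rw u1 u2 v w1 w2 t := rw_ge0 hu1 hu2 hv hw1 hw2 t.
have rwnil : rw u1 u2 v w1 w2 [::] = 1 by [].
have disj s t : ~~ (joined (rcons p e) (ends s t) && joined (z :: q) (ends s t)).
  apply/negP => /andP[h1 h2]; have [k1 _] : (ends s t).1 \in rcons p e /\ (ends s t).2 \in rcons p e.
    by apply: joined_in; case: (ends s t) h1.
  have [k2 _] : (ends s t).1 \in z :: q /\ (ends s t).2 \in z :: q.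
    by apply: joined_in; case: (ends s t) h2.
  by have := upn _ k2; rewrite /= k1.
have adm s : admissible (trace g s) by case: hg => _ _ _; apply.
exists (rcons p e), r, z, q; split.
- by rewrite eg; split=> //; case: (p).
- exact: hside.
- exact: sb.
- move=> x hx; have hxg : x \in g by rewrite eg mem_cat inE hx !orbT.
  have /eqP n : py x != j *+ 2 + 1 := hasPn hq x hx.
  by move: (hmax _ hxg) n; clear; lia.
case: q eg hq up upn upq eq' jg jzq disj => [|s q] eg hq up upn upq eq' jg jzq disj.
  split; first by left.
  (* With nothing after the cut a single rhombus changes; it is given both factors. *)
  apply: (@wt_cut _ _ _ _ _ _ hu1 hu2 hv hw1 hw2 g _ [::] r r) => t.
  have -> : trace [::] t = [::] by rewrite traceE (@eq_selected _ (fun=> false)).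
  rewrite tb; case: eqVneq => [->|nt].
    rewrite trg rwnil mulr1 -mulrA; apply: (le_trans (rw1_le2 _ _ hu1 hu2 hv q0 p1)).
    by rewrite ler_peMl // mulr_ge0.
  rewrite rwnil !mul1r mulr1 le_eqVlt; apply/orP; left; apply/eqP; congr rw.
  rewrite !traceE; apply: eq_selected => x.
  by rewrite jg (joined2E _ _ hq0) (negPf nt) /= /joined /= orbF.
have szs : (z, s) \in steps g.
  by rewrite eg steps_cat mem_cat steps_cons mem_head orbT.
have jzs : joined g (z, s) by rewrite /joined szs.
have sh' := saw_face hg szs; move: (face (z, s)) sh' => r' sh'.
have nr : r' != r.
  apply/eqP => er'; rewrite er' in sh'.
  have := saw_turn hg jez jzs sh sh' => ees.
  by move: eq'; rewrite ees !inE eqxx orbT.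
have /and3P[zr' sr' nzs] := sh'; rewrite /= in zr' sr' nzs.
have [hr' hside'] := vertical_side zr' zv.
have er' : r'.2 = j by move: hr'; rewrite hz; clear; lia.
(* After its last visit to the top level the walk can only go down. *)
have es' : s = south r'.
  have hs2 : py s <= j *+ 2.
    have /eqP n : py s != j *+ 2 + 1 := hasPn hq s (mem_head _ _).
    by have := hmax s; rewrite eg mem_cat !inE eqxx !orbT => /(_ isT); move: n; clear; lia.
  by move: sr' hs2; rewrite !inE => /or4P[] /eqP -> //; rewrite /py /= er'; clear; lia.
have eb : beside r z = r'.
  move: hside hside' nr; rewrite /beside; case: (r) er => i j' /= ->; case: (r') er' => i' j'' /= -> h h' n.
  have {}n : i' <> i by move=> e1; rewrite e1 eqxx in n.
  case: h h' => -> [] [] h; rewrite ?eqxx.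
  - by case: n.
  - by congr pair; move: h; clear; lia.
  - rewrite (_ : (_ == _) = false); first by congr pair; move: h; clear; lia.
    by apply/negP => /eqP []; clear; lia.
  - by case: n; move: h; clear; lia.
split.
  right; split; last by rewrite /= es' eb.
  by apply: (@saw_suffix (rcons (rcons p e) z)); rewrite // cat_rcons -eg.
have /sharedP[q1 hq1] := sh'.
have tg' := low_trace hg hq1 jzs (noN _ er').
have trg' : trace g r' = [:: q1] by rewrite traceE -selected1; apply: eq_selected.
have jz ab : joined (z :: s :: q) ab = joined [:: z; s] ab || joined (s :: q) ab.
  by rewrite -[z :: s :: q]/(rcons [::] z ++ s :: q) joined_glue.
have zq : z \notin s :: q by case/andP: upq.
apply: (@wt_cut _ _ _ _ _ _ hu1 hu2 hv hw1 hw2 g _ (s :: q) r r') => t.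
rewrite tb; case: (eqVneq t r) => [->|nt].
  rewrite (eq_sym r) (negPf nr) mulr1 trg.
  have -> : trace (s :: q) r = [::].
    rewrite traceE (@eq_selected _ (fun=> false)) // => x.
    by have := jzq x; rewrite jz => /norP[_ /negPf].
  by rewrite rwnil mulr1; apply: rw1_le2.
case: (eqVneq t r') => [->|nt'].
  rewrite trg' mul1r.
  have -> : trace (rcons p e) r' = [::].
    rewrite traceE (@eq_selected _ (fun=> false)) // => x; apply/negP => h.
    have e1 : x = q1 by apply/eqP; rewrite -tg' jg h.
    subst x.
    by move: h; rewrite (joined_piece _ hq1) => /joined_in[h _]; rewrite h in zp.
  have -> : trace (s :: q) r' = [::].
    rewrite traceE (@eq_selected _ (fun=> false)) // => x; apply/negP => h.
    have e1 : x = q1 by apply/eqP; rewrite -tg' jg jz h !orbT.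
    subst x.
    by move: h; rewrite (joined_piece _ hq1) => /joined_in[h _]; rewrite h in zq.
  by rewrite rwnil !mulr1; apply: rw1_le.
rewrite !mul1r !traceE; apply: rw_sub => //; first exact: (adm t).
  by move=> x; rewrite jg jz (joined2E _ _ hq0) (joined2E _ _ hq1) (negPf nt) (negPf nt').
by move=> x; apply: contra (disj t x) => /andP[-> h]; rewrite jz h orbT.
Qed.
End CutWalk.

(** * Decomposition into bridges *)

Definition walk (g : seq edge) : Prop := is_saw g /\ ohead g = Some origin.

(* The level [py] counts half rows, hence the doubled heights below. *)
Definition half_walk (L : nat) (g : seq edge) : Prop :=
  walk g /\ forall e, e \in g -> 0 <= py e <= L%:Z.

Definition bridge (T : nat) (g : seq edge) : Prop :=
  [/\ half_walk T.*2 g, ~~ (last origin g).1 & py (last origin g) = T.*2%:Z].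

Definition upper_walk (g : seq edge) : Prop :=
  walk g /\ forall e, e \in g -> 0 <= py e.

Lemma halfturnK a b : involutive (halfturn a b).
Proof. by move=> [[] [i j]]; rewrite /halfturn /=; congr (_, (_, _)); lia. Qed.

Lemma py_halfturn a b e : py (halfturn a b e) = b *+ 2 - py e.
Proof. by case: e => [[] [i j]]; rewrite /halfturn /py /=; lia. Qed.

Lemma walk_head g : walk g -> g != [::] /\ head origin g = origin.
Proof. by case=> hs; case: g hs => [[]|a g _ [->]]. Qed.

Lemma turned_walk g a b : is_saw g -> head origin g = hedge a b -> walk (map (halfturn a b) g).
Proof.
move=> hs hh; split; first exact: (saw_map (halfturn_symmetry a b) hs).
case: g hs hh => [[]//|x g] _ /= ->; congr Some.
by rewrite /halfturn /hedge /= !subrr.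
Qed.

Lemma map_halfturnK a b : involutive (map (halfturn a b)).
Proof. by move=> g; rewrite mapK //; exact: halfturnK. Qed.

Lemma max_level (g : seq edge) : g != [::] -> exists2 e, e \in g & forall e', e' \in g -> py e' <= py e.
Proof.
elim: g => [|a [|b g] IH] // _.
  by exists a; rewrite ?mem_head // => e'; rewrite inE => /eqP ->.
have [e he hm] := IH isT; case: (lerP (py a) (py e)) => h.
  exists e; first by rewrite inE he orbT.
  by move=> e'; rewrite inE => /orP[/eqP ->|/hm].
exists a; first exact: mem_head.
by move=> e'; rewrite inE => /orP[/eqP ->|/hm h'] //; apply: le_trans h' (ltW h).
Qed.

(** Inside the walk, a highest horizontal edge would have both of its pieces in the rhombus below
    it, against [saw_turn]. *)
Lemma max_at_end g e : is_saw g -> e \in g -> ~~ e.1 -> (forall e', e' \in g -> py e' <= py e) ->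
  e = head origin g \/ e = last origin g.
Proof.
move=> hs he ne hm; case/splitPr: he hs hm => p q hs hm.
case/lastP: p hs hm => [|p x] hs hm; first by left.
case: q hs hm => [|y q] hs hm; first by right; rewrite last_cat.
have u : uniq (rcons p x ++ [:: e, y & q]) by case: hs.
have s1 : (x, e) \in steps (rcons p x ++ [:: e, y & q]).
  by rewrite cat_rcons steps_cat steps_cons mem_cat mem_head orbT.
have s2 : (e, y) \in steps (rcons p x ++ [:: e, y & q]).
  by rewrite steps_cat steps_cons mem_cat mem_head orbT.
have h1 := saw_face hs s1; have h2 := saw_face hs s2.
have hx : py x <= py e by apply: hm; rewrite mem_cat mem_rcons mem_head.
have hy : py y <= py e by apply: hm; rewrite mem_cat !inE eqxx !orbT.
have := side_across h1; have := side_across (etrans (shared_sym _ _ _) h2).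
rewrite (negPf ne) => -[k1 k2] [k3 k4].
have ef : face (x, e) = face (e, y).
  by move: (face _) (face _) k1 k2 k3 k4 => r r' k1 k2 k3 k4; apply: center_inj; lia.
have j1 : joined (rcons p x ++ [:: e, y & q]) (x, e) by rewrite /joined s1.
have j2 : joined (rcons p x ++ [:: e, y & q]) (e, y) by rewrite /joined s2.
have exy := saw_turn hs j1 j2 h1; rewrite ef in exy.
move: u; rewrite (exy h2) cat_uniq => /and3P[_ /hasPn /(_ y)].
by rewrite !inE eqxx orbT mem_rcons mem_head => /(_ isT).
Qed.

Definition opposite_side (bit : bool) (r : rhombus) : edge := if bit then west r else east r.

(* Inverse of the cut of [cut_last_maximum] for a second part turned upside
   down; the boolean tells on which side of the last rhombus the edge was. *)
Definition uncut (b : bool * seq edge) (z : seq edge) : seq edge :=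
  let n := last origin b.2 in
  let r : rhombus := (n.2.1, n.2.2 - 1) in
  let e := opposite_side b.1 r in
  take (size b.2).-1 b.2 ++ e :: map (halfturn (beside r e).1 (beside r e).2) z.

Section HammersleyWelsh.
Variables (R : realType) (u1 u2 v w1 w2 : R).
Hypotheses (hu1 : 0 < u1) (hu2 : 0 < u2) (hv : 0 < v) (hw1 : 0 <= w1) (hw2 : 0 <= w2).
Hypotheses (hd1 : w1 <= u1 * u1) (hd2 : w2 <= u2 * u2).

Let f := wt u1 u2 v w1 w2.
Let K := cut_ratio u1 u2 v.

Let f0 g : 0 <= f g. Proof. exact: wt_ge0. Qed.

(** [uncut] recovers the walk from the two parts given by [cut_last_maximum] and one bit; the bit
    costs the factor 2, the altered rhombi the factor K^2. *)
Lemma cut_bounded (P P1 P2 : seq edge -> Prop) (M1 M2 : R) :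
  (forall g, P g -> exists j : int, [/\ is_saw g, ~~ (head origin g).1,
     forall e, e \in g -> py e <= j *+ 2 + 1, has (fun e => py e == j *+ 2 + 1) g &
     forall p r e q, g = p ++ e :: q -> p != [::] -> r.2 = j ->
       e = west r \/ e = east r -> is_saw (rcons p (north r)) ->
       (forall x, x \in q -> py x <= j *+ 2) ->
       (q = [::] \/ is_saw q /\ head origin q = south (beside r e)) -> (beside r e).2 = j ->
       P1 (rcons p (north r)) /\ P2 (map (halfturn (beside r e).1 (beside r e).2) q)]) ->
  bounded_sum f P1 M1 -> bounded_sum f P2 M2 -> bounded_sum f P (K ^+ 2 * ((2 * M1) * M2)).
Proof.
move=> hP b1 b2.
have b1' : bounded_sum (fun y : bool * seq edge => f y.2) (fun y => P1 y.2) (2 * M1).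
  rewrite -[2 * M1]mul1r.
  apply: (bounded_sum_prod (F := fun (c : bool) g => (c, g)) (f1 := fun=> 1) (P1 := fun=> True) _ _ f0 _ _ b1) => //.
    by move=> [c g] h; exists c, g; rewrite !mul1r.
  move=> s us _; apply: (@le_trans _ _ (\sum_(x <- [:: true; false]) 1)).
    by apply: sum_sub => // -[].
  by rewrite !big_cons big_nil addr0.
apply: (bounded_sum_prod (F := uncut) _ _ f0 _ b1' b2) => //.
  by rewrite exprn_ge0 // (le_trans ler01) // cut_ratio_ge1.
move=> g /hP[j [hs hh hm hex hcut]].
have [p [r [e [q [[eg hp er] hside sb hq [hq' hle]]]]]] :=
  cut_last_maximum hu1 hu2 hv hw1 hw2 hd1 hd2 hs hh hm hex.
have eb : (beside r e).2 = j by rewrite /beside; case: ifP.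
have [h1 h2] := hcut p r e q eg hp er hside sb hq hq' eb.
have [bit ebit] : exists bit, e = opposite_side bit r.
  by case: hside => ->; [exists true|exists false].
exists (bit, rcons p (north r)), (map (halfturn (beside r e).1 (beside r e).2) q); split=> //.
  rewrite /uncut /= last_rcons size_rcons -cats1 take_size_cat //=.
  have -> : (r.1, r.2 + 1 - 1) = r by case: (r) => a b /=; rewrite addrK.
  by rewrite -ebit map_halfturnK eg.
by rewrite /= /f (wt_map (halfturn_symmetry _ _)).
Qed.

Lemma half_walk0 : bounded_sum f (half_walk 0) 1.
Proof.
have e1 : f [:: origin] = 1 := wt1 _ _ _ _ _ _.
rewrite -[X in bounded_sum _ _ X]e1; apply: bounded_sum_sub (bounded_sum1 (f0 [:: origin])) => //.
move=> g [[hs ho] hl]; case: g hs ho hl => // a [|b g] hs [ea] hl; subst a => //.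
have hst : (origin, b) \in steps (origin :: b :: g) by rewrite steps_cons mem_head.
have := saw_face hs hst; rewrite shared_sym => /side_across /= [_].
have := hl b; rewrite !inE eqxx orbT => /(_ isT).
have -> : py origin = 0 by [].
by clear; lia.
Qed.

(** The additional walks reach level 2 T + 1. Cut there, they give a bridge of height T + 1 and,
    upside down, a half-walk up to level 2 T or nothing, whence 1 + M. *)
Lemma half_walk_odd (T : nat) M B : bounded_sum f (half_walk T.*2) M ->
  bounded_sum f (bridge T.+1) B ->
  bounded_sum f (half_walk T.*2.+1) (M + K ^+ 2 * ((2 * B) * (1 + M))).
Proof.
move=> hM hB.
apply: (bounded_sum_sub (P := fun g => half_walk T.*2 g \/
   (half_walk T.*2.+1 g /\ has (fun e => py e == T%:Z *+ 2 + 1) g))) (lexx _) _.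
  move=> g hg; case: (boolP (has (fun e => py e == T%:Z *+ 2 + 1) g)) => hh; first by right.
  left; have [hw hl] := hg; split=> // e he.
  by have := hl e he; have /eqP := hasPn hh e he; clear; lia.
apply: bounded_sum_or => //.
have h1M : bounded_sum f (fun z => z = [::] \/ half_walk T.*2 z) (1 + M).
  apply: bounded_sum_or => //; have e1 : f [::] = 1 := wt_nil _ _ _ _ _.
  by rewrite -[X in bounded_sum _ _ X]e1; apply: bounded_sum1.
apply: (cut_bounded _ hB h1M) => g [[hw hl] hh]; exists T%:Z.
have [hs ho] := hw; have [gn hd] := walk_head hw.
split=> //; first by rewrite hd.
  by move=> e /hl; clear; lia.
move=> p r e q eg hp er _ sb hq hq' eb; split.
  split; first split.
  - split=> //; move: ho; rewrite eg; by case: (p) hp.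
  - move=> x; rewrite mem_rcons inE => /orP[/eqP ->|hx].
      by rewrite /py /= er; clear; lia.
    have : x \in g by rewrite eg mem_cat hx.
    by move=> /hl; clear; lia.
  - by rewrite last_rcons.
  - by rewrite last_rcons /py /= er; clear; lia.
case: hq' => [->|[sq hdq]]; first by left.
right; split; first exact: turned_walk.
move=> x /mapP[y hy ->]; rewrite py_halfturn eb.
have : y \in g by rewrite eg mem_cat inE hy !orbT.
by move=> /hl; move: (hq _ hy); clear; lia.
Qed.

(** Level 2 T + 2 consists of horizontal edges, so by [max_at_end] a walk that reaches it stops
    there and is a bridge. *)
Lemma half_walk_even (T : nat) M B : bounded_sum f (half_walk T.*2.+1) M ->
  bounded_sum f (bridge T.+1) B -> bounded_sum f (half_walk T.+1.*2) (M + B).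
Proof.
move=> hM hB.
apply: (bounded_sum_sub (P := fun g => half_walk T.*2.+1 g \/ bridge T.+1 g) _ (lexx _)); last first.
  exact: bounded_sum_or.
move=> g hg; have [hw hl] := hg.
case: (boolP (has (fun e => py e == T.+1.*2%:Z) g)) => [/hasP[e he /eqP ee]|hh]; last first.
  left; split=> // e he.
  by have := hl e he; have /eqP := hasPn hh e he; clear; lia.
right; have [hs _] := hw; have [_ hd] := walk_head hw.
have ne : ~~ e.1 by rewrite -py_type ee; clear; lia.
have hm e' : e' \in g -> py e' <= py e by move=> /hl; rewrite ee => /andP[].
case: (max_at_end hs he ne hm) => e1.
  by move: ee; rewrite e1 hd /py /=; clear; lia.
by split=> //; rewrite -e1.
Qed.

(* A half-walk is cut repeatedly into bridges of decreasing heights, as in the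
   theorem of Hammersley and Welsh; the recursion is dominated by a product of
   factors [1 + c beta i]. *)
Lemma half_walk_bounded (beta : nat -> R) (T : nat) :
  (forall i, bounded_sum f (bridge i.+1) (beta i)) ->
  bounded_sum f (half_walk T.*2) (2 * expR (4 * K ^+ 2 * \sum_(i < T) beta i) - 1).
Proof.
move=> hb; elim: T => [|T IH].
  by rewrite big_ord0 mulr0 expR0 (_ : 2 * 1 - 1 = 1); [exact: half_walk0|lra].
have h1 := half_walk_even (half_walk_odd IH (hb T)) (hb T).
apply: bounded_sum_sub h1 => //.
have b0 := bounded_sum_ge0 (hb T).
rewrite big_ord_recr /=; set Sg := \sum_(i < T) beta i; set b := beta T in b0 *.
have K1 : 1 <= K := cut_ratio_ge1 hu1 hu2 hv.
have c1 : 1 <= K ^+ 2 by rewrite exprn_ege1.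
move: (K ^+ 2) c1 => c c1.
(* With 1 + M = 2 E the two recursions give 2 E - 1 + 4 E b c + b, which is below 2 E (1 + 2 c b)^2
   - 1 because b <= E b c; then 1 + t <= exp t. *)
rewrite [4 * c * (_ + _)]mulrDr expRD.
set E := expR (4 * c * Sg).
have E0 : 0 <= E by apply: expR_ge0.
have k1 : 1 + 2 * c * b <= expR (2 * c * b) by apply: expR_ge1Dx.
have k2 : (1 + 2 * c * b) * (1 + 2 * c * b) <= expR (4 * c * b).
  have -> : 4 * c * b = 2 * c * b + 2 * c * b by ring.
  have z0 : 0 <= 1 + 2 * c * b by rewrite addr_ge0 // !mulr_ge0 //; lra.
  by rewrite expRD; apply: ler_pM.
have k3 : 2 * E * ((1 + 2 * c * b) * (1 + 2 * c * b)) <= 2 * E * expR (4 * c * b).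
  by rewrite ler_wpM2l // mulr_ge0.
have k4 : 0 <= E * b by rewrite mulr_ge0.
have k5 : 0 <= E * b * b * c * c by rewrite !mulr_ge0 //; lra.
have k6 : E * b <= E * b * c by rewrite ler_peMr.
have k7 : b <= E * b.
  rewrite ler_peMl // /E -[leLHS]expR0 ler_expR !mulr_ge0 ?sumr_ge0 //; first by lra.
  by move=> i _; apply: bounded_sum_ge0 (hb i).
rewrite -/E; set X := expR (4 * c * b) in k3 *.
have -> : 2 * (E * X) = 2 * E * X by ring.
have e1 : 2 * E * ((1 + 2 * c * b) * (1 + 2 * c * b)) = 2 * E + 8 * (E * b * c) + 8 * (E * b * b * c * c) by ring.
have -> : 2 * E - 1 + c * (2 * b * (1 + (2 * E - 1))) + b = 2 * E - 1 + 4 * (E * b * c) + b by ring.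
rewrite e1 in k3; move: (E * b * b * c * c) (E * b * c) (E * b) (2 * E * X) k3 k4 k5 k6 k7 => y1 y2 y3 y4.
by lra.
Qed.

Lemma upper_walk_bounded (beta : nat -> R) (S : R) :
  (forall i, bounded_sum f (bridge i.+1) (beta i)) -> (forall T, \sum_(i < T) beta i <= S) ->
  bounded_sum f upper_walk (2 * expR (4 * K ^+ 2 * S)).
Proof.
move=> hb hS s us hs.
have [T hT] : exists T : nat, forall g, g \in s -> forall e, e \in g -> py e <= T.*2%:Z.
  elim: s {us hs} => [|g s [T IH]]; first by exists 0%N.
  have [T' hT'] : exists T' : nat, forall e, e \in g -> py e <= T'.*2%:Z.
    elim: g => [|e g [T' IH']]; first by exists 0%N.
    exists (T' + absz (py e))%N => x; rewrite inE => /orP[/eqP ->|/IH']; first by clear; lia.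
    by clear; lia.
  exists (T + T')%N => x; rewrite inE => /orP[/eqP -> e /hT'|hx e he]; first by clear; lia.
  by have := IH _ hx e he; clear; lia.
have := half_walk_bounded (T := T) hb => /(_ s us) h.
apply: (@le_trans _ _ (2 * expR (4 * K ^+ 2 * \sum_(i < T) beta i) - 1)).
  apply: h => g hg; have [hw h0] := hs g hg; split=> // e he.
  by rewrite h0 //= (hT g).
have K1 : 1 <= K := cut_ratio_ge1 hu1 hu2 hv.
have c1 : 0 <= K ^+ 2 by rewrite exprn_ge0 //; lra.
have : expR (4 * K ^+ 2 * \sum_(i < T) beta i) <= expR (4 * K ^+ 2 * S).
  by rewrite ler_expR ler_wpM2l // mulr_ge0.
by move: (expR _) (expR _) => a b; lra.
Qed.

(* A walk is cut at its last visit to its highest level, and both parts are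
   turned upside down. *)
Lemma walk_bounded M : bounded_sum f upper_walk M -> exists N, bounded_sum f walk N.
Proof.
move=> hM.
(* Three cases for the highest level: attained at the start ([P0]), at a horizontal last edge
   ([P1]), or on a vertical edge, where the walk is cut ([P2]). *)
pose P0 g := exists2 y, upper_walk y & g = map (halfturn 0 0) y.
pose turnback y := rev (map (halfturn (last origin y).2.1 (last origin y).2.2) y).
pose P1 g := exists2 y, upper_walk y & g = turnback y.
have b0 : bounded_sum f P0 M.
  apply: (bounded_sum_map (F := map (halfturn 0 0)) (f1 := f)) hM => // g [y hy ->].
  by exists y; rewrite /f (wt_map (halfturn_symmetry _ _)).
have b1 : bounded_sum f P1 M.
  apply: (bounded_sum_map (F := turnback) (f1 := f)) hM => // g [y hy ->].
  by exists y; rewrite /f wt_rev (wt_map (halfturn_symmetry _ _)).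
have back g : walk g -> ~~ (last origin g).1 -> (forall e, e \in g -> py e <= py (last origin g)) -> P1 g.
  move=> hw nl hm; have [hs ho] := hw; have [gn hd] := walk_head hw.
  set l := last origin g in nl hm.
  have el : l = hedge l.2.1 l.2.2 by case: (l) nl => [[] [i j]].
  exists (map (halfturn l.2.1 l.2.2) (rev g)).
    split.
      apply: turned_walk; first exact: saw_rev.
      rewrite -el /l; case/lastP: (g) gn => // x z _; by rewrite rev_rcons last_rcons.
    move=> e /mapP[e' he' ->]; rewrite py_halfturn.
    have : py l = l.2.2 *+ 2 by rewrite el.
    by have := hm e'; rewrite -mem_rev he' => /(_ isT); clear; lia.
  have lr : last origin (map (halfturn l.2.1 l.2.2) (rev g)) = l.
    rewrite (_ : origin = halfturn l.2.1 l.2.2 l) ?last_map; last first.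
      by rewrite {3}el /halfturn /hedge /= !subrr.
    have -> : last l (rev g) = head l g by case: (g) gn => // x z _; rewrite rev_cons last_rcons.
    have -> : head l g = origin by move: hd; case: (g) gn.
    by rewrite [RHS]el /halfturn /hedge /= !subr0.
  by rewrite /turnback lr map_halfturnK revK.
have h1M : bounded_sum f (fun z => z = [::] \/ upper_walk z) (1 + M).
  apply: bounded_sum_or => //; have e1 : f [::] = 1 := wt_nil _ _ _ _ _.
  by rewrite -[X in bounded_sum _ _ X]e1; apply: bounded_sum1.
pose P2 g := walk g /\ exists j : int, (forall e, e \in g -> py e <= j *+ 2 + 1) /\
   has (fun e => py e == j *+ 2 + 1) g.
have b2 : bounded_sum f P2 (K ^+ 2 * ((2 * M) * (1 + M))).
  apply: (cut_bounded _ b1 h1M) => g [hw [j [hm hh]]]; exists j.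
  have [hs ho] := hw; have [gn hd] := walk_head hw.
  split=> //; first by rewrite hd.
  move=> p r e q eg hp er _ sb hq hq' eb; split.
    apply: back; first split=> //.
    - by move: ho; rewrite eg; case: (p) hp.
    - by rewrite last_rcons.
    - move=> x; rewrite last_rcons mem_rcons inE => /orP[/eqP ->//|hx].
      have : x \in g by rewrite eg mem_cat hx.
      by move=> /hm; rewrite [py (north r)]/py /= er; clear; lia.
  case: hq' => [->|[sq hdq]]; first by left.
  right; split; first exact: turned_walk.
  by move=> x /mapP[y hy ->]; rewrite py_halfturn eb; move: (hq _ hy); clear; lia.
exists (M + M + K ^+ 2 * ((2 * M) * (1 + M))).
apply: (bounded_sum_sub (P := fun g => (P0 g \/ P1 g) \/ P2 g) _ (lexx _)); last first.
  by apply: bounded_sum_or => //; apply: bounded_sum_or.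
move=> g hw; have [hs ho] := hw; have [gn hd] := walk_head hw.
have [e he hm] := max_level gn.
case ee : e.1.
  right; split=> //; exists e.2.2; split=> [x /hm|].
    by rewrite [py e]/py ee.
  by apply/hasP; exists e; rewrite // /py ee.
left; case: (max_at_end hs he (negbT ee) hm) => e1; last first.
  by right; apply: back; rewrite // -e1 ?ee.
left; exists (map (halfturn 0 0) g); last by rewrite map_halfturnK.
split; first by apply: turned_walk; rewrite // hd.
move=> x /mapP[y /hm hy ->]; rewrite py_halfturn; move: hy; rewrite e1 hd.
have -> : py origin = 0 by [].
by clear; lia.
Qed.
End HammersleyWelsh.

(** * Divergence at the critical point *)

Section Total.
Variables (R : realType) (X : eqType) (f : X -> R).

(* Junk value of [sup] if the sums over [P] are unbounded. *)
Definition total (P : X -> Prop) : R :=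
  sup [set y | exists s, [/\ uniq s, forall x, x \in s -> P x & y = \sum_(x <- s) f x]].

Lemma total_bound P M : bounded_sum f P M -> bounded_sum f P (total P).
Proof.
move=> h s us hs; apply: ub_le_sup; last by exists s.
by exists M => y [t [ut ht ->]]; exact: h.
Qed.

Lemma total_le P M : bounded_sum f P M -> total P <= M.
Proof.
move=> h; apply: ge_sup; first by exists 0, [::]; rewrite big_nil.
by move=> y [t [ut ht ->]]; exact: h.
Qed.

Lemma total_add P Q M : (forall x, P x -> ~ Q x) -> bounded_sum f (fun x => P x \/ Q x) M ->
  total P + total Q <= M.
Proof.
move=> hd h; rewrite -lerBrDr; apply: total_le => s us hs.
rewrite lerBrDr addrC -lerBrDr; apply: total_le => t ut ht.
rewrite lerBrDr addrC -big_cat; apply: h => [|x].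
  rewrite cat_uniq us ut andbT; apply/hasPn => x /ht qx; apply/negP => /hs px.
  exact: hd px qx.
by rewrite mem_cat => /orP[/hs|/ht]; [left|right].
Qed.

Lemma total_sum (P : nat -> X -> Prop) (Q : X -> Prop) M n :
  (forall i j x, P i x -> P j x -> i = j) -> (forall i x, P i x -> Q x) ->
  bounded_sum f Q M -> \sum_(i < n) total (P i) <= M.
Proof.
move=> hd hPQ hQ.
have {hPQ hQ} : bounded_sum f (fun x => exists2 i, (i < n)%N & P i x) M.
  by apply: bounded_sum_sub hQ => // x [i _ /hPQ].
elim: n M => [|n IH] M hM; first by rewrite big_ord0; apply: bounded_sum_ge0 hM.
rewrite big_ord_recr /=.
have hn : bounded_sum f (fun x => exists2 i, (i < n)%N & P i x) M.
  by apply: bounded_sum_sub hM => // x [i hi]; exists i; rewrite // ltnW.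
apply: le_trans (lerD (IH _ (total_bound hn)) (lexx _)) _.
apply: total_add => [x [i hi px] pn|]; first by move: hi; rewrite (hd _ _ _ px pn) ltnn.
apply: bounded_sum_sub hM => // x [[i hi px]|px]; last by exists n.
by exists i; rewrite // ltnW.
Qed.
End Total.

Definition bottom_arc (T : nat) (g : seq edge) : Prop := half_walk T.*2 g /\ ends_bottom g.

Lemma boxed_walks T (s : seq (seq edge)) : (forall g, g \in s -> half_walk T.*2 g) ->
  exists L, forall g, g \in s -> box_walk T L g.
Proof.
move=> hs.
have [L hL] : exists L : nat, forall g, g \in s -> forall e, e \in g -> `|px e| <= L%:Z.
  elim: s {hs} => [|g s [L IH]]; first by exists 0%N.
  have [L' hL'] : exists L' : nat, forall e, e \in g -> `|px e| <= L'%:Z.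
    elim: g => [|e g [L' IH']]; first by exists 0%N.
    exists (L' + absz (px e))%N => x; rewrite inE => /orP[/eqP ->|/IH']; first by clear; lia.
    by clear; lia.
  exists (L + L')%N => x; rewrite inE => /orP[/eqP -> e /hL'|hx e he]; first by clear; lia.
  by have := IH _ hx e he; clear; lia.
exists L => g hg; have [[sg ho] hl] := hs g hg; split=> //.
apply/allP => e he; have := hL g hg e he; have := hl e he; rewrite /in_box.
by move: (px e) (py e); clear => x y; lia.
Qed.

Lemma box_half_walk T L g : box_walk T L g -> half_walk T.*2 g.
Proof.
case=> hs ho /allP hb; split=> // e /hb /and4P[_ _]; move: (py e); clear => y; lia.
Qed.

Lemma bridge_ends T g : bridge T g -> half_walk T.*2 g /\ ends_top T g.
Proof.
case=> h1 h2 h3; split=> //; rewrite /ends_top h2 h3.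
by clear; apply/eqP; lia.
Qed.

Section Critical.
Variables (R : realType) (theta : R).
Hypothesis htheta : pi / 3 <= theta <= 2 * pi / 3.

Let f := wt (weight_u1 theta) (weight_u2 theta) (weight_v theta) (weight_w1 theta) (weight_w2 theta).

Lemma critical_ge0 g : 0 <= f g.
Proof.
have [hu1 hu2 hv] := weights_gt0 htheta; have [hw1 hw2] := double_ge0 htheta.
exact: wt_ge0.
Qed.

Let cA : R := - cos (5 * pi / 8).

Lemma bottom_coefficient : 0 < cA.
Proof. by have [h _ _] := octant_signs R; rewrite oppr_gt0. Qed.

(** The finitely many walks fit into one box, whose lateral terms are nonnegative and are
    dropped. *)
Lemma strip_upper T s t : (0 < T)%N -> uniq s -> (forall g, g \in s -> bottom_arc T g) ->
  uniq t -> (forall g, g \in t -> bridge T g) ->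
  cA * \sum_(g <- s) f g + \sum_(g <- t) f g <= 1.
Proof.
move=> T0 us hs ut ht.
have [L hL] : exists L, forall g, g \in s ++ t -> box_walk T L g.
  by apply: boxed_walks => g; rewrite mem_cat => /orP[/hs[]|/ht/bridge_ends[]].
have [ws [uws hws]] := box_walks T L.
have := box_identity htheta T0 uws hws; rewrite -/cA -/f.
have [k1 k2 k3 k4 [k5 k6 k7]] := angle_signs htheta.
set A := \sum_(g <- ws | ends_bottom g) f g; set B := \sum_(g <- ws | ends_top T g) f g.
set ER := \sum_(g <- ws | _) _; set EL := \sum_(g <- ws | _) _.
have fp : forall g, 0 <= f g := critical_ge0.
have hA : \sum_(g <- s) f g <= A.
  rewrite /A -[leRHS]big_filter; apply: sum_sub => // g hg.
  by rewrite mem_filter; have [_ ->] := hs g hg; apply/hws/hL; rewrite mem_cat hg.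
have hB : \sum_(g <- t) f g <= B.
  rewrite /B -[leRHS]big_filter; apply: sum_sub => // g hg.
  by rewrite mem_filter; have [_ ->] := bridge_ends (ht g hg); apply/hws/hL; rewrite mem_cat hg orbT.
have hR : 0 <= ER by rewrite sumr_ge0.
have hL0 : 0 <= EL by rewrite sumr_ge0.
have cR : 0 <= - cos (3 * theta / 8 + 5 * pi / 8).
  rewrite oppr_ge0 addrC cosD; exact: ltW.
have cL : 0 <= cos (3 * theta / 8) := ltW k1.
have m1 := mulr_ge0 cR hR; have m2 := mulr_ge0 cL hL0.
have m3 := ler_wpM2l (ltW bottom_coefficient) hA.
by move: m1 m2 m3; set x1 := _ * ER; set x2 := _ * EL; move: (cA * _) (cA * _) => y1 y2; lra.
Qed.

Lemma bridge_bounded T : (0 < T)%N -> bounded_sum f (bridge T) 1.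
Proof.
move=> T0 t ut ht; have := @strip_upper T [::] t T0 isT _ ut ht.
by rewrite big_nil mulr0 add0r; apply.
Qed.

Lemma bottom_arc_bounded T : (0 < T)%N -> bounded_sum f (bottom_arc T) cA^-1.
Proof.
move=> T0 s us hs; have := @strip_upper T s [::] T0 us hs isT.
rewrite big_nil addr0 -[cA^-1]mul1r ler_pdivlMr ?bottom_coefficient // mulrC; exact.
Qed.

Lemma strip_le T : (0 < T)%N -> cA * total f (bottom_arc T) + total f (bridge T) <= 1.
Proof.
move=> T0; have c0 := bottom_coefficient.
rewrite addrC -lerBrDr; apply: total_le => t ut ht.
rewrite lerBrDr addrC -lerBrDr mulrC -ler_pdivlMr //; apply: total_le => s us hs.
by rewrite ler_pdivlMr // mulrC lerBrDr (@strip_upper T).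
Qed.

(* The walks that leave the strip through the lateral sides of boxes of different
   widths are distinct, so that their weights cannot stay bounded below. *)
Lemma strip_ge T M : (0 < T)%N -> bounded_sum f walk M ->
  1 <= cA * total f (bottom_arc T) + total f (bridge T).
Proof.
move=> T0 hM; set rhs := leRHS; have fp : forall g, 0 <= f g := critical_ge0.
pose lateral n g := [/\ walk g, (last origin g).1 & px (last origin g) = - (n%:Z *+ 2) \/ px (last origin g) = n%:Z *+ 2 + 2].
have lat_bd n : bounded_sum f (lateral n) M by apply: bounded_sum_sub hM => // g [].
(* The lateral coefficients are at most 1; the factor 2 stands for the two walls. *)
have step n : 1 - rhs <= 2 * total f (lateral n).
  have [ws [uws hws]] := box_walks T n.
  have := box_identity htheta T0 uws hws; rewrite -/cA -/f.
  set A := \sum_(g <- ws | ends_bottom g) f g; set B := \sum_(g <- ws | ends_top T g) f g.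
  set ER := \sum_(g <- ws | _) _; set EL := \sum_(g <- ws | _) _.
  have hA : A <= total f (bottom_arc T).
    rewrite /A -big_filter; apply: (total_bound (bottom_arc_bounded T0)); first by rewrite filter_uniq.
    by move=> g; rewrite mem_filter => /andP[hb /hws/box_half_walk].
  have hB : B <= total f (bridge T).
    rewrite /B -big_filter; apply: (total_bound (bridge_bounded T0)); first by rewrite filter_uniq.
    move=> g; rewrite mem_filter => /andP[/andP[k1 /eqP k2] /hws/box_half_walk h]; split=> //.
    by rewrite k2; clear; lia.
  have hR : ER <= total f (lateral n).
    rewrite /ER -big_filter; apply: (total_bound (lat_bd n)); first by rewrite filter_uniq.
    by move=> g; rewrite mem_filter => /andP[/andP[k1 /eqP k2] /hws[? ? _]]; split=> //; right.
  have hL : EL <= total f (lateral n).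
    rewrite /EL -big_filter; apply: (total_bound (lat_bd n)); first by rewrite filter_uniq.
    by move=> g; rewrite mem_filter => /andP[/andP[k1 /eqP k2] /hws[? ? _]]; split=> //; left.
  have hR0 : 0 <= ER by rewrite sumr_ge0.
  have hL0 : 0 <= EL by rewrite sumr_ge0.
  have cR : - cos (3 * theta / 8 + 5 * pi / 8) <= 1 by rewrite lerNl cos_geN1.
  have cL : cos (3 * theta / 8) <= 1 by rewrite cos_le1.
  have m1 := ler_wpM2r hR0 cR; have m2 := ler_wpM2r hL0 cL.
  have m3 := ler_wpM2l (ltW bottom_coefficient) hA.
  rewrite /rhs; move: hR hL hB m1 m2 m3; set x1 := _ * ER; set x2 := _ * EL.
  by move: (cA * _) (cA * _) (total _ _) (total _ _) => y1 y2 y3 y4; rewrite !mul1r; lra.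
have sum_le n : \sum_(i < n) total f (lateral i) <= M.
  apply: (total_sum (Q := walk)) hM => [i j g [_ _ h1] [_ _ h2]|i g []//].
  by move: h1 h2; clear; lia.
rewrite leNgt; apply/negP => hr.
have d0 : 0 < 1 - rhs by rewrite subr_gt0.
have := sum_le (Num.truncn (2 * M / (1 - rhs))).+1; apply/negP; rewrite -ltNge.
apply: (@lt_le_trans _ _ (\sum_(i < (Num.truncn (2 * M / (1 - rhs))).+1) (1 - rhs) / 2)).
  rewrite sumr_const card_ord -[ltRHS]mulr_natl mulrA ltr_pdivlMr // mulrC -ltr_pdivrMr //.
  exact: truncnS_gt.
by apply: ler_sum => i _; rewrite ler_pdivrMr // mulrC.
Qed.

(** A new arc has highest level 2 T + 1. The cut there gives a bridge of height T + 1 and, because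
    the arc comes back to the bottom, a second part that is a bridge of height T upside down. *)
Lemma arc_growth T : (0 < T)%N -> total f (bottom_arc T.+1) <=
  total f (bottom_arc T) + cut_ratio (weight_u1 theta) (weight_u2 theta) (weight_v theta) ^+ 2
    * ((2 * total f (bridge T.+1)) * total f (bridge T)).
Proof.
move=> T0; apply: total_le.
have [hu1 hu2 hv] := weights_gt0 htheta; have [hw1 hw2] := double_ge0 htheta.
have hd1 := double_w1 htheta; have hd2 := double_w2 htheta.
apply: (bounded_sum_sub (P := fun g => bottom_arc T g \/ (bottom_arc T.+1 g /\ ~ half_walk T.*2 g)) _ (lexx _)).
  move=> g hg; case: (pselect (half_walk T.*2 g)) => h; [left|by right].
  by split=> //; case: hg.
apply: bounded_sum_or; first exact: total_bound (bottom_arc_bounded T0).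
apply: (cut_bounded hu1 hu2 hv hw1 hw2 hd1 hd2 _ (total_bound (bridge_bounded (ltn0Sn T)))
  (total_bound (bridge_bounded T0))) => g [[[hw hl] hbot] hn].
exists T%:Z; have [hs ho] := hw; have [gn hd] := walk_head hw.
have /and3P[_ lh /eqP l0] := hbot.
have [e he hm] := max_level gn.
have he1 : T.*2%:Z < py e.
  rewrite ltNge; apply/negP => h; apply: hn; split=> // x hx.
  by have /andP[-> _] := hl x hx; apply: le_trans (hm x hx) h.
(* Level 2 T + 2 would be attained at an end of the walk, but both ends are at level 0. *)
have he2 : py e = T%:Z *+ 2 + 1.
  case: (boolP e.1) => e1.
    have := hl e he; have := py_type e; move: he1; rewrite e1; clear.
    by move: (py e) => y; lia.
  case: (max_at_end hs he e1 hm) => ee; move: he1; rewrite ee ?l0 // hd.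
  by have -> : py origin = 0 by []; clear; lia.
split=> //; first by rewrite hd.
- by move=> x /hm; rewrite he2.
- by apply/hasP; exists e; rewrite // he2.
move=> p r e' q eg hp er hside sb hq hq' eb; split.
  split; first split.
  - split=> //; move: ho; rewrite eg; by case: (p) hp.
  - move=> x; rewrite mem_rcons inE => /orP[/eqP ->|hx].
      by rewrite /py /= er; clear; lia.
    have : x \in g by rewrite eg mem_cat hx.
    by move=> /hl; clear; lia.
  - by rewrite last_rcons.
  - by rewrite last_rcons /py /= er; clear; lia.
case: hq' => [q0|[sq hdq]].
  by move: lh; rewrite eg q0 last_cat /=; case: hside => ->.
have lq : last origin g = last origin q.
  by rewrite eg last_cat; case: (q) sq => // -[].
have lt : last origin (map (halfturn (beside r e').1 (beside r e').2) q) =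
    halfturn (beside r e').1 (beside r e').2 (last origin g).
  by rewrite lq; case: (q) sq => [[]//|x y] _; rewrite /= last_map.
split; first split; first exact: turned_walk.
- move=> x /mapP[y hy ->]; rewrite py_halfturn eb.
  have : y \in g by rewrite eg mem_cat inE hy !orbT.
  by move=> /hl; move: (hq _ hy); clear; lia.
- by rewrite lt /halfturn (negPf lh).
- by rewrite lt py_halfturn eb l0; clear; lia.
Qed.

Lemma harmonic_unbounded (c M : R) : 0 < c -> ~ forall n, \sum_(i < n) c / i.+1%:R <= M.
Proof.
move=> c0 h; apply: (@dvg_harmonic R); apply: nondecreasing_is_cvgn.
  apply/nondecreasing_seqP => n; rewrite /series /= big_nat_recr //= lerDl /harmonic /= invr_ge0.
  by rewrite ler0n.
exists (M / c) => _ [n _ <-]; rewrite /series /= big_mkord ler_pdivlMr // mulrC mulr_sumr.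
exact: h.
Qed.

Lemma walk_bridge T g : bridge T g -> walk g.
Proof. by case=> -[]. Qed.

Lemma bridge_level T T' g : bridge T g -> bridge T' g -> T = T'.
Proof. by case=> _ _ h [_ _]; rewrite h; clear; lia. Qed.

Lemma saw2 a b r p : piece_ends r p a b -> a != b -> is_saw [:: a; b].
Proof.
move=> h nab; split=> // [|x y|s].
- by rewrite /= inE nab.
- by rewrite inE => /eqP[-> ->]; exists r, p.
- rewrite traceE; apply/admissibleP => q q'.
  rewrite !(joined2E _ _ h) => /andP[_ /eqP ->] /andP[_ /eqP ->].
  by rewrite /compatible eqxx.
Qed.

Lemma bridge1_gt0 : 0 < total f (bridge 1).
Proof.
have [hu1 hu2 hv] := weights_gt0 htheta.
pose g := [:: origin; hedge 0 1].
have h : piece_ends (0, 0) LineSN origin (hedge 0 1) by left.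
have hs : is_saw g by exact: saw2 h _.
have hg : bridge 1 g by split=> //; split=> // e; rewrite !inE => /orP[] /eqP ->.
have := total_bound (bridge_bounded (ltn0Sn 0)) (s := [:: g]) isT.
rewrite big_seq1 => /(_ _)/lt_le_trans; apply; last by move=> x; rewrite inE => /eqP ->.
have c : covers [:: (0, 0)] g.
  split=> // r; rewrite traceE -has_filter => /hasP[p _].
  by rewrite (joined2E _ _ h) => /andP[/eqP -> _]; rewrite inE.
by rewrite /f (wtE _ _ _ _ _ c) big_seq1.
Qed.

(* The strip identities give [B_T - B_(T+1) <= c B_T B_(T+1)] for the total
   weight [B_T] of the bridges, so that [1 / B_T] grows at most linearly and
   the sum of the [B_T] diverges like the harmonic series. *)
Lemma walk_unbounded M : ~ bounded_sum f walk M.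
Proof.
move=> hM; have c0 := bottom_coefficient.
set K := cut_ratio (weight_u1 theta) (weight_u2 theta) (weight_v theta).
pose B T := total f (bridge T.+1); pose A T := total f (bottom_arc T.+1).
have eAB T : cA * A T + B T = 1.
  apply/eqP; rewrite eq_le strip_le //=; exact: strip_ge hM.
pose c := 1 + cA * K ^+ 2 * 2.
have K2 : 0 <= cA * K ^+ 2 * 2 by apply: mulr_ge0 => //; apply: mulr_ge0 (ltW c0) (sqr_ge0 _).
have c1 : 1 <= c by rewrite lerDl.
have rec T : B T <= B T.+1 + c * (B T * B T.+1).
  have bT : 0 <= B T by apply/bounded_sum_ge0/total_bound/bridge_bounded.
  have bT' : 0 <= B T.+1 by apply/bounded_sum_ge0/total_bound/bridge_bounded.
  have := ler_wpM2l (ltW c0) (arc_growth (ltn0Sn T)); rewrite -/(A T) -/(A T.+1) -/(B T) -/(B T.+1) -/K.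
  have := mulr_ge0 bT bT'; rewrite /c mulrDr [(1 + _) * _]mulrDl.
  rewrite (_ : cA * (K ^+ 2 * (2 * B T.+1 * B T)) = cA * K ^+ 2 * 2 * (B T * B T.+1)); last by ring.
  have := eAB T; have := eAB T.+1.
  by move: (_ * (_ * _)) (_ * _) (_ * _) (_ * _) => x1 x2 x3 x4; lra.
have lower T : 0 < B T /\ (B T)^-1 <= (B 0)^-1 + c * T%:R.
  elim: T => [|T [b0 hb]]; first by rewrite mulr0 addr0; split=> //; exact: bridge1_gt0.
  have b1 : 0 < B T.+1.
    have bT' : 0 <= B T.+1 by apply/bounded_sum_ge0/total_bound/bridge_bounded.
    rewrite lt_neqAle bT' andbT eq_sym; apply/negP => /eqP e.
    by have := rec T; rewrite e mulr0 mulr0 addr0 leNgt b0.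
  split=> //; have k : (B T.+1)^-1 <= (B T)^-1 + c.
    rewrite -(ler_pM2r (mulr_gt0 b0 b1)) mulrDl mulrCA mulVf ?gt_eqF // mulr1.
    by rewrite mulrA mulVf ?gt_eqF // mul1r; exact: rec.
  have -> : c * T.+1%:R = c * T%:R + c by rewrite -natr1 mulrDr mulr1.
  by move: (c * T%:R) hb k => y; lra.
(* Chosen so that 1 / B T is at most d (T + 1), for comparison with the harmonic series. *)
pose d := (B 0)^-1 + c.
have d0 : 0 < d by rewrite addr_gt0 ?invr_gt0 //; [have [] := lower 0%N|lra].
apply: (@harmonic_unbounded d^-1 M); first by rewrite invr_gt0.
move=> n; apply: (@le_trans _ _ (\sum_(i < n) total f (bridge i.+1))).
  apply: ler_sum => i _; have [b0 hb] := lower i.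
  rewrite -/(B i) -invfM -[leRHS]invrK lef_pV2 ?posrE ?invr_gt0 // ?mulr_gt0 ?ltr0n //.
  apply: le_trans hb _; rewrite /d -natr1 mulrDr mulr1 [((B 0)^-1 + c) * _]mulrDl.
  have [b1 _] := lower 0%N; have k : 0 <= (B 0)^-1 by rewrite invr_ge0 ltW.
  have := mulr_ge0 k (ler0n R i); move: (_ * i%:R) (c * i%:R) => y1 y2; lra.
apply: (total_sum (P := fun i => bridge i.+1) (Q := walk)) hM => [i j g h1 h2|i g /walk_bridge //].
by case: (bridge_level h1 h2).
Qed.
End Critical.

(** * Lengths *)

(** The factor x^length is absorbed into weights of the same shape, so that all bounds on general
    weights apply again. *)
Lemma scaled_rw (R : realType) (u1 u2 v w1 w2 x : R) (k m : nat) t :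
  rw (u1 * x) (u2 * x ^+ k) (v * x ^+ m) (w1 * x ^+ 2) (w2 * x ^+ (k + k)) t =
  rw u1 u2 v w1 w2 t * x ^+ (\sum_(p <- t) piece_length k m p)%N.
Proof.
rewrite /rw; case: t => [|p [|p' [|p'' t]]].
- by rewrite big_nil mulr1.
- by rewrite big_seq1; case: p; rewrite /= ?expr1.
- by rewrite big_cons big_seq1; case: p; case: p'; rewrite /= ?mul0r.
- by case: p; case: p'; rewrite /= mul0r.
Qed.

Lemma scaled_wt (R : realType) (u1 u2 v w1 w2 x : R) (k m : nat) g :
  wt (u1 * x) (u2 * x ^+ k) (v * x ^+ m) (w1 * x ^+ 2) (w2 * x ^+ (k + k)) g =
  wt u1 u2 v w1 w2 g * x ^+ walk_length k m g.
Proof.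
have c := visited_covers g.
rewrite !(wtE _ _ _ _ _ c) (walk_lengthE _ _ c) -prodrXr -big_split /=.
by apply: eq_bigr => r _; rewrite scaled_rw.
Qed.

Lemma ends_neq r p : (ends r p).1 != (ends r p).2.
Proof. by have /and3P[] := ends_shared r p. Qed.

Lemma joined_apart p a q ab : uniq (p ++ a :: q) -> ab.1 != ab.2 ->
  ~~ (joined (rcons p a) ab && joined (a :: q) ab).
Proof.
case: ab => x y; rewrite cat_uniq => /and3P[_ /hasPn h ua] /= nxy.
apply/negP => /andP[/joined_in[x1 y1] /joined_in[x2 y2]].
have only z : z \in rcons p a -> z \in a :: q -> z = a.
  move=> + /h /negP hz; rewrite mem_rcons inE => /orP[/eqP //|hp].
  by case: hz.
by move: nxy; rewrite (only x) // (only y) // eqxx.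
Qed.

Section Length.
Variables k m : nat.
Let len := walk_length k m.

(** The length is a sum over pieces and each piece belongs to one part; unlike the weight, it does
    not see two arcs meeting in a rhombus. *)
Lemma length_cat p a q : uniq (p ++ a :: q) -> len (p ++ a :: q) = (len (rcons p a) + len (a :: q))%N.
Proof.
move=> u; have [rs hrs] := covers_all [:: p ++ a :: q; rcons p a; a :: q].
have c1 : covers rs (p ++ a :: q) by apply: hrs; rewrite !inE eqxx.
have c2 : covers rs (rcons p a) by apply: hrs; rewrite !inE eqxx ?orbT.
have c3 : covers rs (a :: q) by apply: hrs; rewrite !inE eqxx ?orbT.
rewrite /len (walk_lengthE _ _ c1) (walk_lengthE _ _ c2) (walk_lengthE _ _ c3) -big_split /=.
apply: eq_bigr => r _; rewrite !traceE !selected_length.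
have E s : (joined (p ++ a :: q) (ends r s) : nat) =
    (joined (rcons p a) (ends r s) + joined (a :: q) (ends r s))%N.
  rewrite joined_cat; have := joined_apart u (ends_neq r s).
  by case: (joined (rcons p a) _); case: (joined (a :: q) _).
by rewrite !E; ring.
Qed.

Lemma covers2 a b r p : piece_ends r p a b -> covers [:: r] [:: a; b].
Proof.
move=> h; split=> // s; rewrite traceE -has_filter => /hasP[t _].
by rewrite (joined2E _ _ h) => /andP[/eqP -> _]; rewrite mem_head.
Qed.

Lemma trace2 a b r p : piece_ends r p a b -> trace [:: a; b] r = [:: p].
Proof.
move=> h; rewrite traceE -selected1; apply: eq_selected => t.
by rewrite (joined2E _ _ h) eqxx.
Qed.

Lemma length2 a b r p : piece_ends r p a b -> len [:: a; b] = piece_length k m p.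
Proof. by move=> h; rewrite /len (walk_lengthE _ _ (covers2 h)) big_seq1 (trace2 h) big_seq1. Qed.

Hypotheses (hk : (0 < k)%N) (hm : (0 < m)%N).

Lemma size_length g : is_saw g -> (size g <= (len g).+1)%N.
Proof.
elim: g => [|a [|b g] IH] // hs.
have hst : (a, b) \in steps [:: a, b & g] by rewrite steps_cons mem_head.
have /sharedP[p hp] := saw_face hs hst.
rewrite (@length_cat [:: a] b g); last by case: hs.
rewrite (length2 hp) -[size _]/(1 + size (b :: g))%N -addnS leq_add //; first by case: (p).
by apply: IH; apply: (@saw_suffix [:: a]).
Qed.
End Length.

Lemma step_bound r a b : shared r (a, b) -> `|px a - px b| <= 2 /\ `|py a - py b| <= 2.
Proof.
move=> /and3P[/= + + _]; rewrite !inE => /or4P[] /eqP -> /or4P[] /eqP ->; rewrite /px /py /=; lia.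
Qed.

Lemma saw_bound g a e : is_saw (a :: g) -> e \in a :: g ->
  `|px a - px e| <= (size g).*2%:Z /\ `|py a - py e| <= (size g).*2%:Z.
Proof.
elim: g a => [|b g IH] a hs; first by rewrite inE => /eqP ->; rewrite !subrr.
rewrite inE => /orP[/eqP ->|he]; first by rewrite !subrr.
have hst : (a, b) \in steps [:: a, b & g] by rewrite steps_cons mem_head.
have [h1 h2] := step_bound (saw_face hs hst).
have [h3 h4] := IH b (@saw_suffix [:: a] (b :: g) isT hs) he.
by move: h1 h2 h3 h4; clear; rewrite /=; split; lia.
Qed.

(** A piece climbs at most one row and has length at least 1. *)
Lemma bridge_length k m T g : (0 < k)%N -> (0 < m)%N -> bridge T g -> (T <= walk_length k m g)%N.
Proof.
move=> hk hm [[[hs ho] _] _ hl]; have := size_length hk hm hs.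
case: g hs ho hl => // a g hs [ea] hl; subst a.
have [_] := saw_bound hs (mem_last _ _); rewrite hl.
have -> : py origin = 0 by [].
by clear; rewrite /=; lia.
Qed.

Lemma saws_list k m n : (0 < k)%N -> (0 < m)%N ->
  exists ws, uniq ws /\ forall g, g \in ws <-> saws_from k m origin n g.
Proof.
move=> hk hm; apply: (@enumerate _ (n.*2 + 1) n.+1) => g [hs ho hl].
have := size_length hk hm hs; rewrite hl; case: g hs ho hl => // a g hs [ea] hl; subst a => sz.
split=> // e he; have [] := saw_bound hs he.
have -> : py origin = 0 by []. have -> : px origin = 1 by [].
by move: sz; clear; rewrite /= !sub0r; split; lia.
Qed.

(** * Concatenation of bridges *)

Definition glue (g h : seq edge) : seq edge :=
  g ++ behead (map (shift (last origin g).2.1 (last origin g).2.2) h).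

Lemma py_shift a b e : py (shift a b e) = py e + b *+ 2.
Proof. by case: e => [[] [i j]]; rewrite /py /=; lia. Qed.

Lemma shift_origin a b : shift a b origin = hedge a b.
Proof. by rewrite /shift /= !add0r. Qed.

Lemma joined_below g r p (j : int) : (forall e, e \in g -> py e <= j *+ 2) ->
  joined g (ends r p) -> r.2 < j.
Proof.
move=> h; case e : (ends r p) => [a b] /joined_in[/h h1 /h h2].
by move: e h1 h2; case: p => -[<- <-]; rewrite /py /=; clear; lia.
Qed.

Lemma joined_above g r p (j : int) : (forall e, e \in g -> j *+ 2 <= py e) ->
  joined g (ends r p) -> j <= r.2.
Proof.
move=> h; case e : (ends r p) => [a b] /joined_in[/h h1 /h h2].
by move: e h1 h2; case: p => -[<- <-]; rewrite /py /=; clear; lia.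
Qed.

Section Glue.
Variables (T : nat) (g h : seq edge).
Hypotheses (hg : bridge T.+1 g) (hh : upper_walk h).

Let z := last origin g.
Let j := z.2.2.

Let j_level : py z = j *+ 2 /\ j = T.+1%:Z.
Proof.
case: hg => _; rewrite -/z /j; case: (z) => [[] [a b]] //= _.
by rewrite /py /=; clear; lia.
Qed.

Lemma glueE : exists p q, [/\ g = rcons p z,
  map (shift z.2.1 z.2.2) h = z :: q & glue g h = p ++ z :: q].
Proof.
have [[hw _] nz _] := hg; have [gn _] := walk_head hw; rewrite /z in nz *.
case/lastP: (g) gn nz => // p y _; rewrite last_rcons => ny.
case: hh => -[hs ho] _; case: (h) ho => // a q [->]; exists p, (map (shift y.2.1 y.2.2) q).
have ey : shift y.2.1 y.2.2 origin = y by rewrite shift_origin; case: (y) ny => [[] [? ?]].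
split=> //; first by rewrite /= ey.
by rewrite /glue last_rcons /= cat_rcons.
Qed.

Let below e : e \in g -> py e <= j *+ 2.
Proof. by case: hg => -[_ hl] _ _ /hl; have [_ ->] := j_level; clear; lia. Qed.

Let above e : e \in map (shift z.2.1 z.2.2) h -> j *+ 2 <= py e.
Proof. by move=> /mapP[x hx ->]; rewrite py_shift lerDr; case: hh => _; apply. Qed.

Let shifted_saw : is_saw (map (shift z.2.1 z.2.2) h).
Proof. by apply: saw_map; [exact: shift_symmetry|case: hh => -[]]. Qed.

(** The two walks use different rows of rhombi. A common midpoint other than [z] would be a
    horizontal edge at the top level of the bridge, hence an end by [max_at_end], and the first edge
    is lower. *)
Lemma glue_saw : is_saw (glue g h).
Proof.
have [p [q [eg eh ->]]] := glueE; have [[[hs ho] hl] nz _] := hg.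
have hs2 := shifted_saw; rewrite eh in hs2.
have [_ ug _ _] := hs; have [_ uh _ _] := hs2.
have jE ab : joined (p ++ z :: q) ab = joined g ab || joined (z :: q) ab by rewrite joined_cat -eg.
split.
- by case: (p).
- have np : z \notin p by move: ug; rewrite eg rcons_uniq => /andP[].
  rewrite cat_uniq uh andbT; move: ug; rewrite eg rcons_uniq => /andP[_ ->]; rewrite andTb.
  apply/hasPn => x hx; apply/negP => hp.
  have xg : x \in g by rewrite eg mem_rcons inE hp orbT.
  have hx' : py x = j *+ 2.
    by apply/eqP; rewrite eq_le below //= above // eh.
  have nx : ~~ x.1 by rewrite -py_type hx'; clear; lia.
  have hm e : e \in g -> py e <= py x by rewrite hx'; exact: below.
  case: (max_at_end hs xg nx hm) => ex; last by rewrite ex -/z in hp; rewrite hp in np.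
  have [_ hd] := walk_head (conj hs ho).
  have [_ ej] := j_level; move: hx'; rewrite ex hd ej.
  have -> : py origin = 0 by [].
  by clear; lia.
- move=> a b; rewrite steps_cat mem_cat -eg => /orP[].
    by case: hs => _ _ k _; exact: k.
  by case: hs2 => _ _ k _; exact: k.
- move=> r; rewrite traceE; apply/admissibleP => s s'; rewrite !jE.
  have bl t : joined g (ends r t) -> r.2 < j by apply: joined_below below.
  have ab t : joined (z :: q) (ends r t) -> j <= r.2.
    by rewrite -eh; apply: joined_above above.
  move=> /orP[]k1 /orP[]k2.
  + exact: saw_compatible hs k1 k2.
  + by have := bl _ k1; rewrite ltNge (ab _ k2).
  + by have := bl _ k2; rewrite ltNge (ab _ k1).
  + exact: saw_compatible hs2 k1 k2.
Qed.

Lemma glue_wt (R : realType) (u1 u2 v w1 w2 : R) :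
  wt u1 u2 v w1 w2 (glue g h) = wt u1 u2 v w1 w2 g * wt u1 u2 v w1 w2 h.
Proof.
have [p [q [eg eh ->]]] := glueE.
rewrite -(wt_map (shift_symmetry z.2.1 z.2.2) _ _ _ _ _ h).
have [rs hrs] := covers_all [:: p ++ z :: q; g; map (shift z.2.1 z.2.2) h].
have c1 : covers rs (p ++ z :: q) by apply: hrs; rewrite !inE eqxx.
have c2 : covers rs g by apply: hrs; rewrite !inE eqxx ?orbT.
have c3 : covers rs (map (shift z.2.1 z.2.2) h) by apply: hrs; rewrite !inE eqxx ?orbT.
rewrite (wtE _ _ _ _ _ c1) (wtE _ _ _ _ _ c2) (wtE _ _ _ _ _ c3) -big_split /=.
apply: eq_bigr => r _; rewrite eh.
have jE ab : joined (p ++ z :: q) ab = joined g ab || joined (z :: q) ab by rewrite joined_cat -eg.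
have none k : (forall t, joined k (ends r t) = false) -> trace k r = [::].
  by move=> hn; rewrite traceE (eq_selected hn).
case: (ltrP r.2 j) => hr.
  have n t : joined (z :: q) (ends r t) = false.
    apply/negP; rewrite -eh => /(joined_above above); by rewrite leNgt hr.
  rewrite (none _ n) mulr1; congr rw; rewrite !traceE; apply: eq_selected => t.
  by rewrite jE n orbF.
have n t : joined g (ends r t) = false.
  apply/negP => /(joined_below below); by rewrite ltNge hr.
rewrite (none _ n) mul1r; congr rw; rewrite !traceE; apply: eq_selected => t.
by rewrite jE n.
Qed.

Lemma glue_length k m : walk_length k m (glue g h) = (walk_length k m g + walk_length k m h)%N.
Proof.
have [p [q [eg eh eg']]] := glueE; have [_ u _ _] := glue_saw; rewrite eg' in u *.
by rewrite length_cat // -eg -eh walk_length_map //; exact: shift_symmetry.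
Qed.

Lemma glue_walk : walk (glue g h).
Proof.
split; first exact: glue_saw.
by have [[[_ ho] _] _ _] := hg; move: ho; rewrite /glue; case: (g).
Qed.

Lemma glue_bridge T' : bridge T' h -> bridge (T + T').+1 (glue g h).
Proof.
move=> [[_ hl] nl ll]; have [_ ej] := j_level.
have elast : last origin (glue g h) = shift z.2.1 z.2.2 (last origin h).
  have [p [q [eg eh ->]]] := glueE; rewrite last_cat.
  rewrite -[RHS](last_map (shift z.2.1 z.2.2)) eh /=.
  by [].
split; first split; first exact: glue_walk.
- move=> e; rewrite /glue mem_cat => /orP[he|/mem_behead /mapP[x /hl hx ->]].
    by case: hg => -[_ /(_ e he)] + _ _; clear; lia.
  by move: hx; rewrite py_shift -/z -/j ej; clear; lia.
- by rewrite elast.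
- by rewrite elast py_shift ll -/j ej; clear; lia.
Qed.
End Glue.

(** Of two bridges that begin the same walk one is a prefix of the other, and a proper prefix has
    smaller length. *)
Lemma glue_inj k m T T' g g' h h' : (0 < k)%N -> (0 < m)%N ->
  bridge T.+1 g -> bridge T'.+1 g' -> upper_walk h -> upper_walk h' ->
  walk_length k m g = walk_length k m g' -> glue g h = glue g' h' -> g = g' /\ h = h'.
Proof.
move=> hk hm.
wlog: T T' g g' h h' / (size g <= size g')%N.
  move=> W; case: (leqP (size g) (size g')) => s hg hg' hh hh' el e; first exact: (W T T').
  by have [-> ->] := W T' T g' g h' h (ltnW s) hg' hg hh' hh (esym el) (esym e).
move=> sz hg hg' hh hh' el e.
have [p [q [eg eh eq1]]] := glueE hg hh; have [p' [q' [eg' eh' eq2]]] := glueE hg' hh'.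
have eg'' : g' = g ++ drop (size g) g'.
  rewrite -[LHS](cat_take_drop (size g)); congr (_ ++ _).
  have : take (size g) (glue g h) = g by rewrite /glue take_size_cat.
  by rewrite e /glue takel_cat.
have d0 : drop (size g) g' = [::].
  set d := drop _ _ in eg'' *; have [[[hs' _] _] _ _] := hg'; have [_ u _ _] := hs'.
  have ed : g' = p ++ last origin g :: d by rewrite -cat_rcons -eg.
  rewrite ed in hs' u; move/eqP: el; rewrite ed length_cat // -eg -[X in X == _]addn0 eqn_add2l eq_sym => /eqP l0.
  by have := size_length hk hm (@saw_suffix p (_ :: d) isT hs'); rewrite l0; case: (d).
have egg : g = g' by rewrite eg'' d0 cats0.
split=> //; subst g'.
have heads x : upper_walk x -> x = origin :: behead x by case=> -[_ +] _; case: x => // a x [->].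
rewrite (heads _ hh) (heads _ hh'); congr cons.
move/eqP: e; rewrite /glue eqseq_cat // eqxx andTb !behead_map => /eqP.
apply: inj_map; by case: (shift_symmetry (last origin g).2.1 (last origin g).2.2).
Qed.

(** * Exponential growth *)

Lemma geometric_le (R : realType) (z : R) n : 0 < z < 1 -> \sum_(i < n) z ^+ i <= (1 - z)^-1.
Proof.
move=> /andP[z0 z1]; have d0 : 0 < 1 - z by rewrite subr_gt0.
rewrite -[leRHS]mul1r ler_pdivlMr // mulrC -[1 - z]opprB mulNr -subrX1 opprB.
by rewrite gerBl exprn_ge0 // ltW.
Qed.

Lemma total_list (R : realType) (X : eqType) (f : X -> R) (P : X -> Prop) ws :
  (forall x, 0 <= f x) -> uniq ws -> (forall x, x \in ws <-> P x) -> total f P = \sum_(x <- ws) f x.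
Proof.
move=> f0 u h.
have hb : bounded_sum f P (\sum_(x <- ws) f x).
  by move=> s us hs; apply: sum_sub => // x /hs /h.
by apply/eqP; rewrite eq_le total_le //= (total_bound hb) // => x /h.
Qed.

Lemma upper_half_walk T g : half_walk T g -> upper_walk g.
Proof. by case=> hw hl; split=> // e /hl /andP[]. Qed.

Section Growth.
Variables (R : realType) (theta : R).
Hypothesis htheta : pi / 3 <= theta <= 2 * pi / 3.
Variables k m : nat.
Hypotheses (hk : (0 < k)%N) (hm : (0 < m)%N).

Let u1 := weight_u1 theta.
Let f := wt u1 (weight_u2 theta) (weight_v theta) (weight_w1 theta) (weight_w2 theta).
Let len := walk_length k m.

Let fp g : 0 <= f g. Proof. exact: (critical_ge0 htheta). Qed.

Definition total_weight (n : nat) : R := total f (saws_from k m origin n).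

Lemma total_weight_bounded n : bounded_sum f (saws_from k m origin n) (total_weight n).
Proof.
have [ws [uws hws]] := saws_list n hk hm.
rewrite /total_weight (total_list fp uws hws) => s us hs.
by apply: sum_sub => // x /hs /hws.
Qed.

Lemma fsbig_total_weight n : \sum_(g \in saws_from k m origin n) f g = total_weight n.
Proof.
have [ws [uws hws]] := saws_list n hk hm.
rewrite /total_weight (total_list fp uws hws) (fsbigE ws) //.
- by rewrite big_seq_cond [RHS]big_seq_cond; apply: eq_bigl => g; rewrite andbT;
    apply/andP/idP => [[]//|h]; split=> //; apply/mem_set/hws.
- by move=> g /= /hws.
- by move=> g /hws -> .
Qed.

Lemma scaled_bounded (x : R) (beta : nat -> R) (S : R) : 0 < x -> x <= 1 ->
  (forall i, bounded_sum (fun g => f g * x ^+ len g) (bridge i.+1) (beta i)) ->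
  (forall T, \sum_(i < T) beta i <= S) ->
  exists N, bounded_sum (fun g => f g * x ^+ len g) walk N.
Proof.
move=> x0 x1 hb hS.
have [hu1 hu2 hv] := weights_gt0 htheta; have [hw1 hw2] := double_ge0 htheta.
have hd1 := double_w1 htheta; have hd2 := double_w2 htheta.
pose F := wt (u1 * x) (weight_u2 theta * x ^+ k) (weight_v theta * x ^+ m)
  (weight_w1 theta * x ^+ 2) (weight_w2 theta * x ^+ (k + k)).
have eF : (fun g => f g * x ^+ len g) = F by apply/funext => g; rewrite /F scaled_wt.
rewrite eF in hb *.
have h1 : 0 < u1 * x by rewrite mulr_gt0.
have h2 : 0 < weight_u2 theta * x ^+ k by rewrite mulr_gt0 ?exprn_gt0.
have h3 : 0 < weight_v theta * x ^+ m by rewrite mulr_gt0 ?exprn_gt0.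
have h4 : 0 <= weight_w1 theta * x ^+ 2 by rewrite mulr_ge0 // exprn_ge0 // ltW.
have h5 : 0 <= weight_w2 theta * x ^+ (k + k) by rewrite mulr_ge0 // exprn_ge0 // ltW.
have h6 : weight_w1 theta * x ^+ 2 <= (u1 * x) * (u1 * x).
  by rewrite [leRHS]mulrACA -[x * x]expr2 ler_wpM2r // exprn_ge0 // ltW.
have h7 : weight_w2 theta * x ^+ (k + k) <= (weight_u2 theta * x ^+ k) * (weight_u2 theta * x ^+ k).
  by rewrite [leRHS]mulrACA -exprD ler_wpM2r // exprn_ge0 // ltW.
apply: (walk_bounded h1 h2 h3 h4 h5 h6 h7).
exact: (upper_walk_bounded h1 h2 h3 h4 h5 h6 h7 hb hS).
Qed.

Lemma total_weight_upper (x : R) : 0 < x < 1 -> exists N, forall n, total_weight n * x ^+ n <= N.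
Proof.
move=> /andP[x0 x1].
have hb i : bounded_sum (fun g => f g * x ^+ len g) (bridge i.+1) (x ^+ i).
  move=> s us hs; rewrite -[leRHS]mul1r.
  apply: (@le_trans _ _ (\sum_(g <- s) f g * x ^+ i)).
    rewrite big_seq [leRHS]big_seq; apply: ler_sum => g hg; rewrite ler_wpM2l //.
    apply: ler_wiXn2l; [exact: ltW|exact: ltW|].
    exact: ltnW (bridge_length hk hm (hs g hg)).
  rewrite -mulr_suml ler_wpM2r //; first by rewrite exprn_ge0 // ltW.
  exact: (bridge_bounded htheta (ltn0Sn i) us hs).
have x01 : 0 < x < 1 by apply/andP.
have [N hN] := scaled_bounded x0 (ltW x1) hb (fun T => geometric_le T x01).
exists N => n; rewrite -ler_pdivlMr ?exprn_gt0 //; apply: total_le => s us hs.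
rewrite ler_pdivlMr ?exprn_gt0 // mulr_suml.
rewrite big_seq (eq_bigr (fun g => f g * x ^+ len g)); last first.
  by move=> g /hs[_ _ <-].
by rewrite -big_seq; apply: hN => // g /hs[].
Qed.

(** The height is positive, as required for gluing. *)
Definition bridge_of_length (n : nat) (g : seq edge) : Prop :=
  (exists T, bridge T.+1 g) /\ len g = n.

Definition bridge_weight (n : nat) : R := total f (bridge_of_length n).

Lemma bridge_of_length_saw n g : bridge_of_length n g -> saws_from k m origin n g.
Proof. by case=> [[T [[[hs ho] _] _ _]] hl]; split. Qed.

Lemma bridge_weight_bounded n : bounded_sum f (bridge_of_length n) (bridge_weight n).
Proof.
apply: (total_bound (M := total_weight n)); apply: (bounded_sum_sub _ (lexx _) (@total_weight_bounded n)).
exact: bridge_of_length_saw.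
Qed.

Lemma bridge_weight_ge0 n : 0 <= bridge_weight n.
Proof. exact: bounded_sum_ge0 (@bridge_weight_bounded n). Qed.

Lemma bridge_weight_le n : bridge_weight n <= total_weight n.
Proof.
apply: total_le; apply: (bounded_sum_sub _ (lexx _) (@total_weight_bounded n)).
exact: bridge_of_length_saw.
Qed.

Lemma bridges_list n : exists ws, uniq ws /\ forall g, g \in ws <-> bridge_of_length n g.
Proof.
have [ws [uws hws]] := saws_list n hk hm.
exists [seq g <- ws | `[< bridge_of_length n g >]]; split; first by rewrite filter_uniq.
move=> g; rewrite mem_filter; split=> [/andP[/asboolP]//|h].
by apply/andP; split; [exact/asboolP|exact/hws/bridge_of_length_saw].
Qed.

(** For bridges of one fixed length gluing is injective and multiplies weights, so the product of
    the sums is a sum over distinct walks. *)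
Lemma glue_sum n (t : seq (seq edge)) (P : seq edge -> Prop) M : uniq t ->
  (forall h, h \in t -> upper_walk h) ->
  (forall g h, bridge_of_length n g -> h \in t -> P (glue g h)) -> bounded_sum f P M ->
  bridge_weight n * (\sum_(h <- t) f h) <= M.
Proof.
move=> ut ht hP hM; have [s [us hs]] := bridges_list n.
rewrite /bridge_weight (total_list fp us hs) big_distrlr /=.
rewrite (_ : \sum_(i <- s) _ = \sum_(x <- [seq glue g h | g <- s, h <- t]) f x); last first.
  rewrite big_allpairs_dep /= big_seq [RHS]big_seq; apply: eq_bigr => g /hs[[T hg] _].
  rewrite big_seq [RHS]big_seq; apply: eq_bigr => h hh.
  by rewrite /f (glue_wt hg (ht h hh)).
apply: hM; last by move=> x /allpairsP[[g h] /= [/hs hg hh ->]]; exact: hP.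
apply: allpairs_uniq => // -[g h] [g' h'] /allpairsP[[a b] /= [/hs[[T1 h1] l1] h2 [-> ->]]].
move=> /allpairsP[[c d] /= [/hs[[T3 h3] l3] h4 [-> ->]]] /= e.
have el : walk_length k m a = walk_length k m c by rewrite -/(len a) l1 -l3.
by have [-> ->] := glue_inj hk hm h1 h3 (ht _ h2) (ht _ h4) el e.
Qed.

Lemma bridge_weight_mul n n' : bridge_weight n * bridge_weight n' <= bridge_weight (n + n').
Proof.
have [t [ut ht]] := bridges_list n'.
rewrite [bridge_weight n']/bridge_weight (total_list fp ut ht).
apply: (glue_sum ut _ _ (@bridge_weight_bounded _)).
  by move=> h /ht[[T [hl _ _]] _]; exact: upper_half_walk hl.
move=> g h [[T hg] el] /ht[[T' hh] el'].
have hu : upper_walk h by case: hh => hl _ _; exact: upper_half_walk hl.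
split; first by exists (T + T'.+1)%N; exact: glue_bridge.
by rewrite /len (glue_length hg hu) -/(len g) -/(len h) el el'.
Qed.

(** One arc of angle theta, of length 1 whatever k and m: it passes from even to odd lengths. *)
Let tick : seq edge := [:: origin; vedge 0 0].

Let tick_ends : piece_ends (0, 0) ArcSW origin (vedge 0 0).
Proof. by left. Qed.

Lemma tick_walk : [/\ upper_walk tick, len tick = 1%N & f tick = u1].
Proof.
have hs : is_saw tick by exact: saw2 tick_ends _.
split; first by split=> // e; rewrite !inE => /orP[] /eqP ->.
- by rewrite /len (length2 _ _ tick_ends).
- by rewrite /f (wtE _ _ _ _ _ (covers2 tick_ends)) big_seq1.
Qed.

Lemma total_weight_succ n : bridge_weight n * u1 <= total_weight n.+1.
Proof.
have [ht lt ft] := tick_walk; rewrite -ft -(big_seq1 +%R tick f).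
apply: (glue_sum _ _ _ (@total_weight_bounded _)) => //.
  by move=> h; rewrite inE => /eqP ->.
move=> g h [[T hg] el]; rewrite inE => /eqP ->.
have [hs ho] := glue_walk hg ht; split=> //.
by rewrite (glue_length hg ht) -/(len g) -/(len tick) el lt addn1.
Qed.

(** Two arcs of angle theta climb one row, with length 2 for all k and m. *)
Lemma bridge_weight2 : 0 < bridge_weight 2.
Proof.
have [hu1 hu2 hv] := weights_gt0 htheta.
have h2 : piece_ends (-1, 0) ArcNE (vedge 0 0) (hedge (-1) 1) by right.
pose g := rcons (rcons [:: origin] (vedge 0 0)) (hedge (-1) 1).
have hs : is_saw g.
  by apply: (saw_rcons _ _ h2); [exact: saw2 tick_ends _|..].
have hg : bridge_of_length 2 g.
  split; last first.
    have [_ ug _ _] := hs.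
    by rewrite /len (@length_cat k m [:: origin] _ [:: hedge (-1) 1]) // (length2 _ _ tick_ends) (length2 _ _ h2).
  by exists 0%N; split=> //; split=> // e; rewrite !inE => /or3P[] /eqP ->.
have := @bridge_weight_bounded 2 [:: g] isT.
rewrite big_seq1 => /(_ _)/lt_le_trans; apply; last by move=> x; rewrite inE => /eqP ->.
have c : covers [:: (0, 0); (-1, 0)] g.
  split=> // r; rewrite traceE -has_filter => /hasP[p _].
  by rewrite joined_rcons (joined2E _ _ tick_ends) (joined2E _ _ h2) => /orP[] /andP[/eqP -> _].
by rewrite /f (wtE _ _ _ _ _ c) big_cons big_seq1 mulr_gt0.
Qed.
End Growth.

Section LowerBound.
Variables (R : realType) (theta : R).
Hypothesis htheta : pi / 3 <= theta <= 2 * pi / 3.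
Variables k m : nat.
Hypotheses (hk : (0 < k)%N) (hm : (0 < m)%N).

Let f := wt (weight_u1 theta) (weight_u2 theta) (weight_v theta) (weight_w1 theta) (weight_w2 theta).
Let len := walk_length k m.
Let b := bridge_weight theta k m.

(** Bridges are sorted by length, which is at least their height, and a geometric tail is summed. *)
Lemma bridge_tail (z : R) T : 0 < z < 1 -> (forall n, (0 < n)%N -> b n <= z ^+ n) ->
  bounded_sum f (bridge T.+1) (z ^+ T * (1 - z)^-1).
Proof.
move=> hz hb; have /andP[z0 z1] := hz.
have main N s : uniq s -> (forall g, g \in s -> bridge T.+1 g /\ (len g < T.+1 + N)%N) ->
    \sum_(g <- s) f g <= \sum_(i < N) z ^+ (T + i).
  elim: N s => [|N IH] s us hs.
    rewrite big_ord0 big_seq big1 // => g /hs[hg].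
    by rewrite addn0 ltnNge (bridge_length hk hm hg).
  rewrite big_ord_recr /= (bigID (fun g => len g == (T.+1 + N)%N)) /= addrC.
  rewrite -[X in X + _]big_filter -[X in _ + X]big_filter; apply: lerD.
    apply: IH; first by rewrite filter_uniq.
    move=> g; rewrite mem_filter => /andP[ne /hs[hg hl]]; split=> //.
    by rewrite ltn_neqAle ne -ltnS -addnS.
  apply: (@le_trans _ _ (b (T.+1 + N))).
    apply: (bridge_weight_bounded htheta hk hm); first by rewrite filter_uniq.
    move=> g; rewrite mem_filter => /andP[/eqP hl /hs[hg _]]; split=> //; by exists T.
  apply: le_trans (hb _ _) _ => //; rewrite addSn exprS ger_pMl ?exprn_gt0 //; exact: ltW.
move=> s us hs.
have [N hN] : exists N, forall g, g \in s -> (len g < N)%N.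
  exists (\max_(g <- s) len g).+1 => g hg; rewrite ltnS.
  by rewrite (big_rem g) //= leq_maxl.
apply: le_trans (main N s us _) _.
  by move=> g hg; split; [exact: hs|rewrite (leq_trans (hN g hg)) // leq_addl].
rewrite (eq_bigr (fun i : 'I_N => z ^+ T * z ^+ i)); last by move=> i _; rewrite exprD.
by rewrite -mulr_sumr ler_wpM2l ?geometric_le // exprn_ge0 // ltW.
Qed.

(* Otherwise the bridges of length n would weigh at most [y ^ (n / 2)] by
   supermultiplicativity, and the walks would be summable. *)
Lemma heavy_bridges (y : R) : 0 < y < 1 -> exists2 N, (0 < N)%N & y ^+ N <= b (N + N).
Proof.
move=> /andP[y0 y1]; apply: contrapT => hn.
have light N : (0 < N)%N -> b (N + N) < y ^+ N.
  by move=> N0; rewrite ltNge; apply/negP => h; apply: hn; exists N.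
pose z := Num.sqrt y.
have zz : z * z = y by rewrite -expr2 sqr_sqrtr // ltW.
have z0 : 0 < z by rewrite sqrtr_gt0.
have z1 : z < 1 by rewrite -[ltRHS]sqrtr1 ltr_sqrt.
have hz : 0 < z < 1 by rewrite z0.
have hb n : (0 < n)%N -> b n <= z ^+ n.
  move=> n0; rewrite -(@ler_pXn2r _ 2) ?nnegrE ?exprn_ge0 ?(ltW z0) //; last first.
    exact: (bridge_weight_ge0 htheta hk hm).
  rewrite !expr2 -exprMn zz; apply: le_trans (ltW (light n n0)).
  exact: (bridge_weight_mul htheta hk hm).
have d0 : 0 <= (1 - z)^-1 by rewrite invr_ge0 subr_ge0 ltW.
have [||N hN] := @scaled_bounded _ _ htheta k m 1 (fun i => z ^+ i * (1 - z)^-1)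
    ((1 - z)^-1 * (1 - z)^-1) ltr01 (lexx _).
- move=> i s us hs; rewrite (eq_bigr f); first exact: (@bridge_tail z i hz hb s us hs).
  by move=> g _; rewrite expr1n mulr1.
- by move=> T; rewrite -mulr_suml ler_wpM2r // geometric_le.
apply: (walk_unbounded htheta (M := N)) => s us hs.
by rewrite (eq_bigr (fun g => f g * 1 ^+ len g)) ?hN // => g _; rewrite expr1n mulr1.
Qed.

(** One heavy length 2 N suffices: its multiples follow by gluing, the other even lengths by adding
    bridges of length 2, the odd ones by adding [tick]. *)
Lemma total_weight_lower (y : R) : 0 < y < 1 ->
  exists2 c, 0 < c & exists N, forall n, (N <= n)%N -> c * y ^+ n <= total_weight theta k m n.
Proof.
move=> hy; have /andP[y0 y1] := hy; have [hu1 _ _] := weights_gt0 htheta.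
have [N N0 hN] := heavy_bridges hy; pose e j := b (j + j).
have eM i j : e i * e j <= e (i + j)%N.
  rewrite /e -addnACA; exact: (bridge_weight_mul htheta hk hm).
have e0 j : 0 <= e j by apply: (bridge_weight_ge0 htheta hk hm).
have e1 : 0 < e 1%N := bridge_weight2 htheta hk hm.
have powers q : y ^+ (q * N + N) <= e (q * N + N)%N.
  elim: q => [|q IH]; first by rewrite mul0n.
  rewrite mulSn addnAC -[(N + N + q * N)%N]addnA exprD.
  apply: le_trans _ (eM _ _); apply: ler_pM => //; rewrite ?exprn_ge0 ?(ltW y0) //.
  by rewrite [(N + q * N)%N]addnC.
have rests r j : e j * e 1%N ^+ r <= e (j + r)%N.
  elim: r => [|r IH]; first by rewrite mulr1 addn0.
  rewrite exprSr mulrA addnS -[(j + r).+1]addn1; apply: le_trans _ (eM _ _).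
  by rewrite ler_wpM2r // ltW.
(* Fewer than N bridges of length 2 are added, at a cost of at least a^N. *)
pose a := Num.min 1 (e 1%N).
have a0 : 0 < a by rewrite lt_min ltr01.
have a1 : a <= 1 by rewrite ge_min lexx.
have even j : (N <= j)%N -> a ^+ N * y ^+ j <= e j.
  move=> hj; have hq : (0 < j %/ N)%N by rewrite divn_gt0.
  have ej : j = ((j %/ N).-1 * N + N + j %% N)%N.
    by rewrite {1}(divn_eq j N) -mulSnr prednK.
  rewrite {2}ej; apply: le_trans _ (rests _ _); rewrite mulrC.
  apply: ler_pM; rewrite ?exprn_ge0 ?(ltW y0) ?(ltW a0) //.
    apply: le_trans _ (powers _); apply: ler_wiXn2l; [exact: ltW|exact: ltW|].
    by rewrite {2}ej leq_addr.
  apply: (@le_trans _ _ (a ^+ (j %% N))).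
    by apply: ler_wiXn2l => //; [exact: ltW|rewrite ltnW // ltn_mod].
  by apply: lerXn2r; rewrite ?nnegrE ?(ltW a0) ?(ltW e1) // ge_min lexx orbT.
pose c := a ^+ N * Num.min 1 (weight_u1 theta).
exists c; first by rewrite mulr_gt0 ?exprn_gt0 // lt_min ltr01.
exists (N + N)%N => n hn; rewrite -(odd_double_half n); set j := n./2.
have hj : (N <= j)%N by rewrite /j -[N]doubleK leq_half_double -addnn; lia.
have aj := even j hj.
have yj i : (j <= i)%N -> y ^+ i <= y ^+ j by move=> h; apply: ler_wiXn2l; rewrite ?ltW.
have aN : 0 < a ^+ N by rewrite exprn_gt0.
case: (odd n) => /=.
  rewrite add1n -addnn; apply: le_trans _ (total_weight_succ htheta hk hm _).
  apply: (@le_trans _ _ (a ^+ N * y ^+ j * weight_u1 theta)); last by rewrite ler_wpM2r // ltW.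
  rewrite /c mulrAC -!mulrA ler_pM2l //; apply: ler_pM.
  - by rewrite exprn_ge0 // ltW.
  - by rewrite le_min ler01 ltW.
  - by apply: yj; rewrite -addSn leq_addl.
  - by rewrite ge_min lexx orbT.
rewrite add0n -addnn; apply: le_trans _ (bridge_weight_le htheta hk hm _).
apply: le_trans aj; rewrite /c mulrAC -mulrA ler_pM2l // -[leRHS]mulr1; apply: ler_pM.
- by rewrite exprn_ge0 // ltW.
- by rewrite le_min ler01 ltW.
- by apply: yj; rewrite leq_addl.
- by rewrite ge_min lexx.
Qed.
End LowerBound.

Lemma root_cvg1 (R : realType) (W : nat -> R) :
  (forall x : R, 0 < x < 1 -> exists C, forall n, W n * x ^+ n <= C) ->
  (forall x : R, 0 < x < 1 -> exists2 c, 0 < c & exists N, forall n, (N <= n)%N -> c * x ^+ n <= W n) ->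
  (fun n => W n `^ (n%:R)^-1) @ \oo --> (1 : R).
Proof.
move=> hupper hlower; apply/cvgrPdist_le => eps eps0.
(* Since a = x^2, one factor x^n absorbs the constants [c] and [C'] for large n. *)
pose a := (1 + eps)^-1; pose x := Num.sqrt a.
have s0 : 0 < 1 + eps by rewrite addr_gt0.
have a0 : 0 < a by rewrite invr_gt0.
have a1 : a < 1 by rewrite invf_lt1 // ltrDl.
have x0 : 0 < x by rewrite sqrtr_gt0.
have x1 : x < 1 by rewrite -[ltRHS]sqrtr1 ltr_sqrt.
have hx : 0 < x < 1 by rewrite x0.
have xx : x * x = a by rewrite -expr2 sqr_sqrtr // ltW.
have [C hC] := hupper x hx; have [c c0 [N hN]] := hlower x hx.
pose C' := Num.max 1 C.
have C0 : 0 < C' by rewrite lt_max ltr01.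
have small t : 0 < t -> \forall n \near \oo, x ^+ n <= t.
  by move=> t0; apply: cvgr_le (cvg_expr _) _ t0; rewrite ger0_norm // ltW.
near=> n.
have n0 : (0 < n)%N by near: n; exact: nbhs_infty_gt.
have nN : (N <= n)%N by near: n; exact: nbhs_infty_ge.
have xc : x ^+ n <= c by near: n; exact: small.
have xC : x ^+ n <= C'^-1 by near: n; apply: small; rewrite invr_gt0.
have xn : 0 < x ^+ n by rewrite exprn_gt0.
have low : a ^+ n <= W n.
  by rewrite -xx exprMn (le_trans _ (hN n nN)) // ler_pM2r.
have high : W n <= (1 + eps) ^+ n.
  have -> : (1 + eps) ^+ n = (x ^+ n)^-1 * (x ^+ n)^-1.
    by rewrite -invfM -exprMn xx -exprVn /a invrK.
  rewrite -ler_pdivrMr ?invr_gt0 // invrK; apply: le_trans (hC n) _.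
  apply: (@le_trans _ _ C'); first by rewrite le_max lexx orbT.
  by rewrite -[C']invrK lef_pV2 ?posrE ?invr_gt0.
have root t : 0 < t -> (t ^+ n) `^ (n%:R)^-1 = t.
  move=> t0; rewrite -powR_mulrn ?(ltW t0) // -powRrM mulfV ?pnatr_eq0 -?lt0n //.
  by rewrite powRr1 // ltW.
have W0 : 0 <= W n by apply: le_trans low; rewrite exprn_ge0 // ltW.
have i0 : 0 <= (n%:R : R)^-1 by rewrite invr_ge0.
have l1 : a <= W n `^ (n%:R)^-1.
  by rewrite -[leLHS]root // ge0_ler_powR // nnegrE exprn_ge0 // ltW.
have l2 : W n `^ (n%:R)^-1 <= 1 + eps.
  by rewrite -[leRHS]root // ge0_ler_powR // nnegrE exprn_ge0 // ltW.
have l3 : 1 - eps <= a.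
  rewrite -(ler_pM2r s0) mulVf ?gt_eqF // mulrBl mul1r mulrDr mulr1.
  by have := mulr_gt0 eps0 eps0; lra.
by rewrite ler_norml; apply/andP; split; lra.
Unshelve. all: by end_near.
Qed.

Lemma c_tilde_map (R : realType) (u1 u2 v w1 w2 : R) k m (F F' : edge -> edge) o n :
  lattice_symmetry F -> lattice_symmetry F' -> cancel F F' -> cancel F' F ->
  c_tilde u1 u2 v w1 w2 k m (F o) n = c_tilde u1 u2 v w1 w2 k m o n.
Proof.
move=> hF hF' FK FK'; rewrite /c_tilde; congr (_ * _).
rewrite (reindex_fsbig (map F) (saws_from k m o n)).
  by apply: eq_fsbigr => g _; exact: (wt_map hF).
have maps G a g : lattice_symmetry G -> saws_from k m a n g -> saws_from k m (G a) n (map G g).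
  move=> hG [hs ho hl]; split; first exact: saw_map.
  - by case: g ho {hs hl} => // b g [->].
  - by rewrite walk_length_map.
split.
- by move=> g; exact: maps.
- by move=> g h _ _; apply: inj_map; exact: can_inj FK.
- move=> g hg; exists (map F' g); last by rewrite /= mapK.
  by rewrite -(FK o); exact: maps.
Qed.

(** Translations carry [origin] to every horizontal edge, and the transposition carries these to the
    vertical ones. *)
Lemma c_tilde_origin (R : realType) (u1 u2 v w1 w2 : R) k m o n :
  c_tilde u1 u2 v w1 w2 k m o n = c_tilde u1 u2 v w1 w2 k m origin n.
Proof.
have horizontal i j : c_tilde u1 u2 v w1 w2 k m (hedge i j) n = c_tilde u1 u2 v w1 w2 k m origin n.
  rewrite -shift_origin; apply: (c_tilde_map _ _ _ _ _ _ _ _ _ (shift_symmetry i j) (shift_symmetry (- i) (- j))).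
    by move=> [t [a b]]; rewrite /shift /= !addrK.
  by move=> [t [a b]]; rewrite /shift /= !subrK.
case: o => [[] [i j]]; last exact: horizontal.
rewrite -(horizontal j i) -[(true, (i, j))]/(transpose (hedge j i)).
by apply: (c_tilde_map _ _ _ _ _ _ _ _ _ transpose_symmetry transpose_symmetry) => -[[] [a b]].
Qed.

Theorem theorem1p2 (R : realType) (theta : R)
    (htheta : pi / 3 <= theta <= 2 * pi / 3)
    (k m : nat) (hk : (0 < k)%N) (hm : (0 < m)%N) (o : edge) :
  (fun n : nat =>
     c_tilde (weight_u1 theta) (weight_u2 theta) (weight_v theta)
             (weight_w1 theta) (weight_w2 theta) k m o n `^ (n%:R)^-1)
    @ \oo --> 1 / weight_u1 theta.
Proof.
have [hu1 _ _] := weights_gt0 htheta.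
have hW := @root_cvg1 R (total_weight theta k m)
  (fun x hx => total_weight_upper htheta hk hm hx) (fun x hx => total_weight_lower htheta hk hm hx).
rewrite div1r -[(weight_u1 theta)^-1]mulr1.
have W0 n : 0 <= total_weight theta k m n.
  exact: bounded_sum_ge0 (total_weight_bounded htheta hk hm (n := n)).
apply: cvg_trans (cvgMl_tmp (a := (weight_u1 theta)^-1) hW).
(* For n > 0 the nth root of u1^-n is u1^-1; at n = 0 the exponent is 0. *)
apply: near_eq_cvg; near=> n.
have n0 : (0 < n)%N by near: n; exact: nbhs_infty_gt.
rewrite c_tilde_origin /c_tilde (fsbig_total_weight htheta hk hm) powRM ?invr_ge0 ?exprn_ge0 ?(ltW hu1) //.
congr (_ * _); rewrite -exprVn -powR_mulrn ?invr_ge0 ?(ltW hu1) // -powRrM mulfV ?pnatr_eq0 -?lt0n //.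
by rewrite powRr1 // invr_ge0 ltW.
Unshelve. all: by end_near.
Qed.
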